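(* Assume that $g(x,y)>0$ for all $(x,y)\in\mathsf{X}\times\mathsf{Y}$ and that $\mathbb{E}[\ln^+\|g\langle Y_0\rangle\|_\infty]<\infty$. Then for every bounded measurable function $h:\mathsf{X}\to\mathbb{R}$, every real $p>0$, every initial distribution $\chi$ on $(\mathsf{X},\mathcal{X})$ and every $n\in\mathbb{N}^*$, $\mathbb{P}$-a.s., $$\lim_{N\to\infty}\sqrt{N}\;\mathbb{E}^{1/p}\Big(\big|\phi_\chi^N\langle Y_0^{n-1}\rangle h-\phi_\chi\langle Y_0^{n-1}\rangle h\big|^p\,\Big|\,Y_0^{n-1}\Big)=\sqrt{2}\,\sigma_\chi\langle Y_0^{n-1}\rangle(h)\left(\frac{\Gamma((p+1)/2)}{\sqrt{\pi}}\right)^{1/p},$$ where $\Gamma$ is the gamma function.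
   Context: Notation: $\mathbb{N}=\{0,1,2,\dots\}$, $\mathbb{N}^*=\{1,2,\dots\}$; $\ln^+x=\max(\ln x,0)$; $u_k^m=(u_k,\dots,u_m)$; $\|f\|_\infty=\sup_{x\in\mathsf{X}}|f(x)|$; for a measure $\mu$, a kernel $\mathbf{K}$ and a function $f$: $\mu f=\int f\,d\mu$, $\mathbf{K}f(x)=\int f(x')\mathbf{K}(x,dx')$, $\mu\mathbf{K}f=\int\mu(dx)\mathbf{K}f(x)$; $\mathbb{E}^{1/p}(\cdot\,|\,\cdot)$ is the conditional expectation raised to the power $1/p$. Model: $(\mathsf{X},\mathcal{X})$ (with $\mathcal{X}$ countably generated) and $(\mathsf{Y},\mathcal{Y})$ are measurable spaces, $\mathbf{Q}$ is a Markov kernel on $(\mathsf{X},\mathcal{X})$, $\nu$ is a $\sigma$-finite measure on $(\mathsf{Y},\mathcal{Y})$, and $g:\mathsf{X}\times\mathsf{Y}\to(0,\infty)$ is measurable with $\int g(x,y)\,\nu(dy)=1$ for all $x$. Write $g\langle y\rangle(x)=g(x,y)$. For $k\le m$ let $$\mathbf{L}\langle y_k^m\rangle(x_k,\mathsf{A})=\int\cdots\int \mathbf{1}_{\mathsf{A}}(x_{m+1})\prod_{\ell=k}^m g(x_\ell,y_\ell)\,\mathbf{Q}(x_\ell,dx_{\ell+1}),$$ and $\mathbf{L}\langle y_k^m\rangle(x,\mathsf{A})=\delta_x(\mathsf{A})$ for $k>m$. For a probability measure $\chi$ on $(\mathsf{X},\mathcal{X})$ (initial distribution) let $\phi_\chi\langle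 y_k^m\rangle(\mathsf{A})=\chi\mathbf{L}\langle y_k^m\rangle\mathbf{1}_{\mathsf{A}}/\chi\mathbf{L}\langle y_k^m\rangle\mathbf{1}_{\mathsf{X}}$ (predictor), so $\phi_\chi\langle y_k^m\rangle=\chi$ when $k>m$. Asymptotic variance: for bounded measurable $h$, $\sigma_\chi\langle y_0^{n-1}\rangle(h)\ge0$ is the square root of $$\sigma_\chi^2\langle y_0^{n-1}\rangle(h)=\sum_{k=0}^n\int\phi_\chi\langle y_0^{k-1}\rangle(dx)\left(\frac{\mathbf{L}\langle y_k^{n-1}\rangle h(x)-\phi_\chi\langle y_0^{n-1}\rangle h\times\mathbf{L}\langle y_k^{n-1}\rangle\mathbf{1}_{\mathsf{X}}(x)}{\phi_\chi\langle y_0^{k-1}\rangle\mathbf{L}\langle y_k^{n-1}\rangle\mathbf{1}_{\mathsf{X}}}\right)^2.$$ Observations: $(Y_n)_{n\in\mathbb{Z}}$ is a $\mathsf{Y}$-valued strictly stationary process on a probability space with probability $\mathbb{P}$ and expectation $\mathbb{E}$; it is not assumed to be generated by the hidden Markov model with transition kernel $\mathbf{Q}$ and observation density $g$. Bootstrap particle filter with $N$ particles: conditionally on the observations, draw $\xi_0^1,\dots,\xi_0^N$ i.i.d. from $\chi$; for $m\ge0$, given $(\xi_m^i)_{i=1}^N$, set $\omega_m^i=g(\xi_m^i,Y_m)$ and $\Omega_m^N=\sum_{i=1}^N\omega_m^i$, and conditionally independently for $i=1,\dots,N$ draw an index $I_m^i$ from $\{1,\dots,N\}$ with probabilities $(\omega_m^\ell/\Omega_m^N)_{\ell=1}^N$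 and then $\xi_{m+1}^i\sim\mathbf{Q}(\xi_m^{I_m^i},\cdot)$. The particle predictor is $\phi_\chi^N\langle Y_0^{n-1}\rangle=N^{-1}\sum_{i=1}^N\delta_{\xi_n^i}$. *)

(* Defs.v *)
(* MathComp-Analysis. *)
From HB Require Import structures.
From mathcomp Require Import all_boot all_order all_algebra.
From mathcomp Require Import all_classical all_reals all_analysis.
From mathcomp Require Import measurable_realfun.

Set Implicit Arguments.
Unset Strict Implicit.
Unset Printing Implicit Defensive.
Import Order.TTheory GRing.Theory Num.Theory.
Import numFieldNormedType.Exports.

Local Open Scope classical_set_scope.
Local Open Scope ring_scope.

Definition countably_generated d (T : measurableType d) : Prop :=
  exists2 C : set (set T), countable C & @measurable d T = <<s C >>.

Section kernel_operations.
Local Open Scope ereal_scope.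

(* A kernel seen as a parameterized kernel ignoring its first argument, so that
   the library composition [l \; ksnd k] is x |-> \int[l x]_y k y. *)
Section ksnd.
Context d0 d1 d2 (T0 : measurableType d0) (T1 : measurableType d1)
  (T2 : measurableType d2) (R : realType).

Definition ksnd (k : T1 -> {measure set T2 -> \bar R}) (z : T0 * T1) :
  {measure set T2 -> \bar R} := k z.2.

Let measurable_ksnd (k : R.-ker T1 ~> T2) U :
  measurable U -> measurable_fun [set: (T0 * T1)%type] (fun z => ksnd k z U).
Proof.
move=> mU.
exact: (measurableT_comp (measurable_kernel k U mU) measurable_snd).
Qed.

HB.instance Definition _ (k : R.-ker T1 ~> T2) :=
  isKernel.Build _ _ _ _ _ (ksnd k) (measurable_ksnd k).

Definition ksnd_fin (k : R.-fker T1 ~> T2) : T0 * T1 -> {measure set T2 -> \bar R} :=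
  ksnd k.

Let ksnd_uub (k : R.-fker T1 ~> T2) : measure_fam_uub (ksnd_fin k).
Proof. by have [r kr] := measure_uub k; exists r => z; exact: kr. Qed.

HB.instance Definition _ (k : R.-fker T1 ~> T2) :=
  isKernel.Build _ _ _ _ _ (ksnd_fin k) (measurable_ksnd k).

HB.instance Definition _ (k : R.-fker T1 ~> T2) :=
  Kernel_isFinite.Build _ _ _ _ _ (ksnd_fin k) (ksnd_uub k).

Let ksnd_sfinite (k : R.-sfker T1 ~> T2) :
  exists s : (R.-fker (T0 * T1) ~> T2)^nat,
  forall z U, measurable U -> ksnd k z U = kseries s z U.
Proof.
have [s ks] := sfinite_kernel k.
by exists (fun n => ksnd_fin (s n)) => z U mU; rewrite /ksnd ks.
Qed.

HB.instance Definition _ (k : R.-sfker T1 ~> T2) :=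
  Kernel_isSFinite.Build _ _ _ _ _ (ksnd k) (ksnd_sfinite k).

End ksnd.

Definition mkcomp_snd d0 d1 d2 (T0 : measurableType d0)
    (T1 : measurableType d1) (T2 : measurableType d2) (R : realType)
    (l : R.-sfker T0 ~> T1) (k : R.-sfker T1 ~> T2) : R.-sfker T0 ~> T2 :=
  l \; ksnd k.

Section measure_kernel.
Context d1 d2 (T1 : measurableType d1) (T2 : measurableType d2) (R : realType)
  (mu : {measure set T1 -> \bar R}) (k : R.-ker T1 ~> T2).

(* the measure mu K *)
Definition mkmeasure (A : set T2) : \bar R := \int[mu]_x k x A.

Let mkmeasure0 : mkmeasure set0 = 0.
Proof. by apply: integral0_eq => x _; rewrite measure0. Qed.

Let mkmeasure_ge0 A : 0 <= mkmeasure A. Proof. exact: integral_ge0. Qed.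

Let mkmeasure_sigma_additive : semi_sigma_additive mkmeasure.
Proof.
move=> U mU tU mUU; rewrite [X in _ --> X](_ : _ =
  \int[mu]_x (\sum_(n <oo) k x (U n))); last first.
  apply: eq_integral => x _.
  by apply/esym/cvg_lim => //; exact/measure_semi_sigma_additive.
apply/cvg_closeP; split.
  by apply: is_cvg_nneseries => n _ _; exact: integral_ge0.
rewrite closeE// integral_nneseries// => n.
exact: measurable_kernel.
Qed.

HB.instance Definition _ := isMeasure.Build _ _ _
  mkmeasure mkmeasure0 mkmeasure_ge0 mkmeasure_sigma_additive.

End measure_kernel.

End kernel_operations.

Section weighted_kernel.
Local Open Scope ereal_scope.
Context dX dY (X : measurableType dX) (Y : measurableType dY) (R : realType).
Variables (Q : R.-pker X ~> X) (g : {mfun (X * Y)%type >-> R}).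

(* The kernel A |-> g(x, y) Q(x, A). The absolute value only serves to have a
   measure for arbitrary g; it is inert for a positive density. *)
Definition gQ (y : Y) (x : X) : {measure set X -> \bar R} :=
  mscale (`|g (x, y)|%:nng)%R (Q x).

Let measurable_absg y : measurable_fun [set: X] (fun x => `|g (x, y)|)%R.
Proof.
by apply: measurableT_comp => //; apply: measurableT_comp.
Qed.

Let measurable_gQ y U : measurable U -> measurable_fun [set: X] (gQ y ^~ U).
Proof.
move=> mU; apply: emeasurable_funM; last exact: measurable_kernel.
by apply/measurable_EFinP; exact: measurable_absg.
Qed.

HB.instance Definition _ y :=
  isKernel.Build _ _ _ _ _ (gQ y) (@measurable_gQ y).

(* gQ y is s-finite, being the sum over n of its restrictions to the points x
   with n <= g(x, y) < n + 1. *)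
Definition gslice y (n : nat) : set X :=
  [set x | (n%:R <= `|g (x, y)| < n.+1%:R)%R].

Let measurable_gslice y n : measurable (gslice y n).
Proof.
have := @measurable_absg y measurableT _
  (measurable_itv `[n%:R, n.+1%:R[%R).
rewrite setTI; suff -> : (fun x => `|g (x, y)|%R) @^-1` `[n%:R, n.+1%:R[%classic
  = gslice y n by [].
by apply/seteqP; split=> x; rewrite /gslice/= in_itv.
Qed.

Definition gQ_slice y (n : nat) (x : X) : {measure set X -> \bar R} :=
  mscale (`|g (x, y) * \1_(gslice y n) x|%:nng)%R (Q x).

Let measurable_gQ_slice y n U :
  measurable U -> measurable_fun [set: X] (gQ_slice y n ^~ U).
Proof.
move=> mU; apply: emeasurable_funM; last exact: measurable_kernel.
apply/measurable_EFinP; apply: measurableT_comp => //.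
apply: measurable_funM; last exact: measurable_indic.
exact: measurableT_comp.
Qed.

HB.instance Definition _ y n :=
  isKernel.Build _ _ _ _ _ (gQ_slice y n) (@measurable_gQ_slice y n).

Let gQ_slice_uub y n : measure_fam_uub (gQ_slice y n).
Proof.
exists n.+1%:R => x; rewrite /gQ_slice/= /mscale/= prob_kernel mule1 lte_fin.
rewrite normrM indicE; have [|_] := boolP (x \in gslice y n).
  by rewrite inE => /andP[_]; rewrite normr1 mulr1.
by rewrite normr0 mulr0.
Qed.

HB.instance Definition _ y n :=
  Kernel_isFinite.Build _ _ _ _ _ (gQ_slice y n) (@gQ_slice_uub y n).

Let gQ_sfinite y : exists s : (R.-fker X ~> X)^nat,
  forall x U, measurable U -> gQ y x U = kseries s x U.
Proof.
exists (fun n => gQ_slice y n) => x U mU.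
rewrite /kseries/= /mseries (@nneseriesD1 _ _ (Num.truncn `|g (x, y)|)%R)//.
rewrite eseries0 ?adde0; last first.
  move=> n _ /= nE; rewrite /gQ_slice/= /mscale/= indicE memNset ?mulr0 ?normr0 ?mul0e//.
  move=> /andP[n1 n2]; move/negP: nE; apply; rewrite eq_sym.
  by rewrite truncn_eq ?n1 ?n2.
rewrite /gQ_slice /gQ/= /mscale/= indicE mem_set ?mulr1//.
by rewrite /gslice/=; apply/andP; split; [rewrite truncn_le|rewrite truncnS_gt].
Qed.

HB.instance Definition _ y :=
  Kernel_isSFinite.Build _ _ _ _ _ (gQ y) (@gQ_sfinite y).

End weighted_kernel.

Section hidden_markov_model.
Local Open Scope ereal_scope.
Context dX dY (X : measurableType dX) (Y : measurableType dY) (R : realType).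
Variables (Q : R.-pker X ~> X) (g : {mfun (X * Y)%type >-> R}).

(* Blocks of observations y_k^m are sequences [:: y_k; ...; y_m], the empty
   sequence being the case k > m. *)
Fixpoint L (s : seq Y) : R.-sfker X ~> X :=
  if s is y :: s' then mkcomp_snd (gQ Q g y) (L s')
  else kdirac (@measurable_id _ X setT).

(* The total mass of chi L is in ]0, +oo[ whenever g is positive and the
   functions g(., y), y \in s, are bounded; [mnormalize] is then the division by
   the total mass, and its default value chi is not used. *)
Definition predictor (chi : probability X R) (s : seq Y) : probability X R :=
  mnormalize (mkmeasure chi (L s)) chi.

Local Open Scope ring_scope.

Definition Lint (s : seq Y) (f : X -> R) (x : X) : R := \int[L s x]_z f z.

(* With s = y_0^{n-1}: take k s = y_0^{k-1} and drop k s = y_k^{n-1}. *)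
Definition asymptotic_variance (chi : probability X R) (s : seq Y)
    (h : X -> R) : R :=
  \sum_(0 <= k < (size s).+1)
    \int[predictor chi (take k s)]_x
      ((Lint (drop k s) h x
          - (\int[predictor chi s]_z h z) * Lint (drop k s) (cst 1) x)
        / (\int[predictor chi (take k s)]_z Lint (drop k s) (cst 1) z)) ^+ 2.

Definition asymptotic_std (chi : probability X R) (s : seq Y) (h : X -> R) : R :=
  Num.sqrt (asymptotic_variance chi s h).

End hidden_markov_model.

(* The sup norm of g(., y), +oo if this function is unbounded. *)
Definition supnorm_at dX dY (X : measurableType dX) (Y : measurableType dY)
    (R : realType) (g : X * Y -> R) (y : Y) : \bar R :=
  ereal_sup (range (fun x => `|g (x, y)|%:E)).

Definition lneplus (R : realType) (x : \bar R) : \bar R := maxe (lne x) 0%E.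

Definition Gamma (R : realType) (a : R) : R :=
  \int[lebesgue_measure]_(t in `]0, +oo[) (t `^ (a - 1) * expR (- t)).

Section probability_space.
Context d (W : measurableType d) (R : realType) (P : probability W R).

(* <<s generators K Z >> is the sigma-algebra sigma(Z_i, i \in K). *)
Definition generators dT (T : measurableType dT) (I : Type) (K : set I)
    (Z : I -> W -> T) : set (set W) :=
  \bigcup_(i in K) preimage_set_system setT (Z i) measurable.

(* Z is an (integrable) version of the conditional expectation of f given
   <<s G >>. *)
Definition is_cond_expectation (G : set (set W)) (f Z : W -> R) : Prop :=
  [/\ forall B, measurable B -> <<s G>> (Z @^-1` B),
      P.-integrable setT (EFin \o Z) &
      forall A, <<s G>> A ->
        (\int[P]_(w in A) (Z w)%:E = \int[P]_(w in A) (f w)%:E)%E].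

Section observations.
Context dY (Y : measurableType dY) (Yobs : int -> {RV P >-> Y}).

Definition strictly_stationary : Prop :=
  forall (m : nat) (t : 'I_m -> int) (s : int) (A : set (m.-tuple Y)),
    measurable A ->
    P [set w | A [tuple Yobs (t i + s) w | i < m]] =
    P [set w | A [tuple Yobs (t i) w | i < m]].

Definition obs_block (n : nat) (w : W) : seq Y :=
  [seq Yobs k%:Z w | k <- iota 0 n].

Context dX (X : measurableType dX) (Q : R.-pker X ~> X)
  (g : {mfun (X * Y)%type >-> R}) (chi : probability X R) (N : nat).
Variables (xi : nat -> 'I_N -> {RV P >-> X}) (anc : nat -> 'I_N -> W -> 'I_N).

(* <<s filter_past m >> is the sigma-algebra of all the observations, of the
   particles up to time m and of the ancestor indices drawn before time m. *)
Definition filter_past (m : nat) : set (set W) :=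
  generators setT Yobs
  `|` \bigcup_(k in [set k | (k <= m)%N]) generators setT (xi k)
  `|` \bigcup_(k in [set k | (k < m)%N]) \bigcup_(i in [set: 'I_N])
        preimage_set_system setT (anc k i) setT.

(* The i-th factor in the last clause is the conditional probability that the
   pair (I_m^i, xi_{m+1}^i) lies in {a i} x A i; the product over i expresses the
   conditional independence. *)
Definition bootstrap_filter : Prop :=
  [/\ forall m i j, measurable (anc m i @^-1` [set j]),
      forall A : 'I_N -> set X, (forall i, measurable (A i)) ->
        is_cond_expectation (generators setT Yobs)
          (\1_[set w | forall i, A i (xi 0%N i w)])
          (fun=> \prod_i fine (chi (A i))) &
      forall m (a : 'I_N -> 'I_N) (A : 'I_N -> set X),
        (forall i, measurable (A i)) ->
        is_cond_expectation (filter_past m)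
          (\1_[set w | forall i, anc m i w = a i /\ A i (xi m.+1 i w)])
          (fun w => \prod_i
             (g (xi m (a i) w, Yobs m%:Z w)
                / (\sum_(l < N) g (xi m l w, Yobs m%:Z w))
              * fine (Q (xi m (a i) w) (A i))))].

(* the integral of h with respect to N^{-1} \sum_i \delta_{xi_n^i} *)
Definition particle_predictor (n : nat) (h : X -> R) (w : W) : R :=
  N%:R^-1 * \sum_(i < N) h (xi n i w).

End observations.
End probability_space.

(* Main.v *)
Require Import Defs.
From HB Require Import structures.
From mathcomp Require Import all_boot all_order all_algebra.
From mathcomp Require Import all_classical all_reals all_analysis.
From mathcomp Require Import measurable_realfun ring lra.

Set Implicit Arguments.
Unset Strict Implicit.
Unset Printing Implicit Defensive.
Import Order.TTheory GRing.Theory Num.Theory.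
Import numFieldNormedType.Exports.

Local Open Scope classical_set_scope.
Local Open Scope ring_scope.

(** Given the observations, the particles form a Markov chain, and the theorem is a
    central limit theorem for this chain together with the convergence of absolute
    moments: sqrt N times the error of the particle predictor is asymptotically normal
    with mean 0 and variance sigma^2, and the p-th absolute moment of that normal law is
    (sqrt 2 sigma)^p Gamma((p+1)/2) / sqrt pi.

    The central limit theorem is an induction on time with characteristic functions.
    Let phi be the predictor at time m and phi' the next one, and put G = g(., y_m).
    Given the particles at time m, the next ones are an independent sample of a mixture
    whose mean of f is the ratio of the empirical means of G Qf and of G. The error at
    time m+1 is therefore the sum of the sampling error and of the error of this ratio;
    the latter is the error at time m of the phi-centred function
    gbar = G (Qf - phi' f), divided by the empirical mean of G. Hence the variances
    satisfy V'(f) = Var_phi' f + V(gbar) / (phi G)^2 ([step_gaussian_cf]), which is also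
    the recursion of the asymptotic variance ([asymptotic_varianceS]). All the estimates
    carry a rate 1 / sqrt N, and the same decomposition propagates bounds on the even
    moments that are uniform in N ([step_bounded_moments]). The random denominator has
    no lower bound; when it is small its own fluctuation is large, which is enough
    ([ratio_fluctuation]).

    The passage from characteristic functions to absolute moments ([cvg_moment]) rests
    on the formula c |x|^p = \int_0^oo (1 - cos (t x))^k t^(-1-p) dt, valid for
    2k >= p + 1: it expresses moments by characteristic functions, and bounded moments
    of order 2k make dominated convergence applicable.

    Two points concern the random observations. The conditional expectations defining
    the filter determine the joint law of the observations and the particles
    ([filter_law]), so that the conditional error is the integral of the error against
    the law of the chain with the observations frozen ([cond_moment]). Moreover the
    recursion needs g(., Y_m) to be bounded for 0 <= m < n, whereas the moment
    assumption bounds it for m = 0, and the supremum over x may not be a measurable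
    function of the observation. The property used instead is that g(., y_m) is
    essentially bounded for the unnormalized predictor of y_0, ..., y_{m-1}; it is
    measurable, so stationarity applies to it ([ae_essentially_bounded]). The particles
    almost surely avoid the exceptional set, and g may be truncated ([law_limit]). *)

(** * Elementary inequalities for the sine, cosine and exponential *)

Section elementary_inequalities.
Context {R : realType}.
Implicit Types x u a b : R.

Lemma ge0_derive_le (f df : R -> R) x :
  (forall y : R, is_derive y (1 : R) f (df y)) ->
  (forall y, 0 <= y -> 0 <= df y) -> 0 <= x -> f 0 <= f x.
Proof.
move=> fdf df0 x0.
have [|c /[!in_itv]/= /andP[c0 _] fc] := @MVT_segment R f df 0 x x0.

  apply: continuous_subspaceT => y; apply: differentiable_continuous.
  exact/derivable1_diffP.
by rewrite -subr_ge0 fc subr0 mulr_ge0// df0.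
Qed.

Lemma sin_le_id x : 0 <= x -> sin x <= x.
Proof.
move=> x0; rewrite -subr_ge0.
have := @ge0_derive_le (fun y => y - sin y) (fun y => 1 - cos y) x.
by rewrite sin0 subr0; apply.
Qed.

Lemma is_derive_mulXn (c y : R) n :
  is_derive y (1 : R) (fun y : R => c * y ^+ n.+1) (c * (n.+1%:R * y ^+ n)).
Proof.
have := is_deriveZ c (is_deriveX n.+1 (is_derive_id y (1 : R))).
rewrite (_ : c \*: _ = (fun y : R => c * y ^+ n.+1)); last first.
  by apply/funext => z/=; rewrite /GRing.scale/= exprfctE.
by move=> H; apply: is_derive_eq; rewrite /GRing.scale/= mulr1.
Qed.

Lemma cos_ge_quad x : 1 - 2^-1 * x ^+ 2 <= cos x.
Proof.
wlog x0 : x / 0 <= x.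
  move=> H; have [/H//|x0] := leP 0 x.
  by rewrite -cosN -sqrrN H// oppr_ge0 ltW.
rewrite -subr_ge0.
have := @ge0_derive_le (fun y => cos y - (1 - 2^-1 * y ^+ 2)) (fun y => y - sin y) x.
rewrite cos0 expr0n/= mulr0 subr0 subrr; apply => // y; last first.
  by move=> y0; rewrite subr_ge0 sin_le_id.
have ? := @is_derive_mulXn 2^-1 y 1.
apply: is_derive_eq; lra.
Qed.

Lemma sin_ge_cubic x : 0 <= x -> x - 6^-1 * x ^+ 3 <= sin x.
Proof.
move=> x0; rewrite -subr_ge0.
have := @ge0_derive_le (fun y => sin y - (y - 6^-1 * y ^+ 3))
  (fun y => cos y - (1 - 2^-1 * y ^+ 2)) x.
rewrite sin0 expr0n/= mulr0 subr0 subrr; apply => // y; last first.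
  by move=> _; rewrite subr_ge0 cos_ge_quad.
have ? := @is_derive_mulXn 6^-1 y 2.
apply: is_derive_eq; lra.
Qed.

Lemma cos_le_quartic x : cos x <= 1 - 2^-1 * x ^+ 2 + 24^-1 * x ^+ 4.
Proof.
wlog x0 : x / 0 <= x.
  move=> H; have [/H//|x0] := leP 0 x.
  have := H (- x); rewrite cosN sqrrN (_ : (- x) ^+ 4 = x ^+ 4); last by ring.
  by apply; lra.
rewrite -subr_ge0.
have := @ge0_derive_le (fun y => 1 - 2^-1 * y ^+ 2 + 24^-1 * y ^+ 4 - cos y)
  (fun y => sin y - (y - 6^-1 * y ^+ 3)) x.
rewrite cos0 !expr0n/= !mulr0 subr0 addr0 subrr; apply => // y; last first.
  by move=> y0; rewrite subr_ge0 sin_ge_cubic.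
have ? := @is_derive_mulXn 2^-1 y 1.
have ? := @is_derive_mulXn 24^-1 y 3.
apply: is_derive_eq; lra.
Qed.

(** The second-order expansion of the cosine at a, with a cubic error uniform in
    a: this drives the one-particle step of the central limit theorem. *)
Lemma cos_Taylor2 a u :
  `|cos (a + u) - (cos a - u * sin a - 2^-1 * u ^+ 2 * cos a)| <= 2 * `|u| ^+ 3.
Proof.
have hs : `|sin u - u| <= `|u| ^+ 3.
  have pos (v : R) : 0 <= v -> `|sin v - v| <= `|v| ^+ 3.
    move=> v0; have := sin_le_id v0; have := sin_ge_cubic v0.
    rewrite (ger0_norm v0) ler_norml => h1 h2.
    by have := exprn_ge0 3 v0; lra.
  have [/pos//|u0] := leP 0 u.
  have := pos (- u); rewrite sinN normrN -opprD normrN; apply; lra.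
have hc : `|cos u - (1 - 2^-1 * u ^+ 2)| <= `|u| ^+ 3.
  have := cos_ge_quad u; have := cos_le_quartic u; have := cos_le1 u.
  have n0 : 0 <= `|u| by [].
  rewrite -[u ^+ 2]real_normK ?num_real// (_ : u ^+ 4 = `|u| ^+ 4); last first.
    by rewrite -[4%N]/(2 * 2)%N !exprM real_normK ?num_real.
  rewrite ler_norml; move: (`|u|) n0 => v v0 h1 h2 h3.
  have [v1|v1] := leP v 1.
    by have := exprn_ge0 3 v0; rewrite [v ^+ 4]exprS in h2; nra.
  by have := exprn_ge0 2 v0; rewrite [v ^+ 3]exprS; nra.
rewrite cosD.
have -> : cos a * cos u - sin a * sin u
    - (cos a - u * sin a - 2^-1 * u ^+ 2 * cos a) =
  cos a * (cos u - (1 - 2^-1 * u ^+ 2)) - sin a * (sin u - u) by ring.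
rewrite (le_trans (ler_normB _ _))// !normrM.
rewrite (_ : 2 * `|u| ^+ 3 = 1 * `|u| ^+ 3 + 1 * `|u| ^+ 3); last by ring.
by apply: lerD; apply: ler_pM => //; rewrite ?cos_max ?sin_max //.
Qed.

Lemma expRN_Taylor1 x : 0 <= x -> `|expR (- x) - (1 - x)| <= x ^+ 2.
Proof.
move=> x0; rewrite ler_norml.
have h1 := expR_ge1Dx (- x); have h2 := expR_ge1Dx x.
have e0 := expR_gt0 (- x).
have : expR (- x) * expR x = 1 by rewrite expRN mulVf// gt_eqF// expR_gt0.
move: (expR x) (expR (- x)) h1 h2 e0 => e e' h1 h2 e0 ee.
have : e' * (1 + x) <= 1 by rewrite -[leRHS]ee ler_pM2l.
have : 0 <= x ^+ 2 by rewrite exprn_ge0.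
nra.
Qed.

Lemma expR_le_quad u : u <= 2^-1 -> expR u <= 1 + u + 2 * u ^+ 2.
Proof.
move=> u2; have h := expR_ge1Dx (- u); have e0 := expR_gt0 u.
have : expR (- u) * expR u = 1 by rewrite expRN mulVf// gt_eqF.
move: (expR u) (expR (- u)) h e0 => e e' h e0 ee.
have : (1 - u) * e <= 1 by rewrite -[leRHS]ee ler_pM2r.
have : 0 <= u ^+ 2 by rewrite sqr_ge0.
have : 1 <= (1 + u + 2 * u ^+ 2) * (1 - u).
  have : 0 <= u ^+ 2 * (1 - 2 * u) by rewrite mulr_ge0 ?sqr_ge0//; lra.
  by rewrite !expr2; lra.
move=> h1 h2 h3; rewrite -(@ler_pM2l _ (1 - u)); last by lra.
by rewrite (le_trans h3)// mulrC.
Qed.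

(** One term of the exponential series bounds a power: even moments are thus
    controlled by exponential ones. *)
Lemma exprn_even_le_expR k x :
  x ^+ k.*2 <= k.*2`!%:R * (expR x + expR (- x)).
Proof.
have pos (v : R) : 0 <= v -> v ^+ k.*2 <= k.*2`!%:R * expR v.
  move=> v0; rewrite mulrC -ler_pdivrMr ?ltr0n ?fact_gt0//.
  case: k => [|k]; first by rewrite expr0 divr1 -expR0 ler_expR.
  have := expR_ge1Dxn (k.*2.+1) v0; rewrite doubleS; apply: le_trans.
  by rewrite lerDr.
have f0 : (0 : R) <= k.*2`!%:R by [].
rewrite mulrDr; have [/pos h|x0] := leP 0 x.
  by rewrite (le_trans h)// lerDl mulr_ge0// expR_ge0.
have := pos (- x); rewrite exprNn -signr_odd odd_double mul1r => h.
by rewrite (le_trans (h _))// ?lerDr ?mulr_ge0// ?expR_ge0//; lra.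
Qed.

End elementary_inequalities.

(** * Integrals of bounded measurable functions *)

Section bounded_measurable.
Context d (T : measurableType d) (R : realType).
Implicit Types (f g : T -> R) (mu : {measure set T -> \bar R}).

(** Unlike the structure of measurable functions, this predicate is closed under
    the operations below without any packing, and it makes all integrals against
    probability measures finite. *)
Definition bmeas f := measurable_fun setT f /\ exists M, forall x, `|f x| <= M.

Lemma bmeas_cst c : bmeas (cst c).
Proof. by split => //; exists `|c|. Qed.

Lemma bmeasD f g : bmeas f -> bmeas g -> bmeas (fun x => f x + g x).
Proof.
move=> [mf [M fM]] [mg [M' gM]]; split; first exact: measurable_funD.
by exists (M + M') => x; rewrite (le_trans (ler_normD _ _))// lerD.
Qed.

Lemma bmeasN f : bmeas f -> bmeas (fun x => - f x).
Proof.
move=> [mf [M fM]]; split; first exact: measurableT_comp.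
by exists M => x; rewrite normrN.
Qed.

Lemma bmeasB f g : bmeas f -> bmeas g -> bmeas (fun x => f x - g x).
Proof. by move=> mf mg; apply: bmeasD => //; exact: bmeasN. Qed.

Lemma bmeasM f g : bmeas f -> bmeas g -> bmeas (fun x => f x * g x).
Proof.
move=> [mf [M fM]] [mg [M' gM]]; split; first exact: measurable_funM.
by exists (M * M') => x; rewrite normrM ler_pM.
Qed.

Lemma bmeasX f n : bmeas f -> bmeas (fun x => f x ^+ n).
Proof.
move=> mf; elim: n => [|n ih]; first exact: bmeas_cst.
by under eq_fun do rewrite exprS; exact: bmeasM.
Qed.

Lemma bmeas_sum (I : Type) (r : seq I) (F : I -> T -> R) :
  (forall i, bmeas (F i)) -> bmeas (fun x => \sum_(i <- r) F i x).
Proof.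
move=> mF; elim: r => [|i r ih].
  by under eq_fun do rewrite big_nil; exact: bmeas_cst.
by under eq_fun do rewrite big_cons; exact: bmeasD.
Qed.

Lemma bmeas_prod (I : Type) (r : seq I) (F : I -> T -> R) :
  (forall i, bmeas (F i)) -> bmeas (fun x => \prod_(i <- r) F i x).
Proof.
move=> mF; elim: r => [|i r ih].
  by under eq_fun do rewrite big_nil; exact: bmeas_cst.
by under eq_fun do rewrite big_cons; exact: bmeasM.
Qed.

Lemma bmeas_norm f : bmeas f -> bmeas (fun x => `|f x|).
Proof.
move=> [mf [M fM]]; split; first exact: measurableT_comp.
by exists M => x; rewrite normr_id.
Qed.

Lemma bmeas_cos f : measurable_fun setT f -> bmeas (fun x => cos (f x)).
Proof.
move=> mf; split; last by exists 1 => x; exact: cos_max.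
apply: measurableT_comp mf; apply: continuous_measurable_fun.
exact: continuous_cos.
Qed.

Lemma bmeas_expR f : bmeas f -> bmeas (fun x => expR (f x)).
Proof.
move=> [mf [M fM]]; split; first exact: measurableT_comp.
exists (expR M) => x; rewrite ger0_norm ?expR_ge0// ler_expR.
exact: le_trans (ler_norm _) _.
Qed.

Lemma bmeas_powR f p : 0 <= p -> bmeas f -> bmeas (fun x => `|f x| `^ p).
Proof.
move=> p0 [mf [M fM]]; split.
  apply: (measurableT_comp (measurable_powR p)).
  exact: measurableT_comp.
exists (M `^ p) => x; rewrite ger0_norm ?powR_ge0//.
by rewrite ge0_ler_powR ?nnegrE// (le_trans _ (fM x)).
Qed.

Lemma bmeas_indic A : measurable A -> bmeas (\1_A : T -> R).
Proof.
move=> mA; split; first exact: measurable_indic.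
by exists 1 => x; rewrite indicE; case: (_ \in _); rewrite ?normr1 ?normr0.
Qed.

Lemma bmeas_ge0_bound f : bmeas f -> exists2 M, 0 < M & forall x, `|f x| <= M.
Proof.
move=> [_ [M fM]]; exists (`|M| + 1) => [|x]; first by rewrite ltr_wpDl.
by rewrite (le_trans (fM x))// (le_trans (ler_norm M))// lerDl.
Qed.

Lemma bmeas_fin_integrable (mu : {measure set T -> \bar R}) f :
  (mu setT < +oo)%E -> bmeas f -> mu.-integrable setT (EFin \o f).
Proof.
move=> mufin mf; have [M M0 fM] := bmeas_ge0_bound mf.
apply: measurable_bounded_integrable => //; first exact: mf.1.
exists M; split; first exact: num_real.
by move=> x Mx y _ /=; rewrite (le_trans (fM y))// ltW.
Qed.

(** If the integral is infinite, both sides are 0, as [fine] sends infinities to 0. *)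
Lemma ge0_RintZ (mu : {measure set T -> \bar R}) (c : R) f : 0 < c ->
  measurable_fun setT f -> (forall x, 0 <= f x) ->
  \int[mu]_x (c * f x) = c * \int[mu]_x f x.
Proof.
move=> c0 mf f0; rewrite /Rintegral; under eq_integral do rewrite EFinM.
rewrite ge0_integralZl//; last 3 first.
- exact/measurable_EFinP.
- by move=> x _; rewrite lee_fin.
- by rewrite lee_fin ltW.
case: (integral _ _ _) => [r| |] //=.
- by rewrite gt0_muley ?lte_fin//= mulr0.
- by rewrite gt0_muleNy ?lte_fin//= mulr0.
Qed.

Section integral.
Variables (mu : {measure set T -> \bar R}) (mu1 : mu setT = 1%E).

Lemma bmeas_integrable f : bmeas f -> mu.-integrable setT (EFin \o f).
Proof. by apply: bmeas_fin_integrable; rewrite mu1 ltry. Qed.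

Lemma bmeas_EFin f : bmeas f -> (\int[mu]_x (f x)%:E)%E = (\int[mu]_x f x)%:E.
Proof.
move=> /bmeas_integrable fi; rewrite /Rintegral fineK//.
exact: integrable_fin_num.
Qed.

Lemma RintD f g : bmeas f -> bmeas g ->
  \int[mu]_x (f x + g x) = \int[mu]_x f x + \int[mu]_x g x.
Proof. by move=> /bmeas_integrable ? /bmeas_integrable ?; exact: RintegralD. Qed.

Lemma RintB f g : bmeas f -> bmeas g ->
  \int[mu]_x (f x - g x) = \int[mu]_x f x - \int[mu]_x g x.
Proof. by move=> /bmeas_integrable ? /bmeas_integrable ?; exact: RintegralB. Qed.

Lemma RintZ c f : bmeas f -> \int[mu]_x (c * f x) = c * \int[mu]_x f x.
Proof. by move=> /bmeas_integrable ?; exact: RintegralZl. Qed.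

Lemma RintZr c f : bmeas f -> \int[mu]_x (f x * c) = (\int[mu]_x f x) * c.
Proof. by move=> /bmeas_integrable ?; exact: RintegralZr. Qed.

Lemma Rint_cst c : \int[mu]_x c = c.
Proof. by rewrite Rintegral_cst// mu1 mulr1. Qed.

Lemma Rint_sum (I : Type) (r : seq I) (F : I -> T -> R) :
  (forall i, bmeas (F i)) ->
  \int[mu]_x (\sum_(i <- r) F i x) = \sum_(i <- r) \int[mu]_x F i x.
Proof.
move=> mF; elim: r => [|i r ih].
  by under eq_Rintegral do rewrite big_nil; rewrite Rint_cst big_nil.
under eq_Rintegral do rewrite big_cons.
by rewrite RintD// ?ih ?big_cons//; exact: bmeas_sum.
Qed.

Lemma le_Rint f g : bmeas f -> bmeas g -> (forall x, f x <= g x) ->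
  \int[mu]_x f x <= \int[mu]_x g x.
Proof.
by move=> /bmeas_integrable ? /bmeas_integrable ? fg; apply: le_Rintegral.
Qed.

Lemma le_norm_Rint f : bmeas f -> `|\int[mu]_x f x| <= \int[mu]_x `|f x|.
Proof. by move=> /bmeas_integrable ?; exact: le_normr_Rintegral. Qed.

Lemma Rint_ge0 f : (forall x, 0 <= f x) -> 0 <= \int[mu]_x f x.
Proof. by move=> f0; apply: Rintegral_ge0. Qed.

Lemma Rint_le_cst f c : bmeas f -> (forall x, f x <= c) -> \int[mu]_x f x <= c.
Proof.
move=> mf fc; rewrite -[leRHS]Rint_cst.
by apply: le_Rint => //; exact: bmeas_cst.
Qed.

Lemma norm_Rint_le_cst f c : bmeas f -> (forall x, `|f x| <= c) ->
  `|\int[mu]_x f x| <= c.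
Proof.
move=> mf fc; apply: (le_trans (le_norm_Rint mf)).
by apply: Rint_le_cst => //; exact: bmeas_norm.
Qed.

Lemma ae_eq_Rint f g : bmeas f -> bmeas g -> {ae mu, forall x, f x = g x} ->
  \int[mu]_x f x = \int[mu]_x g x.
Proof.
move=> mf mg fg; rewrite /Rintegral; congr fine.
apply: ae_eq_integral => //.
- by apply/measurable_EFinP; exact: mf.1.
- by apply/measurable_EFinP; exact: mg.1.
- by apply: filterS fg => x /= -> _.
Qed.

Lemma Rint_eq0_ae f : bmeas f -> (forall x, 0 <= f x) ->
  \int[mu]_x f x = 0 -> {ae mu, forall x, f x = 0}.
Proof.
move=> mf f0 i0.
have mfE : measurable_fun [set: T] (EFin \o f).
  by apply/measurable_EFinP; exact: mf.1.
have /(_ mu)[h _] := ae_eq_integral_abs _ measurableT mfE.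
have : ae_eq mu [set: T] (EFin \o f) (cst 0%E).
  apply: h; rewrite -[RHS]/(0%R%:E) -i0 -bmeas_EFin//.
  by apply: eq_integral => x _ /=; rewrite ger0_norm.
by apply: filterS => x /(_ Logic.I) /= [].
Qed.

Lemma Rint_var f : bmeas f ->
  \int[mu]_x (f x - \int[mu]_y f y) ^+ 2 =
  \int[mu]_x f x ^+ 2 - (\int[mu]_x f x) ^+ 2.
Proof.
move=> bf; set c := \int[mu]_y f y.
have -> : \int[mu]_x (f x - c) ^+ 2 = \int[mu]_x ((f x ^+ 2 - (2 * c) * f x) + c ^+ 2).
  by apply: eq_Rintegral => x _; ring.
have bcf : bmeas (fun x => 2 * c * f x) by apply: bmeasM => //; exact: bmeas_cst.
rewrite RintD//; last 2 first.
- by apply: bmeasB => //; exact: bmeasX.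
- exact: bmeas_cst.
rewrite RintB//; last exact: bmeasX.
by rewrite RintZ// Rint_cst// -/c; ring.
Qed.

Lemma Rint_var_ge0 f : bmeas f ->
  0 <= \int[mu]_x f x ^+ 2 - (\int[mu]_x f x) ^+ 2.
Proof. by move=> bf; rewrite -Rint_var//; apply: Rint_ge0 => x; rewrite sqr_ge0. Qed.

Lemma le_Rint_ae f g : bmeas f -> bmeas g -> {ae mu, forall x, f x <= g x} ->
  \int[mu]_x f x <= \int[mu]_x g x.
Proof.
move=> bf bg fg; have [M M0 fM] := bmeas_ge0_bound bf.
have [M' M'0 gM] := bmeas_ge0_bound bg.
have bD h : bmeas h -> bmeas (fun x => h x + (M + M')).
  by move=> bh; apply: bmeasD => //; exact: bmeas_cst.
have f0 x : 0 <= f x + (M + M') by have := fM x; rewrite ler_norml; move: M'0; lra.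
have g0 x : 0 <= g x + (M + M') by have := gM x; rewrite ler_norml; move: M0; lra.
rewrite -(lerD2r (M + M')) -[M + M']Rint_cst -!RintD//; try exact: bmeas_cst.
rewrite -lee_fin -!bmeas_EFin; [|exact: bD|exact: bD].
apply: ae_ge0_le_integral => //.
- by move=> x _; rewrite lee_fin.
- by apply/measurable_EFinP; exact: (bD _ bf).1.
- by move=> x _; rewrite lee_fin.
- by apply/measurable_EFinP; exact: (bD _ bg).1.
- by apply: filterS fg => x h _; rewrite lee_fin lerD2r.
Qed.

Lemma not_ae_False : ~ {ae mu, forall x : T, False}.
Proof.
move=> [A [mA A0 TA]].
have AT : A = setT by apply/seteqP; split => // x _; exact: TA.
by move: A0; rewrite AT mu1 => /eqP; rewrite onee_eq0.
Qed.

Lemma Rint_gt0 f : bmeas f -> (forall x, 0 < f x) -> 0 < \int[mu]_x f x.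
Proof.
move=> mf f0; have f0' x : 0 <= f x by exact: ltW.
rewrite lt_neqAle Rint_ge0// andbT eq_sym; apply/eqP => i0.
apply: not_ae_False; apply: filterS (Rint_eq0_ae mf f0' i0) => x.
by apply/eqP; rewrite gt_eqF.
Qed.

End integral.
End bounded_measurable.

Section as_probability.
Context d (T : measurableType d) (R : realType).
Variables (m : {measure set T -> \bar R}) (m1 : m setT = 1%E).

(** A measure of mass 1 packed as a probability, for results stated for
    sigma-finite measures. *)
Definition as_probability_of (_ : m setT = 1%E) : set T -> \bar R := m.

HB.instance Definition _ := Measure.on (as_probability_of m1).

Let as_probability_setT : as_probability_of m1 setT = 1%E. Proof. exact: m1. Qed.

HB.instance Definition _ :=
  Measure_isProbability.Build _ _ _ (as_probability_of m1) as_probability_setT.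

Definition as_probability : probability T R := as_probability_of m1.

End as_probability.

(** * Change of variables on the positive half-line *)

Section substitution_0y.
Context {R : realType}.
Let mu := @lebesgue_measure R.

Lemma bigcup_itvcy (b : R^nat) : (forall n, 0 < b n) -> b @ \oo --> 0 ->
  \bigcup_n `[b n, +oo[%classic = `]0, +oo[%classic :> set R.
Proof.
move=> b0 bn; apply/seteqP; split => x /=.
  by move=> [n _] /=; rewrite !in_itv/= !andbT => /(lt_le_trans (b0 n)).
rewrite in_itv/= andbT => x0.
have [N _ NH] : \forall n \near \oo, b n < x by exact: cvgr_lt bn _ x0.
by exists N => //=; rewrite in_itv/= andbT ltW// NH/=.
Qed.

Lemma measurable_fun_0y (f : R -> R) : {in `]0, +oo[, continuous f} ->
  measurable_fun (`]0, +oo[%classic : set R) f.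
Proof.
move=> cf; apply: open_continuous_measurable_fun => //.
exact/in_continuous_mksetP.
Qed.

(** Since F and its derivative may be singular at 0, the substitution is done on
    the half-lines [1/(n+1), +oo[ and n tends to infinity by monotone
    convergence. *)
Lemma ge0_integral_subst_0y (F F' G : R -> R) :
  (forall x, 0 < x -> 0 < F x) ->
  (forall x y, 0 < x -> x < y -> F x < F y) ->
  (forall x : R, 0 < x -> is_derive x (1 : R) F (F' x)) ->
  (forall x, 0 < x -> 0 <= F' x) -> {in `]0, +oo[, continuous F'} ->
  cvg (F' x @[x --> +oo]) -> F x @[x --> +oo] --> +oo ->
  F x @[x --> 0^'+] --> 0 ->
  {in `]0, +oo[, continuous G} -> (forall x, 0 < x -> 0 <= G x) ->
  (\int[mu]_(x in `]0%R, +oo[) (G x)%:E =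
   \int[mu]_(x in `]0%R, +oo[) (G (F x) * F' x)%:E)%E.
Proof.
move=> F0 Fi dF F'0 cF' cvF' Fy F00 cG G0.
pose a (n : nat) : R := n.+1%:R^-1.
have a0 n : 0 < a n by rewrite invr_gt0 ltr0n.
have acv : a @ \oo --> 0 by exact: cvg_harmonic.
have aR n : a n.+1 <= a n by rewrite lef_pV2 ?posrE ?ltr0n// ler_nat.
have ami : {homo a : n m / (n <= m)%N >-> m <= n} by exact/nonincreasing_seqP.
have Fam : {homo (F \o a) : n m / (n <= m)%N >-> m <= n}.
  move=> n m /ami; rewrite le_eqVlt => /predU1P[/= -> //|nm /=].
  by apply/ltW/Fi.
have Facv : (F \o a) @ \oo --> 0.
  move/cvg_at_rightP : F00; apply; split => //; exact: a0.
have cF : {in `]0, +oo[, continuous F}.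
  move=> x; rewrite in_itv/= andbT => /dF dFx.
  by apply/differentiable_continuous/derivable1_diffP; exact: ex_derive.
have F'E (x : R) : 0 < x -> derive1 F x = F' x.
  by move=> /dF dFx; rewrite derive1E; exact: derive_val.
have cGF : {in `]0, +oo[, continuous (fun x => G (F x) * F' x)}.
  move=> x x0; apply: cvgM; last exact: cF'.
  apply: continuous_comp; first exact: cF.
  by apply: cG; move: x0; rewrite !in_itv/= !andbT; exact: F0.
have step n : (\int[mu]_(x in `[F (a n), +oo[) (G x)%:E =
   \int[mu]_(x in `[a n, +oo[) (G (F x) * F' x)%:E)%E.
  have F'near (y : R) : 0 < y -> \forall z \near y, F' z = derive1 F z.
    move=> y0; near=> z; rewrite F'E//; near: z.
    exact: lt_nbhsr.
  rewrite increasing_ge0_integration_by_substitutiony.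
  - apply: eq_integral => x; rewrite inE/= in_itv/= andbT => ax.
    by rewrite -F'E// (lt_le_trans (a0 n)).
  - move=> x y; rewrite !in_itv/= !andbT => ax ay; apply: Fi.
    exact: lt_le_trans ax.
  - move=> x; rewrite in_itv/= andbT => ax.
    have x0 : 0 < x by exact: lt_trans ax.
    rewrite /continuous_at F'E//.
    apply: cvg_trans (cF' x _); last by rewrite in_itv/= andbT.
    by apply: near_eq_cvg; exact: F'near.
  - apply/cvg_ex; exists (F' (a n)).
    apply: (@cvg_trans _ (F' x @[x --> (a n)^'+])).
      apply: near_eq_cvg; apply: cvg_within; exact: F'near.
    apply: cvg_at_right_filter; apply: cF'.
    by rewrite in_itv/= andbT.
  - move/cvg_ex : cvF' => [l F'l]; apply/cvg_ex; exists l.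
    apply: cvg_trans F'l; apply: near_eq_cvg.
    near=> z; rewrite F'E//; near: z; exact: nbhs_pinfty_gt.
  - split.
      move=> x; rewrite in_itv/= andbT => ax.
      by apply: ex_derive; apply: dF; exact: lt_trans ax.
    apply: cvg_at_right_filter; apply: cF; by rewrite in_itv/= andbT.
  - exact: Fy.
  - apply: continuous_in_subspaceT => x; rewrite inE/= in_itv/= andbT => Fx.
    by apply: cG; rewrite in_itv/= andbT (lt_le_trans _ Fx)// F0.
  - by move=> x; rewrite in_itv/= andbT => Fx; rewrite G0// (lt_trans _ Fx)// F0.
have expand (b : R^nat) (H : R -> R) : (forall n, 0 < b n) ->
    {homo b : n m / (n <= m)%N >-> m <= n} ->
    b @ \oo --> 0 -> {in `]0, +oo[, continuous H} ->
    (forall x, 0 < x -> 0 <= H x) ->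
    (\int[mu]_(x in `[b n, +oo[) (H x)%:E)%E @[n --> \oo] -->
    (\int[mu]_(x in `]0%R, +oo[) (H x)%:E)%E.
  move=> b0 bmi bcv cH H0; rewrite -(bigcup_itvcy b0 bcv).
  apply: ge0_nondecreasing_set_cvg_integral => //.
  - move=> n m nm; apply/subsetPset => x /=; rewrite !in_itv/= !andbT.
    by apply: le_trans; exact: bmi.
  - move=> n; apply/measurable_EFinP.
    apply: measurable_funS (measurable_fun_0y cH) => //.
    move=> x /=; rewrite !in_itv/= !andbT; exact: lt_le_trans.
  - move=> n x /=; rewrite in_itv/= andbT => bx; rewrite lee_fin H0//.
    exact: lt_le_trans bx.
have GF0 x : 0 < x -> 0 <= G (F x) * F' x.
  by move=> x0; rewrite mulr_ge0// ?G0 ?F0// F'0.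
have h1 := expand (F \o a) G (fun n => F0 _ (a0 n)) Fam Facv cG G0.
have h2 := expand a (fun x => G (F x) * F' x) a0 ami acv cGF GF0.
rewrite -(cvg_lim _ h1)// -(cvg_lim _ h2)//.
by congr (lim (_ @ \oo)); apply/funext => n; rewrite step.
Unshelve. all: by end_near. Qed.
End substitution_0y.

(** * Power functions and absolute Gaussian moments *)

Section power_integrals.
Context {R : realType}.
Let mu := @lebesgue_measure R.

Lemma continuous_norm_powR (p : R) : 0 < p -> continuous (fun x : R => `|x| `^ p).
Proof.
move=> p0 x; have [->|x0] := eqVneq x 0.
  apply/cvgrPdist_lt => e e0; near=> z.
  rewrite normr0 powR0 ?gt_eqF// sub0r normrN ger0_norm ?powR_ge0//.
  have -> : e = (e `^ p^-1) `^ p by rewrite -powRrM mulVf ?gt_eqF// powRr1// ltW.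
  apply: gt0_ltr_powR; rewrite ?nnegrE ?powR_ge0//.
  by near: z; apply: (@nbhs0_lt _ R^o); exact: powR_gt0.
apply: (@continuous_comp _ _ _ (fun x : R => `|x|) (fun y => y `^ p)).
  exact: norm_continuous.
apply: differentiable_continuous; apply/derivable1_diffP.
by apply: derivable_powR; rewrite in_itv/= andbT normr_gt0.
Unshelve. all: by end_near. Qed.

Lemma continuous_powR_0y (p : R) : {in `]0, +oo[, continuous (fun x : R => x `^ p)}.
Proof.
move=> x x0; apply: differentiable_continuous; apply/derivable1_diffP.
exact: derivable_powR.
Qed.

Lemma cvgy_powR (p : R) : 0 < p -> (x `^ p @[x --> +oo]) --> +oo.
Proof.
move=> p0; apply/cvgryPge => A; near=> x.
have x0 : `|A| `^ p^-1 <= x by near: x; exact: nbhs_pinfty_ge.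
rewrite (le_trans (ler_norm A))//.
have -> : `|A| = (`|A| `^ p^-1) `^ p by rewrite -powRrM mulVf ?gt_eqF// powRr1.
by rewrite ge0_ler_powR ?nnegrE ?powR_ge0 ?(ltW p0)// (le_trans _ x0)// powR_ge0.
Unshelve. all: by end_near. Qed.

Lemma cvgy_powRN (p : R) : 0 < p -> (x `^ (- p) @[x --> +oo]) --> 0.
Proof.
move=> p0; under eq_fun do rewrite powRN.
apply/gtr0_cvgV0; last exact: cvgy_powR.
by near=> x; apply: powR_gt0; near: x; exact: nbhs_pinfty_gt.
Unshelve. all: by end_near. Qed.

(** By symmetry the right-hand side is twice the integral over the positive
    half-line, where the substitution x = sqrt t yields the Gamma integral. *)
Lemma Gamma_gauss_moment (p : R) : 0 < p ->
  Gamma ((p + 1) / 2) = \int[mu]_x (`|x| `^ p * gauss_fun x).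
Proof.
move=> p0; rewrite /Gamma /Rintegral; congr fine.
rewrite ge0_symfun_integralT; last 3 first.
- by move=> x; rewrite mulr_ge0 ?powR_ge0 ?gauss_fun_ge0.
- move=> x; apply: cvgM; first exact: continuous_norm_powR.
  exact: continuous_gauss_fun.
- by move=> x /=; rewrite normrN /gauss_fun sqrrN.
rewrite -set_itvcy.
have cG : continuous (fun x : R => `|x| `^ p * gauss_fun x).
  move=> x; apply: cvgM; first exact: continuous_norm_powR.
  exact: continuous_gauss_fun.
rewrite -integral_itv_obnd_cbnd; last first.
  by apply/measurable_EFinP; apply: measurable_funTS; exact: continuous_measurable_fun.
rewrite (@ge0_integral_subst_0y R (fun t => t `^ 2^-1)
  (fun t => 2^-1 * t `^ (2^-1 - 1)) (fun x => `|x| `^ p * gauss_fun x)); last 9 first.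
- by move=> x; exact: powR_gt0.
- move=> x y x0 xy; apply: gt0_ltr_powR; rewrite ?nnegrE//; lra.
- by move=> x x0; rewrite mulr_ge0 ?powR_ge0.
- move=> x x0; apply: cvgM; [exact: cvg_cst|exact: continuous_powR_0y].
- apply/cvg_ex; exists 0; rewrite (_ : 2^-1 - 1 = - 2^-1); last by lra.
  by rewrite -[X in _ --> X](mulr0 2^-1); apply: cvgM; [exact: cvg_cst|exact: cvgy_powRN].
- exact: cvgy_powR.
- exact: powR_cvg0.
- by move=> x _; exact: cG.
- by move=> x _; rewrite mulr_ge0 ?powR_ge0 ?gauss_fun_ge0.
rewrite -ge0_integralZl//; last 2 first.
- apply/measurable_EFinP; apply: measurable_fun_0y => x x0.
  apply: cvgM; last by apply: cvgM; [exact: cvg_cst|exact: continuous_powR_0y].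
  apply: (@continuous_comp _ _ _ (fun t : R => t `^ 2^-1)
    (fun x => `|x| `^ p * gauss_fun x)); last exact: cG.
  exact: continuous_powR_0y.
- by move=> x _; rewrite lee_fin !mulr_ge0 ?powR_ge0 ?gauss_fun_ge0.
apply: eq_integral => x; rewrite inE/= in_itv/= andbT => x0.
rewrite -EFinM; congr EFin.
rewrite /gauss_fun (ger0_norm (powR_ge0 _ _)) -powRrM -(powR_mulrn 2) ?powR_ge0//.
rewrite -powRrM mulVf ?powRr1 ?(ltW x0)//.
rewrite (_ : 2 * _ = x `^ (2^-1 * p) * x `^ (2^-1 - 1) * expR (- x)); last first.
  by field.
rewrite -powRD; last by rewrite (gt_eqF x0) implybT.
by congr (_ `^ _ * _); lra.
Qed.

End power_integrals.

(** * The Gaussian characteristic function *)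

Section gaussian_characteristic_function.
Context {R : realType}.
Let mu := @lebesgue_measure R.

Lemma integrable_half_gauss :
  mu.-integrable setT (fun x : R => (expR (- x ^+ 2 / 2))%:E).
Proof.
have := @integrable_normal_pdf R 0 1.
move=> /(integrableZl measurableT (normal_peak 1)^-1).
congr (integrable _ _ _); apply/funext => x; rewrite /= -EFinM normal_pdfE ?oner_eq0//.
rewrite /= /normal_fun mulrA mulVf ?mul1r; last first.
  by rewrite gt_eqF// normal_peak_gt0// oner_eq0.
by rewrite subr0 expr1n -mulr_natr mul1r.
Qed.

(** Half of the Gaussian exponent absorbs the linear growth of f, the other half
    is integrable. *)
Lemma gauss_dominated (f : R -> R) : measurable_fun setT f ->
  (exists c, forall x, `|f x| <= c * (1 + `|x|)) ->
  mu.-integrable setT (fun x => (f x * gauss_fun x)%:E).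
Proof.
move=> mf [c fc].
have c0 : 0 <= c by have := fc 0; rewrite normr0 addr0 mulr1; exact: le_trans.
apply: (@le_integrable _ _ _ mu setT measurableT _
  (EFin \o (fun x => (2 * c) * expR (- x ^+ 2 / 2)))).
- apply/measurable_EFinP; apply: measurable_funM => //.
  exact: measurable_gauss_fun.
- move=> x _; rewrite /= lee_fin [leRHS]ger0_norm ?mulr_ge0 ?expR_ge0//.
  rewrite normrM [X in _ * X]ger0_norm ?gauss_fun_ge0//.
  have -> : gauss_fun x = expR (- x ^+ 2 / 2) * expR (- x ^+ 2 / 2).
    by rewrite -expRD /gauss_fun; congr expR; field.
  rewrite mulrA ler_pM2r ?expR_gt0//.
  have : (1 + `|x|) * expR (- x ^+ 2 / 2) <= 2.
    rewrite mulNr expRN -ler_pdivlMr ?invr_gt0 ?expR_gt0// invrK.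
    have := expR_ge1Dx (x ^+ 2 / 2); rewrite -[x ^+ 2]real_normK ?num_real//.
    move: (expR _) => e; have : 0 <= (`|x| - 2^-1) ^+ 2 by rewrite sqr_ge0.
    by rewrite !expr2; lra.
  have := fc x; have := expR_gt0 (- x ^+ 2 / 2); move: (expR _) => e e0 h1 h2.
  by rewrite (le_trans (ler_wpM2r (ltW e0) h1))//; nra.
- exact: (integrableZl measurableT _ integrable_half_gauss).
Qed.

Lemma integral_derive_eq0 (f F : R -> R) : continuous f ->
  (forall x : R, is_derive x (1 : R) F (f x)) ->
  mu.-integrable setT (EFin \o f) ->
  (fun n : nat => F n%:R) @ \oo --> 0 ->
  (fun n : nat => F (- n%:R)) @ \oo --> 0 ->
  (\int[mu]_x (f x)%:E = 0)%E.
Proof.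
move=> cf dF fi Fy FNy.
have mf : measurable_fun setT f by exact: continuous_measurable_fun.
pose I n : set R := `[- n%:R, n%:R]%classic.
pose f_ n := (EFin \o f) \_ (I n).
have mI n : measurable (I n) by exact: measurable_itv.
have cF : continuous F.
  move=> x; apply/differentiable_continuous/derivable1_diffP.
  exact: ex_derive.
have step n : (\int[mu]_x f_ n.+1 x = (F n.+1%:R - F (- n.+1%:R))%:E)%E.
  rewrite -integral_mkcond (@continuous_FTC2 _ f F).
  - by rewrite EFinB.
  - by rewrite (@lt_trans _ _ 0)// ?oppr_lt0 ltr0n.
  - exact: continuous_subspaceT.
  - split; [by move=> x _; exact: ex_derive| |].
    + by apply: cvg_at_right_filter; exact: cF.
    + by apply: cvg_at_left_filter; exact: cF.
  - by move=> x _; rewrite derive1E derive_val.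
have h0 : (fun n => \int[mu]_x f_ n.+1 x)%E @ \oo --> 0%E.
  under eq_fun do rewrite step.
  apply: cvg_EFin; first exact: nearW.
  rewrite /comp /= -[X in _ --> X](subr0 0); apply: cvgB.
    by rewrite (cvg_shiftS (fun n => F n%:R)).
  by rewrite (cvg_shiftS (fun n => F (- n%:R))).
have [|||||_ _] := @dominated_convergence _ _ _ mu setT measurableT
  (fun n => f_ n.+1) (EFin \o f) (fun x => `|f x|%:E).
- move=> n; apply/(measurable_restrictT _ (mI _)).
  by apply/measurable_EFinP; apply: measurable_funTS.
- exact/measurable_EFinP.
- apply: aeW => x _; apply: cvg_near_cst.
  near=> n; rewrite /f_ patchE ifT// inE /I/= in_itv/= -ler_norml.
  rewrite (@le_trans _ _ n%:R)//; last by rewrite ler_nat.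
  near: n; exact: nbhs_infty_ger.
- exact: (integrable_norm fi).
- apply: aeW => x n _; rewrite /f_ patchE; case: ifPn => _ //=.
  by rewrite normr0 lee_fin.
- move=> h1; have := cvg_unique _ h1 h0; exact.
Unshelve. all: by end_near. Qed.

Lemma is_derive_gauss (x : R) :
  is_derive x (1 : R) (@gauss_fun R) (- (2 * x) * gauss_fun x).
Proof.
rewrite /gauss_fun; apply: is_derive_eq.
rewrite /GRing.scale/=; ring.
Qed.

Lemma is_derive_sin_scale (t x : R) :
  is_derive x (1 : R) (fun y : R => sin (t * y)) (t * cos (t * x)).
Proof. by apply: is_derive_eq; rewrite /GRing.scale/=; ring. Qed.

Lemma is_derive_cos_scale (t x : R) :
  is_derive t (1 : R) (fun s : R => cos (s * x)) (- (x * sin (t * x))).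
Proof. by apply: is_derive_eq; rewrite /GRing.scale/=; ring. Qed.

Lemma continuous_sin_scale (t : R) : continuous (fun y : R => sin (t * y)).
Proof.
move=> x; apply/differentiable_continuous/derivable1_diffP.
by apply: ex_derive; exact: is_derive_sin_scale.
Qed.

Lemma continuous_cos_scale (t : R) : continuous (fun y : R => cos (t * y)).
Proof.
move=> x; apply: (@continuous_comp _ _ _ (fun y : R => t * y) cos).
  by apply: mulrl_continuous.
exact: continuous_cos.
Qed.

Lemma integrable_cos_gauss (t : R) :
  mu.-integrable setT (EFin \o (fun x => cos (t * x) * gauss_fun x)).
Proof.
apply: gauss_dominated.
  by apply: continuous_measurable_fun; exact: continuous_cos_scale.
by exists 1 => x; rewrite mul1r (le_trans (cos_max _))// lerDl.
Qed.

Lemma integrable_xsin_gauss (t : R) :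
  mu.-integrable setT (EFin \o (fun x => (x * sin (t * x)) * gauss_fun x)).
Proof.
apply: gauss_dominated.
  apply: measurable_funM => //.
  by apply: continuous_measurable_fun; exact: continuous_sin_scale.
exists 1 => x; rewrite mul1r normrM (@le_trans _ _ `|x|)//.
  by rewrite ler_piMr// sin_max.
by rewrite lerDr.
Qed.

(** Integration by parts: the derivative of sin (t x) exp (- x^2) integrates to 0
    over the line. *)
Lemma gauss_by_parts (t : R) :
  \int[mu]_x ((x * sin (t * x)) * gauss_fun x) =
  t / 2 * \int[mu]_x (cos (t * x) * gauss_fun x).
Proof.
have h : \int[mu]_x (t * (cos (t * x) * gauss_fun x) -
    2 * ((x * sin (t * x)) * gauss_fun x)) = 0.
  have dF (x : R) : is_derive x (1 : R) (fun x => sin (t * x) * gauss_fun x)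
      (t * (cos (t * x) * gauss_fun x) - 2 * ((x * sin (t * x)) * gauss_fun x)).
    have ? := is_derive_gauss x; have ? := is_derive_sin_scale t x.
    by apply: is_derive_eq; rewrite /GRing.scale/=; ring.
  rewrite /Rintegral (integral_derive_eq0 _ dF)//.
  - move=> x; apply: cvgB; apply: cvgM; (try exact: cvg_cst); apply: cvgM.
    + exact: continuous_cos_scale.
    + exact: continuous_gauss_fun.
    + apply: cvgM; [exact: cvg_id|exact: continuous_sin_scale].
    + exact: continuous_gauss_fun.
  - apply: (@integrableB _ _ _ mu setT measurableT
      (EFin \o (fun x => t * (cos (t * x) * gauss_fun x)))
      (EFin \o (fun x => 2 * ((x * sin (t * x)) * gauss_fun x)))).
    + exact: (integrableZl measurableT _ (integrable_cos_gauss t)).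
    + exact: (integrableZl measurableT _ (integrable_xsin_gauss t)).
  - apply: (@squeeze_cvgr _ _ _ _ (fun n : nat => - gauss_fun (n%:R : R))
      (fun n : nat => gauss_fun (n%:R : R))).
    + apply: nearW => n; rewrite -ler_norml normrM [X in _ * X]ger0_norm ?gauss_fun_ge0//.
      by rewrite ler_piMl ?gauss_fun_ge0 ?sin_max.
    + rewrite -oppr0; apply: cvgN; apply: (cvg_comp _ _ cvgr_idn).
      exact: cvg_gauss_fun.
    + by apply: (cvg_comp _ _ cvgr_idn); exact: cvg_gauss_fun.
  - apply: (@squeeze_cvgr _ _ _ _ (fun n : nat => - gauss_fun (n%:R : R))
      (fun n : nat => gauss_fun (n%:R : R))).
    + apply: nearW => n; rewrite -ler_norml normrM [X in _ * X]ger0_norm ?gauss_fun_ge0//.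
      rewrite [gauss_fun (- _)](_ : _ = gauss_fun (n%:R : R)); last first.
        by rewrite /gauss_fun sqrrN.
      by rewrite ler_piMl ?gauss_fun_ge0 ?sin_max.
    + rewrite -oppr0; apply: cvgN; apply: (cvg_comp _ _ cvgr_idn).
      exact: cvg_gauss_fun.
    + by apply: (cvg_comp _ _ cvgr_idn); exact: cvg_gauss_fun.
move: h; rewrite RintegralB//; last 2 first.
- exact: (integrableZl measurableT _ (integrable_cos_gauss t)).
- exact: (integrableZl measurableT _ (integrable_xsin_gauss t)).
rewrite RintegralZl//; last exact: integrable_cos_gauss.
rewrite RintegralZl//; last exact: integrable_xsin_gauss.
by move=> /eqP; rewrite subr_eq0 => /eqP h; rewrite mulrAC h; field.
Qed.

(** The integral G satisfies G' (t) = - (t / 2) G (t) by differentiation under the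
    integral sign and [gauss_by_parts], so that G (t) exp (t^2 / 4) is constant. *)
Lemma gauss_cf (t : R) : \int[mu]_x (cos (t * x) * gauss_fun x) =
  Num.sqrt pi * expR (- (t ^+ 2 / 4)).
Proof.
pose G s := \int[mu]_x (cos (s * x) * gauss_fun x).
have dG (s : R) : is_derive s (1 : R) G (- (s / 2 * G s)).
  have sI : `](s - 1), (s + 1)[%classic s.
    by rewrite /= in_itv/=; apply/andP; split; lra.
  have dcos (x y : R) : is_derive x (1 : R) (fun z => cos (z * y) * gauss_fun y)
      (- (y * sin (x * y) * gauss_fun y)).
    have ? := is_derive_cos_scale x y.
    by apply: is_derive_eq; rewrite /GRing.scale/=; ring.
  have d1 (x y : R) : partial1of2 (fun x y : R => cos (x * y) * gauss_fun y) x y =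
      - (y * sin (x * y) * gauss_fun y).
    by rewrite partial1of2E derive_val.
  have iG : mu.-integrable setT (EFin \o (fun y : R => `|y| * gauss_fun y)).
    apply: gauss_dominated; first exact: (measurableT_comp (@normr_measurable R setT)).
    by exists 1 => y; rewrite mul1r normr_id lerDr.
  have G0 (y : R) : 0 <= `|y| * gauss_fun y by rewrite mulr_ge0 ?gauss_fun_ge0.
  have ub (x y : R) : `](s - 1), (s + 1)[%classic x -> [set: R] y ->
      `|partial1of2 (fun x y : R => cos (x * y) * gauss_fun y) x y| <= `|y| * gauss_fun y.
    move=> _ _; rewrite d1 normrN !normrM [X in _ * X]ger0_norm ?gauss_fun_ge0//.
    by rewrite ler_wpM2r ?gauss_fun_ge0// ler_piMr// sin_max.
  have id x : `](s - 1), (s + 1)[%classic x ->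
     mu.-integrable setT (EFin \o (fun y : R => cos (x * y) * gauss_fun y)).
    by move=> _; exact: integrable_cos_gauss.
  have dd (x y : R) : `](s - 1), (s + 1)[%classic x -> [set: R] y ->
      derivable (fun x : R => cos (x * y) * gauss_fun y) x 1.
    by move=> _ _; exact: ex_derive.
  apply: DeriveDef.
    exact: (derivable_under_integral measurableT sI id dd G0 iG ub).
  rewrite -derive1E (differentiation_under_integral measurableT sI id dd G0 iG ub).
  under eq_Rintegral do rewrite d1 -mulN1r.
  rewrite RintegralZl//; last exact: integrable_xsin_gauss.
  by rewrite gauss_by_parts mulN1r.
have dH (s : R) : is_derive s (1 : R) (fun s : R => G s * expR (s ^+ 2 / 4)) 0.
  have ? := dG s.
  by apply: is_derive_eq; rewrite /GRing.scale/=; field.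
have := is_derive_0_is_cst t 0 dH.
rewrite expr0n/= mul0r expR0 mulr1 => h.
have G0 : G 0 = Num.sqrt pi.
  rewrite /G; under eq_Rintegral do rewrite mul0r cos0 mul1r.
  by rewrite /Rintegral integralT_gauss.
by rewrite -[LHS]/(G t) -G0 -h expRN -mulrA mulfV ?mulr1// gt_eqF// expR_gt0.
Qed.

End gaussian_characteristic_function.

(** * Fractional powers as integrals of cosines *)

Section fractional_moment_kernel.
Context {R : realType}.
Let mu := @lebesgue_measure R.
Variables (k : nat) (p : R).
Hypotheses (k0 : (0 < k)%N) (p0 : 0 < p) (pk : p + 1 <= k.*2%:R).

Let rho (t : R) : R := t `^ (- (1 + p)).

(** Scaling t shows that the integral over t > 0 of (1 - cos (t x))^k t^(-1-p) is
    this constant times |x|^p ([osc_integral_scale]): a power of |x|, even a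
    fractional one, is a mixture of trigonometric polynomials in x. *)
Definition osc_integral : \bar R :=
  (\int[mu]_(t in `]0%R, +oo[) ((1 - cos t) ^+ k * t `^ (- (1 + p)))%:E)%E.

(** Up to a constant, the smaller of 1 and t^(-1-p), in a form with an explicit
    primitive. *)
Definition osc_dom (t : R) : R := 2 `^ (1 + p) * (1 + t) `^ (- (1 + p)).

Lemma onem_cos_ge0 (t : R) : 0 <= 1 - cos t.
Proof. by rewrite subr_ge0 cos_le1. Qed.

Lemma onem_cos_le (t : R) : (1 - cos t) ^+ k <= 2 ^+ k.
Proof.
rewrite lerXn2r// ?nnegrE ?onem_cos_ge0//.
by have := cos_geN1 t; lra.
Qed.

Lemma onem_cos_le_quad (t : R) : (1 - cos t) ^+ k <= t ^+ k.*2.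
Proof.
rewrite -mul2n exprM lerXn2r// ?nnegrE ?onem_cos_ge0 ?sqr_ge0//.
by have := cos_ge_quad t; have := sqr_ge0 t; lra.
Qed.

Lemma measurable_rho : measurable_fun (`]0, +oo[%classic : set R) rho.
Proof. by apply: measurable_fun_0y; exact: continuous_powR_0y. Qed.

Lemma osc_dom_integrable :
  mu.-integrable (`]0, +oo[%classic : set R) (EFin \o osc_dom).
Proof.
have d1 (x : R) : 0 <= x -> is_derive x (1 : R) (fun x => (1 + x) `^ (- p))
    (- p * (1 + x) `^ (- (1 + p))).
  move=> x0; have x1 : 0 < 1 + x by lra.
  have h := is_derive1_powR (- p) x1.
  have h2 : is_derive x (1 : R) (fun x : R => 1 + x) 1 by apply: is_derive_eq; lra.
  have := @is_derive1_comp R (fun y => y `^ (- p)) (fun x => 1 + x) x _ _ h h2.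
  by rewrite mulr1 (_ : - p - 1 = - (1 + p)); last by ring.
have dF (x : R) : 0 <= x -> is_derive x (1 : R)
    (fun x => - (2 `^ (1 + p) / p) * (1 + x) `^ (- p)) (osc_dom x).
  move=> /d1 dx; apply: is_derive_eq.
  by rewrite /osc_dom /GRing.scale/=; field; rewrite gt_eqF.
have cd (x : R) : 0 <= x -> {for x, continuous osc_dom}.
  move=> x0; apply: cvgM; first exact: cvg_cst.
  apply: (@continuous_comp _ _ _ (fun x : R => 1 + x) (fun y => y `^ (- (1 + p)))).
    by apply: cvgD; [exact: cvg_cst|exact: cvg_id].
  by apply: continuous_powR_0y; rewrite in_itv/= andbT; lra.
have dom0 x : 0 <= osc_dom x by rewrite mulr_ge0 ?powR_ge0.
have md : measurable_fun (`]0, +oo[%classic : set R) osc_dom.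
  apply: measurable_fun_0y => x; rewrite in_itv/= andbT => /ltW; exact: cd.
apply/integrableP; split; first exact/measurable_EFinP.
under eq_integral do rewrite /= ger0_norm//.
rewrite integral_itv_obnd_cbnd; last exact/measurable_EFinP.
rewrite (@ge0_continuous_FTC2y _ _
  (fun x => - (2 `^ (1 + p) / p) * (1 + x) `^ (- p)) 0 0).
- by rewrite -EFinB ltry.
- by move=> x _.
- apply: continuous_in_subspaceT => x; rewrite inE/= in_itv/= andbT.
  exact: cd.
- rewrite -[X in _ --> X](mulr0 (- (2 `^ (1 + p) / p))); apply: cvgM.
    exact: cvg_cst.
  apply: (@cvg_comp _ _ _ (fun x : R => 1 + x) (fun y => y `^ (- p)) _ +oo).
    by apply: cvg_addrl.
  exact: cvgy_powRN.
- by move=> x /ltW /dF ?; exact: ex_derive.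
- have ? := dF _ (lexx 0); apply: cvg_at_right_filter.
  have : derivable (fun x : R => - (2 `^ (1 + p) / p) * (1 + x) `^ (- p)) (0:R) (1:R) by exact: ex_derive.
  by move=> /derivable1_diffP/differentiable_continuous.
- move=> x; rewrite in_itv/= andbT => /ltW/dF ?; by rewrite derive1E derive_val.
Qed.

(** Near 0 the factor t^(2k) compensates for the singularity t^(-1-p), because
    2k >= p + 1; away from 0 boundedness of a suffices. *)
Lemma osc_domP (a A t : R) : 0 < t -> 0 <= A -> 0 <= a -> a <= A ->
  a <= A * t ^+ k.*2 -> a * rho t <= A * osc_dom t.
Proof.
move=> t0 A0 a0 aA aAt.
have r0 : 0 < rho t by exact: powR_gt0.
have [t1|t1] := leP t 1.
  apply: (@le_trans _ _ (A * 1)).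
    rewrite (le_trans (ler_wpM2r (ltW r0) aAt))// -mulrA ler_wpM2l//.
    rewrite /rho -powR_mulrn ?(ltW t0)// -powRD; last by rewrite (gt_eqF t0) implybT.
    rewrite -[leRHS](powRr0 t) ger_powR ?t0//; move: pk; lra.
  rewrite ler_wpM2l// /osc_dom powRN -ler_pdivrMr ?invr_gt0 ?powR_gt0//; last lra.
  by rewrite invrK mul1r ge0_ler_powR ?nnegrE//; move: p0; lra.
rewrite ler_pM ?(ltW r0)//.
rewrite /rho /osc_dom !powRN -(ler_pM2l (powR_gt0 (1 + p) t0)) mulfV ?gt_eqF ?powR_gt0//.
rewrite mulrA -powRM// ?(ltW t0)// ler_pdivlMr ?powR_gt0//; last lra.
rewrite mul1r ge0_ler_powR ?nnegrE//; move: p0; lra.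
Qed.

Lemma osc_integral_fin : (osc_integral < +oo)%E.
Proof.
have mf : measurable_fun (`]0, +oo[%classic : set R)
    (fun t => (1 - cos t) ^+ k * t `^ (- (1 + p))).
  apply: measurable_funM; last exact: measurable_rho.
  apply: measurable_funX; apply: measurable_funB => //.
  by apply: measurable_funTS; apply: continuous_measurable_fun; exact: continuous_cos.
have /integrableP[_ h] : mu.-integrable (`]0, +oo[%classic : set R)
    (fun t => (2 ^+ k)%:E * (osc_dom t)%:E)%E.
  by apply: integrableZl => //; exact: osc_dom_integrable.
apply: le_lt_trans h; apply: ge0_le_integral => //.
- by move=> t _; rewrite lee_fin mulr_ge0 ?powR_ge0 ?exprn_ge0 ?onem_cos_ge0.
- exact/measurable_EFinP.
- apply: measurableT_comp => //.
  apply/measurable_EFinP; apply: measurable_funM => //.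
  apply: measurable_funM => //; apply: (measurable_funTS).
  by apply: (measurableT_comp (measurable_powR _)); apply: measurable_funD.
- move=> t /=; rewrite in_itv/= andbT => t0; rewrite lee_fin.
  rewrite (le_trans _ (ler_norm _))//.
  apply: osc_domP; rewrite ?exprn_ge0 ?onem_cos_ge0 ?onem_cos_le//.
  rewrite (le_trans (onem_cos_le_quad t))// ler_peMl ?exprn_ge0 ?(ltW t0)//.
  by rewrite exprn_ege1// ler1n.
Qed.

(** On [1, 2] one has 1 - cos t >= 1/3, by the quartic bound on the cosine. *)
Lemma osc_integral_gt0 : (0 < osc_integral)%E.
Proof.
pose c : R := 3^-1 ^+ k * 2 `^ (- (1 + p)).
have c0 : 0 < c by rewrite mulr_gt0 ?exprn_gt0 ?powR_gt0 ?invr_gt0.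
have mf : measurable_fun (`]0, +oo[%classic : set R)
    (fun t => (1 - cos t) ^+ k * t `^ (- (1 + p))).
  apply: measurable_funM; last exact: measurable_rho.
  apply: measurable_funX; apply: measurable_funB => //.
  by apply: measurable_funTS; apply: continuous_measurable_fun; exact: continuous_cos.
have sub : `[1, 2]%classic `<=` (`]0, +oo[%classic : set R).
  by move=> t /=; rewrite !in_itv/= andbT => /andP[+ _]; exact: lt_le_trans.
apply: (@lt_le_trans _ _ (\int[mu]_(t in `[1%R, 2%R]) c%:E)%E).
  rewrite integral_cst//= lebesgue_measure_itv/= lte_fin ltr1n/= -EFinB -EFinM lte_fin.
  by rewrite mulr_gt0//; lra.
apply: (@le_trans _ _ (\int[mu]_(t in `[1%R, 2%R])
    ((1 - cos t) ^+ k * t `^ (- (1 + p)))%:E)%E); last first.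
  apply: ge0_subset_integral => //; first exact/measurable_EFinP.
  by move=> t _; rewrite lee_fin mulr_ge0 ?powR_ge0 ?exprn_ge0 ?onem_cos_ge0.
apply: ge0_le_integral => //.
- by move=> t _; rewrite lee_fin ltW.
- by apply/measurable_EFinP; apply: measurable_funS mf.
move=> t /=; rewrite in_itv/= => /andP[t1 t2]; rewrite lee_fin.
have t0 : 0 < t by exact: lt_le_trans t1.
apply: ler_pM; rewrite ?exprn_ge0 ?invr_ge0 ?powR_ge0//.
  rewrite lerXn2r ?nnegrE ?invr_ge0 ?onem_cos_ge0//.
  have := cos_le_quartic t; have : t ^+ 2 * (4 - t ^+ 2) >= 0.
    by rewrite mulr_ge0 ?sqr_ge0// subr_ge0 -[4]/(2 * 2)%:R natrM -expr2 lerXn2r ?nnegrE// ltW.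
  have : 1 <= t ^+ 2 by rewrite exprn_ege1.
  rewrite (_ : t ^+ 4 = t ^+ 2 * t ^+ 2); last by ring.
  by move: (t ^+ 2) => z; lra.
rewrite !powRN lef_pV2 ?posrE ?powR_gt0// ge0_ler_powR ?nnegrE//; move: p0; lra.
Qed.

Lemma osc_integral_scale (x : R) :
  (\int[mu]_(t in `]0%R, +oo[) ((1 - cos (t * x)) ^+ k * t `^ (- (1 + p)))%:E =
   (`|x| `^ p)%:E * osc_integral)%E.
Proof.
have [->|x0] := eqVneq x 0.
  rewrite normr0 powR0 ?gt_eqF// mul0e; apply: integral0_eq => t _.
  by rewrite mulr0 cos0 subrr expr0n gtn_eqF// mul0r.
have y0 : 0 < `|x| by rewrite normr_gt0.
have -> : osc_integral = ((`|x| `^ (- p))%:E * \int[mu]_(t in `]0%R, +oo[)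
    ((1 - cos (t * x)) ^+ k * t `^ (- (1 + p)))%:E)%E; last first.
  by rewrite muleA -EFinM -powRD ?subrr ?powRr0 ?mul1e// (gt_eqF y0) implybT.
have F0 t : 0 < t -> 0 < `|x| * t by move=> t0; rewrite mulr_gt0.
have Fi t s : 0 < t -> t < s -> `|x| * t < `|x| * s.
  by move=> t0 ts; rewrite ltr_pM2l.
have dF (t : R) : 0 < t -> is_derive t (1 : R) (fun t : R => `|x| * t) `|x|.
  by move=> _; apply: is_derive_eq; rewrite /GRing.scale/=; ring.
rewrite /osc_integral (ge0_integral_subst_0y F0 Fi dF).
- rewrite -ge0_integralZl//; last 2 first.
  + apply/measurable_EFinP; apply: measurable_funM; last exact: measurable_rho.
    apply: measurable_funX; apply: measurable_funB => //; apply: measurable_funTS.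
    apply: (measurableT_comp (continuous_measurable_fun (@continuous_cos R))).
    exact: measurable_funM.
  + by move=> t _; rewrite lee_fin mulr_ge0 ?powR_ge0 ?exprn_ge0 ?onem_cos_ge0.
  apply: eq_integral => t; rewrite inE/= in_itv/= andbT => t0.
  rewrite -EFinM; congr EFin; rewrite -(cos_norm (t * x)) normrM (gtr0_norm t0) (mulrC t).
  rewrite powRM ?(ltW t0)// (_ : - p = - (1 + p) + 1); last by ring.
  rewrite [_ `^ (_ + 1)]powRD; last by rewrite (gt_eqF y0) implybT.
  by rewrite powRr1//; ring.
- by [].
- by move=> t _; exact: cvg_cst.
- by apply/cvg_ex; exists `|x|; exact: cvg_cst.
- exact: gt0_cvgMry.
- apply: cvg_at_right_filter; rewrite -[X in _ --> X](mulr0 `|x|).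
  by apply: cvgM; [exact: cvg_cst|exact: cvg_id].
- move=> t t0; apply: cvgM; last exact: continuous_powR_0y.
  apply: (@continuous_comp _ _ _ (fun t : R => 1 - cos t) (fun y => y ^+ k)).
    by apply: cvgB; [exact: cvg_cst|exact: continuous_cos].
  exact: exprn_continuous.
- by move=> t _; rewrite mulr_ge0 ?powR_ge0 ?exprn_ge0 ?onem_cos_ge0.
Qed.

End fractional_moment_kernel.

(** * Fractional moments *)

Section weighted_fractional_moment.
Context {R : realType}.
Let mu := @lebesgue_measure R.
Variables (k : nat) (p : R).
Hypotheses (k0 : (0 < k)%N) (p0 : 0 < p) (pk : p + 1 <= k.*2%:R).

(** [osc_integral_scale] integrated in x, by Tonelli. The weight w makes the lemma
    apply both to the given random variables (w = 1) and to the Gaussian density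
    against Lebesgue measure. *)
Lemma weighted_fractional_moment d (T : measurableType d)
    (m : {sigma_finite_measure set T -> \bar R}) (X w : T -> R) :
  measurable_fun setT X -> measurable_fun setT w -> (forall x, 0 <= w x) ->
  (\int[m]_x (w x * `|X x| `^ p)%:E * osc_integral k p =
   \int[mu]_(t in `]0%R, +oo[) ((t `^ (- (1 + p)))%:E *
      \int[m]_x (w x * (1 - cos (t * X x)) ^+ k)%:E))%E.
Proof.
move=> mX mw w0.
have Cf : osc_integral k p \is a fin_num.
  by rewrite ge0_fin_numE ?ltW ?osc_integral_gt0 ?osc_integral_fin.
pose rho (t : R) := t `^ (- (1 + p)).
pose rho' := rho \_ (`]0, +oo[%classic : set R).
have rho'0 t : 0 <= rho' t by rewrite /rho' patchE; case: ifP => // _; exact: powR_ge0.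
have mrho' : measurable_fun setT rho'.
  have mD : measurable (`]0, +oo[%classic : set R) by exact: measurable_itv.
  by apply/(measurable_restrictT _ mD); exact: measurable_rho.
have rho'E (a : R -> \bar R) : (\int[mu]_(t in `]0%R, +oo[) ((rho t)%:E * a t) =
    \int[mu]_t ((rho' t)%:E * a t))%E.
  rewrite integral_mkcond; apply: eq_integral => t _.
  by rewrite /rho' !patchE; case: ifP => // _; rewrite mul0e.
have mcos : measurable_fun setT (fun z : T * R => (1 - cos (z.2 * X z.1)) ^+ k).
  apply: measurable_funX; apply: measurable_funB => //.
  apply: (measurableT_comp (continuous_measurable_fun (@continuous_cos R))).
  by apply: measurable_funM => //; exact: measurableT_comp.
have cos0 (y : R) : 0 <= (1 - cos y) ^+ k by rewrite exprn_ge0 ?onem_cos_ge0.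
pose f (z : T * R) : \bar R :=
  (rho' z.2 * (w z.1 * (1 - cos (z.2 * X z.1)) ^+ k))%:E.
have f0 z : (0 <= f z)%E by rewrite lee_fin !mulr_ge0.
have mf : measurable_fun setT f.
  apply/measurable_EFinP; apply: measurable_funM; first exact: measurableT_comp.
  by apply: measurable_funM => //; exact: measurableT_comp.
have mc2 (x : T) : measurable_fun setT (fun t : R => (1 - cos (t * X x)) ^+ k).
  exact: (measurableT_comp mcos (pair1_measurable x)).
have mc1 (t : R) : measurable_fun setT (fun x : T => (1 - cos (t * X x)) ^+ k).
  exact: (measurableT_comp mcos (pair2_measurable t)).
transitivity (\int[m]_x \int[mu]_t f (x, t))%E.
  rewrite -(fineK Cf) -ge0_integralZr//; last 3 first.
  - apply/measurable_EFinP; apply: measurable_funM => //.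
    apply: (measurableT_comp (measurable_powR p)).
    exact: measurableT_comp.
  - by move=> x _; rewrite lee_fin mulr_ge0 ?powR_ge0.
  - by rewrite fineK// ltW// osc_integral_gt0.
  apply: eq_integral => x _; rewrite fineK// EFinM -muleA.
  rewrite -(osc_integral_scale k0 p0).
  under eq_integral do rewrite mulrC EFinM.
  rewrite (rho'E (fun t => ((1 - cos (t * X x)) ^+ k)%:E)).
  rewrite -ge0_integralZl//; last 3 first.
  - apply: emeasurable_funM; apply/measurable_EFinP => //; exact: mc2.
  - by move=> t _; rewrite -EFinM lee_fin mulr_ge0.
  - by rewrite lee_fin.
  by apply: eq_integral => t _; rewrite -!EFinM /f/= mulrCA.
rewrite (@fubini_tonelli _ _ T _ R m mu f mf f0)
  (rho'E (fun t => \int[m]_x (w x * (1 - cos (t * X x)) ^+ k)%:E)%E).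
apply: eq_integral => t _; rewrite /f /=.
under eq_integral do rewrite EFinM.
rewrite ge0_integralZl//.
- by apply/measurable_EFinP; apply: measurable_funM.
- by move=> x _; rewrite lee_fin mulr_ge0.
- by rewrite lee_fin.
Qed.

End weighted_fractional_moment.

Section gaussian_expectation.
Context {R : realType}.
Let mu := @lebesgue_measure R.

(** The expectation under the normal law with mean 0 and variance 1/2, the law
    with density proportional to exp (- x^2). *)
Definition gauss_mean (f : R -> R) : R :=
  (Num.sqrt pi)^-1 * \int[mu]_x (f x * gauss_fun x).

Lemma gauss_int f : bmeas f -> mu.-integrable setT (EFin \o (fun x => f x * gauss_fun x)).
Proof.
move=> mf; have [M M0 fM] := bmeas_ge0_bound mf.
apply: gauss_dominated; first exact: mf.1.
by exists M => x; rewrite (le_trans (fM x))// ler_peMr ?(ltW M0)// lerDl.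
Qed.

Lemma gauss_meanB f g : bmeas f -> bmeas g ->
  gauss_mean (fun x => f x - g x) = gauss_mean f - gauss_mean g.
Proof.
move=> mf mg; rewrite /gauss_mean.
under eq_Rintegral do rewrite mulrBl.
by rewrite RintegralB ?mulrBr//; exact: gauss_int.
Qed.

Lemma gauss_meanZ c f : bmeas f ->
  gauss_mean (fun x => c * f x) = c * gauss_mean f.
Proof.
move=> mf; rewrite /gauss_mean.
under eq_Rintegral do rewrite -mulrA.
by rewrite RintegralZl 1?mulrCA//; exact: gauss_int.
Qed.

Lemma gauss_mean_cos t : gauss_mean (fun x => cos (t * x)) = expR (- (t ^+ 2 / 4)).
Proof.
by rewrite /gauss_mean gauss_cf mulrA mulVf ?mul1r// gt_eqF// sqrtr_gt0 pi_gt0.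
Qed.

End gaussian_expectation.

(** * From characteristic functions to absolute moments *)

Section convergence_of_moments.
Context {R : realType}.
Let mu := @lebesgue_measure R.

Lemma integrable_powR_gauss (p : R) : 0 < p ->
  mu.-integrable setT (EFin \o (fun x => `|x| `^ p * gauss_fun x)).
Proof.
move=> p0; have [k pk] : exists k, p <= k.*2%:R.
  exists (Num.truncn p).+1; rewrite -addnn natrD.
  by rewrite (le_trans (ltW (truncnS_gt p)))// lerDr ler0n.
pose c : R := 1 + 2 ^+ k * k`!%:R.
have c0 : 0 <= c by rewrite addr_ge0// mulr_ge0 ?exprn_ge0.
apply: (@le_integrable _ _ _ mu setT measurableT _
  (EFin \o (fun x => c * expR (- x ^+ 2 / 2)))).
- apply/measurable_EFinP; apply: measurable_funM; last exact: measurable_gauss_fun.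
  apply: continuous_measurable_fun; exact: continuous_norm_powR.
- move=> x _; rewrite /= lee_fin [leRHS]ger0_norm ?mulr_ge0 ?expR_ge0//.
  rewrite ger0_norm ?mulr_ge0 ?powR_ge0 ?gauss_fun_ge0//.
  have -> : gauss_fun x = expR (- x ^+ 2 / 2) * expR (- x ^+ 2 / 2).
    by rewrite -expRD /gauss_fun; congr expR; field.
  rewrite mulrA ler_pM2r ?expR_gt0//.
  rewrite mulNr expRN -ler_pdivlMr ?invr_gt0 ?expR_gt0// invrK.
  have e1 : 1 <= expR (x ^+ 2 / 2) by rewrite -expR0 ler_expR divr_ge0 ?sqr_ge0.
  rewrite mulrDl mul1r; have [x1|x1] := leP `|x| 1.
    rewrite (@le_trans _ _ 1)//; last first.
      by rewrite (le_trans e1)// lerDl !mulr_ge0 ?exprn_ge0 ?expR_ge0.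
    have h1 : (1 : R) `^ p = 1 by rewrite powR1.
    by rewrite -[leRHS]h1 ge0_ler_powR ?nnegrE ?(ltW p0).
  rewrite (@le_trans _ _ (`|x| ^+ k.*2))//.
    by rewrite -powR_mulrn// ler_powR// ltW.
  rewrite -mul2n exprM real_normK ?num_real//.
  have h := @expR_ge1Dxn R (x ^+ 2 / 2).
  case: k {pk} @c c0 => [|k] c c0.
    by rewrite !expr0 fact0 !mul1r; lra.
  have := h k (divr_ge0 (sqr_ge0 _) (ler0n _ _)).
  have f0 : (0 : R) < (k.+1)`!%:R by rewrite ltr0n fact_gt0.
  rewrite -lerBrDl ler_pdivrMr// expr_div_n ler_pdivrMr ?exprn_gt0// => h'.
  rewrite (le_trans h')//; rewrite -subr_ge0.
  have : 0 <= (2 : R) ^+ k.+1 * k.+1`!%:R by rewrite mulr_ge0 ?exprn_ge0.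
  by move: (expR _) e1 => e e1; move: (2 ^+ k.+1) => a; nra.
- exact: (integrableZl measurableT _ integrable_half_gauss).
Qed.

Section sequence.
Context d (T_ : nat -> measurableType d).
Variables (m_ : forall n, {measure set (T_ n) -> \bar R}) (X_ : forall n, T_ n -> R).
Arguments X_ : clear implicits.
Variable (v : R).
Hypotheses (v0 : 0 <= v) (m1 : forall n, m_ n setT = 1%E).
Hypothesis bX : forall n, bmeas (X_ n).
Hypothesis cfX : forall t,
  (fun n => \int[m_ n]_x cos (t * X_ n x)) @ \oo --> expR (- (t ^+ 2 * v / 4)).

Let s := Num.sqrt v.

Let sE : s ^+ 2 = v. Proof. by rewrite sqr_sqrtr. Qed.

Let bcos1 d' (T : measurableType d') (f : T -> R) t : measurable_fun setT f ->
  bmeas (fun x => 1 - cos (t * f x)).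
Proof.
move=> mf; apply: bmeasB; first exact: bmeas_cst.
by apply: bmeas_cos; exact: measurable_funM.
Qed.

(** Expanding one factor 1 - cos (t x) by the product formula for cosines lowers k
    by one and shifts the frequency u, down to the characteristic function. *)
Lemma cvg_trig_moment k t u :
  (fun n => \int[m_ n]_x ((1 - cos (t * X_ n x)) ^+ k * cos (u * X_ n x))) @ \oo -->
  gauss_mean (fun x => (1 - cos (t * (s * x))) ^+ k * cos (u * (s * x))).
Proof.
elim: k u => [|k ih] u.
  under eq_fun do under eq_Rintegral do rewrite expr0 mul1r.
  under [X in gauss_mean X]eq_fun do rewrite expr0 mul1r mulrA.
  rewrite gauss_mean_cos exprMn sE; exact: cfX.
have bX1 n t' : bmeas (fun x => 1 - cos (t' * X_ n x)).
  apply: bmeasB; first exact: bmeas_cst.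
  by apply: bmeas_cos; apply: measurable_funM => //; exact: (bX n).1.
have bX2 n u' : bmeas (fun x => (1 - cos (t * X_ n x)) ^+ k * cos (u' * X_ n x)).
  apply: bmeasM; first exact: bmeasX.
  by apply: bmeas_cos; apply: measurable_funM => //; exact: (bX n).1.
have bG u' : bmeas (fun x : R => (1 - cos (t * (s * x))) ^+ k * cos (u' * (s * x))).
  apply: bmeasM; first by apply: bmeasX; apply: bcos1; exact: measurable_funM.
  by apply: bmeas_cos; apply: measurable_funM => //; exact: measurable_funM.
have decomp y : (1 - cos (t * y)) ^+ k.+1 * cos (u * y) =
    ((1 - cos (t * y)) ^+ k * cos (u * y) -
     2^-1 * ((1 - cos (t * y)) ^+ k * cos ((u + t) * y))) -
     2^-1 * ((1 - cos (t * y)) ^+ k * cos ((u - t) * y)).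
  by rewrite exprS [(u + t) * y]mulrDl [(u - t) * y]mulrBl cosD cosB; field.
rewrite (_ : (fun n => _) = (fun n =>
    (\int[m_ n]_x ((1 - cos (t * X_ n x)) ^+ k * cos (u * X_ n x)) -
    2^-1 * \int[m_ n]_x ((1 - cos (t * X_ n x)) ^+ k * cos ((u + t) * X_ n x))) -
    2^-1 * \int[m_ n]_x ((1 - cos (t * X_ n x)) ^+ k * cos ((u - t) * X_ n x)))); last first.
  apply/funext => n; under eq_Rintegral do rewrite decomp.
  by rewrite !RintB ?RintZ//; do ?[apply: bmeasB => //]; apply: bmeasM => //; exact: bmeas_cst.
rewrite (_ : gauss_mean _ =
    (gauss_mean (fun x => (1 - cos (t * (s * x))) ^+ k * cos (u * (s * x))) -
    2^-1 * gauss_mean (fun x => (1 - cos (t * (s * x))) ^+ k * cos ((u + t) * (s * x)))) -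
    2^-1 * gauss_mean (fun x => (1 - cos (t * (s * x))) ^+ k * cos ((u - t) * (s * x)))); last first.
  under [X in gauss_mean X]eq_fun do rewrite decomp.
  by rewrite !gauss_meanB ?gauss_meanZ//; do ?[apply: bmeasB => //]; apply: bmeasM => //; exact: bmeas_cst.
by apply: cvgB; [apply: cvgB|]; [exact: ih| |];
  apply: cvgM; (try exact: cvg_cst); exact: ih.
Qed.

Hypothesis momX : forall k, exists C, forall n, \int[m_ n]_x X_ n x ^+ k.*2 <= C.

Let powR_scale (p x : R) : 0 <= p -> `|s * x| `^ p = v `^ (p / 2) * `|x| `^ p.
Proof.
move=> p0; rewrite normrM powRM// (ger0_norm (sqrtr_ge0 v)) -powR12_sqrt//.
by rewrite -powRrM [2^-1 * p]mulrC.
Qed.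

(** Levy continuity and uniform integrability in one step: writing |x|^p as an
    integral of (1 - cos (t x))^k t^(-1-p), the p-th moment becomes an integral of
    trigonometric moments, which converge for each t by [cvg_trig_moment] and are
    dominated thanks to the bound on the moments of order 2k. *)
Lemma cvg_moment (p : R) : 0 < p ->
  (fun n => \int[m_ n]_x `|X_ n x| `^ p) @ \oo -->
  v `^ (p / 2) * (Gamma ((p + 1) / 2) / Num.sqrt pi).
Proof.
move=> p0; have [k k0 pk] : exists2 k, (0 < k)%N & p + 1 <= k.*2%:R.
  exists (Num.truncn (p + 1)).+1 => //; rewrite -addnn natrD.
  by rewrite (le_trans (ltW (truncnS_gt _)))// lerDr ler0n.
have [B BX] := momX k.
have B0 : 0 <= B.
  apply: le_trans (BX 0%N); apply: Rint_ge0 => x.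
  by rewrite -mul2n exprM exprn_ge0// sqr_ge0.
pose I := (`]0, +oo[%classic : set R).
have mI : measurable I by exact: measurable_itv.
pose rho (t : R) := t `^ (- (1 + p)).
have mrho : measurable_fun I rho by exact: measurable_rho.
pose a n t := \int[m_ n]_x (1 - cos (t * X_ n x)) ^+ k.
pose a_lim t := gauss_mean (fun x => (1 - cos (t * (s * x))) ^+ k).
have ba n t : bmeas (fun x => (1 - cos (t * X_ n x)) ^+ k).
  by apply: bmeasX; apply: bcos1; exact: (bX n).1.
have a_cvg t : a ^~ t @ \oo --> a_lim t.
  have := @cvg_trig_moment k t 0.
  under eq_fun do under eq_Rintegral do rewrite mul0r cos0 mulr1.
  by under [X in gauss_mean X]eq_fun do rewrite mul0r cos0 mulr1.
have momE n : ((\int[m_ n]_x `|X_ n x| `^ p)%:E * osc_integral k p =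
    \int[mu]_(t in I) (a n t * rho t)%:E)%E.
  have : (\int[m_ n]_x (1 * `|X_ n x| `^ p)%:E * osc_integral k p =
      \int[mu]_(t in I) ((rho t)%:E *
        \int[m_ n]_x (1 * (1 - cos (t * X_ n x)) ^+ k)%:E))%E.
    exact: (weighted_fractional_moment k0 p0 pk (as_probability (m1 n))
      (bX n).1 (measurable_cst (1 : R)) (fun=> ler01)).
  under eq_integral do rewrite mul1r.
  rewrite (bmeas_EFin (m1 n) (bmeas_powR (ltW p0) (bX n))) => ->.
  apply: eq_integral => t _.
  under eq_integral do rewrite mul1r.
  by rewrite (bmeas_EFin (m1 n) (ba n t)) -EFinM mulrC.
have ma n : measurable_fun setT (a n).
  have mf : measurable_fun setT
      (fun z : T_ n * R => ((1 - cos (z.2 * X_ n z.1)) ^+ k)%:E).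
    apply/measurable_EFinP; apply: measurable_funX; apply: measurable_funB => //.
    apply: (measurableT_comp (continuous_measurable_fun (@continuous_cos R))).
    by apply: measurable_funM => //; apply: (measurableT_comp (bX n).1).
  apply: measurableT_comp => //.
  apply: (@measurable_fun_fubini_tonelli_G _ _ (T_ n) R R (as_probability (m1 n)) _ mf).
  by move=> z; rewrite lee_fin exprn_ge0// onem_cos_ge0.
have ma_lim : measurable_fun setT a_lim.
  apply: (measurable_fun_cvg ma) => t _; exact: a_cvg.
have a0 n t : 0 <= a n t.
  by apply: Rint_ge0 => x; rewrite exprn_ge0// onem_cos_ge0.
have a_lim0 t : 0 <= a_lim t.
  rewrite mulr_ge0 ?invr_ge0//; apply: Rint_ge0 => x.
  by rewrite mulr_ge0 ?gauss_fun_ge0// exprn_ge0// onem_cos_ge0.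
have spi : Num.sqrt pi != 0 :> R by rewrite gt_eqF// sqrtr_gt0 pi_gt0.
have limE : ((v `^ (p / 2) * (Gamma ((p + 1) / 2) / Num.sqrt pi))%:E * osc_integral k p =
    \int[mu]_(t in I) (a_lim t * rho t)%:E)%E.
  have := weighted_fractional_moment k0 p0 pk mu
    (measurable_funM (measurable_cst s) (@measurable_id _ R setT))
    (@measurable_gauss_fun R) (@gauss_fun_ge0 R).
  have -> : (\int[mu]_x (gauss_fun x * `|s * x| `^ p)%:E =
      (v `^ (p / 2) * Gamma ((p + 1) / 2))%:E)%E.
    under eq_integral do rewrite powR_scale ?(ltW p0)// mulrCA [gauss_fun _ * _]mulrC EFinM.
    have ig := integrable_powR_gauss p0.
    rewrite integralZl// EFinM Gamma_gauss_moment//; congr (_ * _)%E.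
    by rewrite /Rintegral fineK//; exact: integrable_fin_num.
  move=> h; have : (((Num.sqrt pi)^-1)%:E * ((v `^ (p / 2) * Gamma ((p + 1) / 2))%:E *
      osc_integral k p) = ((Num.sqrt pi)^-1)%:E * \int[mu]_(t in I)
      (Num.sqrt pi * (a_lim t * rho t))%:E)%E.
    rewrite h; congr (_ * _)%E; apply: eq_integral => t _.
    have ->: (\int[mu]_x (gauss_fun x * (1 - cos (t * (s * x))) ^+ k)%:E =
        (Num.sqrt pi * a_lim t)%:E)%E.
      rewrite /a_lim /gauss_mean mulrA mulfV// mul1r.
      under eq_integral do rewrite mulrC.
      rewrite /Rintegral fineK//; apply: integrable_fin_num => //.
      apply: gauss_int; apply: bmeasX; apply: bcos1.
      by apply: measurable_funM => //; exact: measurable_funM.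
    by rewrite -EFinM; congr EFin; rewrite /rho; ring.
  rewrite muleA -EFinM mulrCA [_^-1 * _]mulrC => ->.
  under eq_integral do rewrite EFinM.
  rewrite ge0_integralZl//; last 2 first.
  - apply/measurable_EFinP; apply: measurable_funM => //; exact: measurable_funTS.
  - by move=> t _; rewrite lee_fin mulr_ge0// powR_ge0.
  by rewrite muleA -EFinM mulVf// mul1e.
have : (\int[mu]_(t in I) (a n t * rho t)%:E)%E @[n --> \oo] -->
    (\int[mu]_(t in I) (a_lim t * rho t)%:E)%E.
  pose A := 2 ^+ k + B.
  have A0 : 0 <= A by rewrite addr_ge0// exprn_ge0.
  have [|||||_ _ +] := @dominated_convergence _ _ _ mu I mI
    (fun n t => (a n t * rho t)%:E) (fun t => (a_lim t * rho t)%:E)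
    (fun t => (A * osc_dom p t)%:E); last exact.
  - move=> n; apply/measurable_EFinP; apply: measurable_funM => //.
    exact: (measurable_funTS (ma n)).
  - by apply/measurable_EFinP; apply: measurable_funM => //; exact: measurable_funTS.
  - apply: aeW => t _; apply: cvg_EFin; first exact: nearW.
    by apply: cvgM; [exact: a_cvg|exact: cvg_cst].
  - under eq_fun do rewrite EFinM.
    by apply: integrableZl => //; exact: osc_dom_integrable.
  - apply: aeW => t n; rewrite /I/= in_itv/= andbT => t0.
    rewrite lee_fin ger0_norm ?mulr_ge0 ?powR_ge0//.
    apply: (@osc_domP _ k) => //.
      rewrite (@le_trans _ _ (2 ^+ k))// ?lerDl//.
      by apply: Rint_le_cst => // x; exact: onem_cos_le.
    rewrite (@le_trans _ _ (\int[m_ n]_x (t ^+ k.*2 * X_ n x ^+ k.*2)))//.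
      apply: le_Rint => //.
        by apply: bmeasM; [exact: bmeas_cst|exact: bmeasX].
      by move=> x; rewrite -exprMn; exact: onem_cos_le_quad.
    rewrite RintZ//; last exact: bmeasX.
    rewrite mulrC ler_wpM2r ?exprn_ge0 ?(ltW t0)//.
    by rewrite (le_trans (BX n))// lerDr exprn_ge0.
rewrite -limE; under eq_fun do rewrite -momE.
have := @osc_integral_gt0 R k p p0; have := osc_integral_fin p0 pk.
case: (osc_integral k p) => // c _; rewrite lte_fin => c0.
under eq_fun do rewrite -EFinM; rewrite -EFinM => /fine_cvg /=.
have c0' : c != 0 by rewrite gt_eqF.
have key (u : R^nat) (l : R) : (fun n => u n * c) @ \oo --> l * c -> u @ \oo --> l.
  move=> ucl; rewrite -(mulfK c0' l).
  rewrite (_ : u = fun n => u n * c / c); last first.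
    by apply/funext => n; rewrite mulfK.
  by apply: cvgM => //; exact: cvg_cst.
by move=> h; apply: key; exact: h.
Qed.

End sequence.
End convergence_of_moments.

(** * Probability kernels *)

Section probability_kernels.
Context {R : realType}.

Section precomposition.
Context d0 d1 d2 (T0 : measurableType d0) (T1 : measurableType d1)
  (T2 : measurableType d2) (k : R.-pker T1 ~> T2) (f : T0 -> T1).

Definition kpre (mf : measurable_fun setT f) : T0 -> {measure set T2 -> \bar R} :=
  fun x => k (f x).

Hypothesis mf : measurable_fun setT f.

Let measurable_kpre U : measurable U -> measurable_fun setT (kpre mf ^~ U).
Proof. by move=> mU; exact: measurableT_comp (measurable_kernel k U mU) mf. Qed.

HB.instance Definition _ := isKernel.Build _ _ _ _ _ (kpre mf) measurable_kpre.

Let kpre_prob x : kpre mf x setT = 1%E. Proof. exact: prob_kernel. Qed.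

HB.instance Definition _ := Kernel_isProbability.Build _ _ _ _ _ (kpre mf) kpre_prob.

End precomposition.

Section constant.
Context d0 d1 (T0 : measurableType d0) (T1 : measurableType d1)
  (P : probability T1 R).

Definition kcst (_ : T0) : {measure set T1 -> \bar R} := P.

Let measurable_kcst U : measurable U -> measurable_fun setT (kcst ^~ U).
Proof. by move=> mU; exact: measurable_cst. Qed.

HB.instance Definition _ := isKernel.Build _ _ _ _ _ kcst measurable_kcst.

Let kcst_prob x : kcst x setT = 1%E. Proof. exact: probability_setT. Qed.

HB.instance Definition _ := Kernel_isProbability.Build _ _ _ _ _ kcst kcst_prob.

End constant.

Section composition.
Context d0 d1 d2 (T0 : measurableType d0) (T1 : measurableType d1)
  (T2 : measurableType d2) (l : R.-pker T0 ~> T1) (k : R.-pker (T0 * T1) ~> T2).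

(** The composition of two probability kernels, as a probability kernel rather than
    merely an s-finite one. *)
Definition pkcomp : T0 -> {measure set T2 -> \bar R} := mkcomp l k.

Let measurable_pkcomp U : measurable U -> measurable_fun setT (pkcomp ^~ U).
Proof. exact: measurable_fun_mkcomp_sfinite. Qed.

HB.instance Definition _ := isKernel.Build _ _ _ _ _ pkcomp measurable_pkcomp.

Let pkcomp_prob x : pkcomp x setT = 1%E.
Proof.
rewrite /pkcomp /= /kcomp; under eq_integral do rewrite prob_kernel.
by rewrite integral_cst// prob_kernel mul1e.
Qed.

HB.instance Definition _ := Kernel_isProbability.Build _ _ _ _ _ pkcomp pkcomp_prob.

End composition.

Lemma bmeas_kernel d1 d2 (T1 : measurableType d1) (T2 : measurableType d2)
    (k : R.-pker T1 ~> T2) (f : T2 -> R) :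
  bmeas f -> bmeas (fun y => \int[k y]_z f z).
Proof.
move=> bf; have [M M0 fM] := bmeas_ge0_bound bf.
split; last by exists M => y; exact: (norm_Rint_le_cst (prob_kernel y)).
have bfM : bmeas (fun x => f x + M) by apply: bmeasD => //; exact: bmeas_cst.
have fM0 z : 0 <= f z + M by have := fM z; rewrite ler_norml; lra.
rewrite (_ : (fun y => _) = (fun y => fine (\int[k y]_z (f z + M)%:E) - M)); last first.
  apply/funext => y; rewrite (bmeas_EFin (prob_kernel y) bfM)/=.
  rewrite (RintD (prob_kernel y))//; last exact: bmeas_cst.
  by rewrite (Rint_cst (prob_kernel y)) addrK.
apply: measurable_funB => //; apply: measurableT_comp => //.
apply: measurable_fun_integral_kernel.
- by move=> U mU; exact: measurable_kernel.
- by move=> z; rewrite lee_fin.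
- by apply/measurable_EFinP; exact: bfM.1.
Qed.

(** Translating by a bound of f reduces identities between integrals to
    nonnegative integrands. *)
Lemma Rint_shift d (T : measurableType d) (m : {measure set T -> \bar R}) (f : T -> R) M :
  m setT = 1%E -> bmeas f -> \int[m]_x f x = \int[m]_x (f x + M) - M.
Proof.
by move=> m1 bf; rewrite RintD// ?Rint_cst ?addrK//; exact: bmeas_cst.
Qed.

Lemma Rint_pkcomp d0 d1 d2 (T0 : measurableType d0) (T1 : measurableType d1)
    (T2 : measurableType d2) (l : R.-pker T0 ~> T1) (k : R.-pker (T0 * T1) ~> T2)
    (x : T0) (f : T2 -> R) : bmeas f ->
  \int[pkcomp l k x]_z f z = \int[l x]_y \int[k (x, y)]_z f z.
Proof.
move=> bf; have [M M0 fM] := bmeas_ge0_bound bf.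
have bfM : bmeas (fun x => f x + M) by apply: bmeasD => //; exact: bmeas_cst.
have fM0 z : 0 <= f z + M by have := fM z; rewrite ler_norml; lra.
have bk (h : T2 -> R) : bmeas h -> bmeas (fun y => \int[k (x, y)]_z h z).
  by move=> bh; have := bmeas_kernel (kpre k (pair1_measurable x)) bh.
rewrite (Rint_shift M (prob_kernel x) bf).
rewrite (Rint_shift M (prob_kernel x) (bk _ bf)); congr (_ - _).
rewrite (_ : (fun y => _) = (fun y => \int[k (x, y)]_z (f z + M))); last first.
  apply/funext => y; rewrite (Rint_shift M (prob_kernel (x, y)) bf) subrK.
  by [].
apply: EFin_inj; rewrite -(bmeas_EFin (prob_kernel x) bfM).
rewrite -(bmeas_EFin (prob_kernel x) (bk _ bfM)).
rewrite [LHS](@integral_kcomp _ _ _ _ _ _ R l k)//; last first.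
  by apply/measurable_EFinP; exact: bfM.1.
by apply: eq_integral => y _; rewrite (bmeas_EFin (prob_kernel (x, y)) bfM).
Qed.

Lemma Rint_kdirac d0 d1 (T0 : measurableType d0) (T1 : measurableType d1)
    (h : T0 -> T1) (mh : measurable_fun setT h) (x : T0) (f : T1 -> R) :
  measurable_fun setT f -> \int[kdirac mh x]_z f z = f (h x).
Proof.
move=> mf; rewrite /Rintegral /kdirac integral_dirac//.
  by rewrite diracT mul1e.
exact/measurable_EFinP.
Qed.

Lemma bmeas_kernel2 d1 d2 (T1 : measurableType d1) (T2 : measurableType d2)
    (k : R.-pker T1 ~> T2) (f : T1 * T2 -> R) :
  bmeas f -> bmeas (fun x => \int[k x]_y f (x, y)).
Proof.
move=> bf; rewrite (_ : (fun x => _) = (fun x =>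
    \int[pkcomp k (kdirac (@measurable_id _ (T1 * T2)%type setT)) x]_w f w)).
  exact: (bmeas_kernel (pkcomp k (kdirac (@measurable_id _ (T1 * T2)%type setT)))).
apply/funext => x; rewrite Rint_pkcomp//; apply: eq_Rintegral => y _.
by rewrite Rint_kdirac//; exact: bf.1.
Qed.

Lemma bmeas_Rint2 d1 d2 (T1 : measurableType d1) (T2 : measurableType d2)
    (m : {measure set T2 -> \bar R}) (f : T1 * T2 -> R) :
  m setT = 1%E -> bmeas f -> bmeas (fun x => \int[m]_y f (x, y)).
Proof. by move=> m1 bf; exact: (bmeas_kernel2 (kcst (as_probability m1))). Qed.

End probability_kernels.

(** * Independent samples and multinomial selection *)

Section power_kernel.
Context {R : realType} d0 d (T0 : measurableType d0) (X : measurableType d).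

Definition consz n (z : (T0 * X) * n.-tuple X) : n.+1.-tuple X :=
  [the n.+1.-tuple X of z.1.2 :: z.2].

Lemma measurable_consz n : measurable_fun setT (@consz n).
Proof.
apply: measurable_cons; last exact: measurable_snd.
exact: measurableT_comp measurable_snd measurable_fst.
Qed.

(** [kpow k n z] is the law of n independent draws from [k z]. *)
Fixpoint kpow (k : R.-pker T0 ~> X) n : R.-pker T0 ~> n.-tuple X :=
  if n is n'.+1 then
    pkcomp k (pkcomp (kpre (kpow k n') (@measurable_fst _ _ T0 X))
      (kdirac (@measurable_consz n')))
  else kdirac (@measurable_cst _ _ T0 (0.-tuple X) setT [tuple]).

Variable k : R.-pker T0 ~> X.

Lemma Rint_kpow0 z (f : 0.-tuple X -> R) : bmeas f ->
  \int[kpow k 0 z]_v f v = f [tuple].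
Proof.
by move=> bf; rewrite /= Rint_kdirac//; exact: bf.1.
Qed.

Lemma Rint_kpowS n z (f : n.+1.-tuple X -> R) : bmeas f ->
  \int[kpow k n.+1 z]_v f v =
  \int[k z]_x \int[kpow k n z]_v f [tuple of x :: v].
Proof.
move=> bf; rewrite /= Rint_pkcomp//; apply: eq_Rintegral => x _.
rewrite Rint_pkcomp//; apply: eq_Rintegral => v _.
by rewrite Rint_kdirac//; exact: bf.1.
Qed.

Lemma bmeas_tnth n (u : X -> R) i : bmeas u ->
  bmeas (fun v : n.-tuple X => u (tnth v i)).
Proof.
move=> [mu [M uM]]; split; last by exists M.
exact: measurableT_comp mu (measurable_tnth i).
Qed.

Lemma Rint_kpow_prod n z (u : 'I_n -> X -> R) : (forall i, bmeas (u i)) ->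
  \int[kpow k n z]_v (\prod_(i < n) u i (tnth v i)) = \prod_(i < n) \int[k z]_x u i x.
Proof.
elim: n u => [|n ih] u bu.
  rewrite Rint_kpow0 ?big_ord0//.
  by apply: bmeas_prod => i; exact: bmeas_tnth.
rewrite Rint_kpowS; last by apply: bmeas_prod => i; exact: bmeas_tnth.
rewrite big_ord_recl -(RintZr (prob_kernel z))//.
apply: eq_Rintegral => x _; rewrite -ih; last by move=> i; exact: bu.
rewrite -(RintZ (prob_kernel z)); last first.
  by apply: bmeas_prod => i; exact: bmeas_tnth.
apply: eq_Rintegral => v _; rewrite big_ord_recl tnth0; congr (_ * _).
by apply: eq_bigr => i _; rewrite tnthS.
Qed.

End power_kernel.

Section selection_kernel.
Context {R : realType} d0 d (T0 : measurableType d0) (X : measurableType d).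
Variables (G : T0 * X -> R) (mG : measurable_fun setT G) (G0 : forall z, 0 < G z).
Variables (Q : R.-pker X ~> X) (N : nat).

Definition weight (z : T0 * N.+1.-tuple X) (l : 'I_N.+1) : R :=
  G (z.1, tnth z.2 l) / \sum_(j < N.+1) G (z.1, tnth z.2 j).

Lemma sum_weight_gt0 (z : T0 * N.+1.-tuple X) :
  0 < \sum_(j < N.+1) G (z.1, tnth z.2 j).
Proof. by rewrite big_ord_recl ltr_pwDl// sumr_ge0// => i _; exact: ltW. Qed.

Lemma weight_ge0 z l : 0 <= weight z l.
Proof. by rewrite divr_ge0 ?ltW// sum_weight_gt0. Qed.

Lemma sum_weight z : \sum_(l < N.+1) weight z l = 1.
Proof. by rewrite -mulr_suml mulfV// gt_eqF// sum_weight_gt0. Qed.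

Lemma measurable_Gtnth l : measurable_fun setT
  (fun z : T0 * N.+1.-tuple X => G (z.1, tnth z.2 l)).
Proof.
apply: (measurableT_comp mG); apply: measurable_fun_pair; first exact: measurable_fst.
exact: measurableT_comp (measurable_tnth l) measurable_snd.
Qed.

Lemma measurable_weight l : measurable_fun setT (weight ^~ l).
Proof.
apply: measurable_funM; first exact: measurable_Gtnth.
rewrite (_ : (fun z => _) = (fun z : T0 * N.+1.-tuple X =>
    (\sum_(j < N.+1) G (z.1, tnth z.2 j)) `^ (- 1))); last first.
  by apply/funext => z; rewrite powR_inv1// ltW// sum_weight_gt0.
apply: (measurableT_comp (measurable_powR _)).
by apply: measurable_sum => i; exact: measurable_Gtnth.
Qed.

(** The law of a new particle given the current ones: choose a particle with
    probability proportional to its weight, then move it with Q. *)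
Definition selection (_ : measurable_fun setT G)
   (z : T0 * N.+1.-tuple X) : {measure set X -> \bar R} :=
  msum (fun l => mscale (NngNum (weight_ge0 z (inord l))) (Q (tnth z.2 (inord l)))) N.+1.

Local Notation sel := (selection mG).

Lemma selectionE z U :
  sel z U = (\sum_(l < N.+1) (weight z l)%:E * Q (tnth z.2 l) U)%E.
Proof.
rewrite /selection /= /msum; apply: eq_bigr => l _.
by rewrite /mscale/= inord_val.
Qed.

Let measurable_selection U : measurable U -> measurable_fun setT (sel ^~ U).
Proof.
move=> mU; under eq_fun do rewrite selectionE.
apply: emeasurable_sum => l; apply: emeasurable_funM.
  by apply/measurable_EFinP; exact: measurable_weight.
apply: (measurableT_comp (measurable_kernel Q U mU)).
exact: measurableT_comp (measurable_tnth l) measurable_snd.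
Qed.

HB.instance Definition _ := isKernel.Build _ _ _ _ _ sel measurable_selection.

Let selection_prob z : sel z setT = 1%E.
Proof.
rewrite selectionE; under eq_bigr do rewrite prob_kernel mule1.
by rewrite sumEFin sum_weight.
Qed.

HB.instance Definition _ := Kernel_isProbability.Build _ _ _ _ _ sel selection_prob.

Lemma Rint_selection z (f : X -> R) : bmeas f ->
  \int[sel z]_x f x = \sum_(l < N.+1) weight z l * \int[Q (tnth z.2 l)]_x f x.
Proof.
move=> bf; have [M M0 fM] := bmeas_ge0_bound bf.
have bfM : bmeas (fun x => f x + M) by apply: bmeasD => //; exact: bmeas_cst.
have fM0 x : 0 <= f x + M by have := fM x; rewrite ler_norml; lra.
have mfM : measurable_fun setT (fun x => (f x + M)%:E).
  by apply/measurable_EFinP; exact: bfM.1.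
rewrite (Rint_shift M (prob_kernel z) bf).
have -> : \int[sel z]_x (f x + M) =
    \sum_(l < N.+1) weight z l * \int[Q (tnth z.2 l)]_x (f x + M).
  apply: EFin_inj; rewrite -(bmeas_EFin (prob_kernel z) bfM) -sumEFin.
  have fM0E x : setT x -> (0 <= (f x + M)%:E)%E by rewrite lee_fin.
  rewrite (ge0_integral_measure_sum _ measurableT fM0E mfM).
  apply: eq_bigr => l _; rewrite (ge0_integral_mscale _ measurableT _ mfM fM0E)/=.
  by rewrite inord_val EFinM (bmeas_EFin (prob_kernel _) bfM).
rewrite (eq_bigr (fun l => weight z l * \int[Q (tnth z.2 l)]_x f x + weight z l * M)).
  by rewrite big_split/= -mulr_suml sum_weight mul1r addrK.
move=> l _; rewrite (RintD (prob_kernel _))//; last exact: bmeas_cst.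
by rewrite (Rint_cst (prob_kernel _)) mulrDr.
Qed.

End selection_kernel.

(** * Fluctuations of independent samples *)

Section iid_fluctuations.
Context {R : realType} d0 d (T0 : measurableType d0) (X : measurableType d).

Definition emean N (f : X -> R) (v : N.+1.-tuple X) : R :=
  N.+1%:R^-1 * \sum_(i < N.+1) f (tnth v i).

Definition dev N (c : R) (f : X -> R) (v : N.+1.-tuple X) : R :=
  Num.sqrt N.+1%:R * (emean f v - c).

Lemma bmeas_emean N (f : X -> R) : bmeas f -> bmeas (@emean N f).
Proof.
move=> bf; apply: bmeasM; first exact: bmeas_cst.
by apply: bmeas_sum => i; exact: bmeas_tnth.
Qed.

Lemma bmeas_dev N c (f : X -> R) : bmeas f -> bmeas (@dev N c f).
Proof.
move=> bf; apply: bmeasM; first exact: bmeas_cst.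
by apply: bmeasB; [exact: bmeas_emean|exact: bmeas_cst].
Qed.

Lemma sqrtn_gt0 N : 0 < Num.sqrt (N.+1%:R : R).
Proof. by rewrite sqrtr_gt0 ltr0n. Qed.

Lemma sqrtn_sqr N : Num.sqrt (N.+1%:R : R) ^+ 2 = N.+1%:R.
Proof. by rewrite sqr_sqrtr// ler0n. Qed.

Lemma sqrtn_ge1 N : 1 <= Num.sqrt (N.+1%:R : R).
Proof. by rewrite -[leLHS]sqrtr1 ler_sqrt// ler1n. Qed.

Lemma devE N c (f : X -> R) (v : N.+1.-tuple X) :
  dev c f v = (Num.sqrt N.+1%:R)^-1 * \sum_(i < N.+1) (f (tnth v i) - c).
Proof.
rewrite /dev /emean big_split/= sumr_const card_ord.
have s0 := sqrtn_gt0 N; have sn := sqrtn_sqr N.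
rewrite -[(- c) *+ _]mulr_natr; move: (Num.sqrt _) sn s0 => s sn s0.
by rewrite -sn; field; rewrite gt_eqF.
Qed.

Section fixed_law.
Variables (k : R.-pker T0 ~> X) (z : T0) (u : X -> R) (B : R).
Hypotheses (bu : bmeas u) (uB : forall x, `|u x| <= B) (u0 : \int[k z]_x u x = 0).

Let k1 : k z setT = 1%E. Proof. exact: prob_kernel. Qed.

Let bE s : bmeas (fun x => expR (s * u x)).
Proof. by apply: bmeas_expR; apply: bmeasM => //; exact: bmeas_cst. Qed.

Let bsum n : bmeas (fun v : n.-tuple X => \sum_(i < n) u (tnth v i)).
Proof. by apply: bmeas_sum => i; exact: bmeas_tnth. Qed.

Let B0 : 0 <= B.
Proof.
rewrite -(@Rint_cst _ _ _ _ k1 B); apply: Rint_ge0 => x.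
exact: le_trans (uB x).
Qed.

Lemma iid_expR s n : \int[kpow k n z]_v expR (s * \sum_(i < n) u (tnth v i)) =
  (\int[k z]_x expR (s * u x)) ^+ n.
Proof.
have := @Rint_kpow_prod R _ _ T0 X k n z (fun _ x => expR (s * u x)) (fun=> bE s).
rewrite prodr_const card_ord => <-.
apply: eq_Rintegral => v _; rewrite mulr_sumr expR_sum//.
Qed.

Lemma iid_expR_le s n : `|s| * B <= 2^-1 ->
  \int[kpow k n z]_v expR (s * \sum_(i < n) u (tnth v i)) <=
  expR (2 * (s * B) ^+ 2 * n%:R).
Proof.
move=> sB; rewrite iid_expR mulrC [expR _]expRM_natl.
rewrite lerXn2r ?nnegrE ?expR_ge0//; first by apply: Rint_ge0 => x; exact: expR_ge0.
rewrite (le_trans _ (expR_ge1Dx _))//.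
apply: (@le_trans _ _ (\int[k z]_x (1 + s * u x + 2 * (s * B) ^+ 2))).
  apply: le_Rint => //.
    apply: bmeasD; last exact: bmeas_cst.
    by apply: bmeasD; [exact: bmeas_cst|apply: bmeasM => //; exact: bmeas_cst].
  move=> x; have su : `|s * u x| <= `|s| * B by rewrite normrM ler_wpM2l.
  rewrite (le_trans (expR_le_quad _)) ?(le_trans (ler_norm _) (le_trans su sB))//.
  rewrite lerD2l ler_pM2l// -[leLHS]real_normK ?num_real//.
  rewrite -[leRHS]real_normK ?num_real// lerXn2r ?nnegrE//.
  by rewrite [leRHS]normrM (ger0_norm B0).
rewrite RintD//; last 2 first.
- by apply: bmeasD; [exact: bmeas_cst|apply: bmeasM => //; exact: bmeas_cst].
- exact: bmeas_cst.
rewrite RintD//; last 2 first.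
- exact: bmeas_cst.
- by apply: bmeasM => //; exact: bmeas_cst.
by rewrite RintZ// u0 mulr0 !Rint_cst// addr0.
Qed.

(** By [exprn_even_le_expR] the moment is at most an exponential moment at a scale
    s proportional to 1 / sqrt N, and by independence the latter is the N-th power of
    1 + O(1/N). *)
Lemma iid_moment m N : 0 < B ->
  \int[kpow k N.+1 z]_v ((Num.sqrt N.+1%:R)^-1 * \sum_(i < N.+1) u (tnth v i)) ^+ m.*2 <=
  (2 * B) ^+ m.*2 * (m.*2`!%:R * (2 * expR 1)).
Proof.
move=> Bpos; pose s := (2 * B * Num.sqrt (N.+1%:R))^-1.
have s0 := sqrtn_gt0 N; have sn := sqrtn_sqr N; have s1 := sqrtn_ge1 N.
have kp1 : kpow k N.+1 z setT = 1%E by exact: prob_kernel.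
have es : (Num.sqrt N.+1%:R)^-1 = 2 * B * s :> R.
  by rewrite /s; field; rewrite !gt_eqF.
have spos : 0 < s by rewrite invr_gt0 !mulr_gt0.
have sB : s * B <= 2^-1.
  rewrite (_ : s * B = 2^-1 * (Num.sqrt N.+1%:R)^-1); last first.
    by rewrite /s; field; rewrite !gt_eqF.
  by rewrite ler_piMr// invf_le1.
have sBn : 2 * (s * B) ^+ 2 * N.+1%:R <= 1.
  rewrite -sn /s (_ : _ * _ = 2^-1); first by lra.
  by field; rewrite !gt_eqF.
have be t : bmeas (fun v : N.+1.-tuple X => expR (t * \sum_(i < N.+1) u (tnth v i))).
  by apply: bmeas_expR; apply: bmeasM; [exact: bmeas_cst|exact: bsum].
apply: (@le_trans _ _ (\int[kpow k N.+1 z]_v ((2 * B) ^+ m.*2 * (m.*2`!%:R *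
    (expR (s * \sum_(i < N.+1) u (tnth v i)) +
     expR ((- s) * \sum_(i < N.+1) u (tnth v i))))))).
  apply: le_Rint => //.
  - by apply: bmeasX; apply: bmeasM; [exact: bmeas_cst|exact: bsum].
  - do 2 (apply: bmeasM; first exact: bmeas_cst).
    by apply: bmeasD; exact: be.
  - move=> v; rewrite es -!mulrA mulrA exprMn ler_wpM2l ?exprn_ge0 ?mulr_ge0//.
    by rewrite mulNr; exact: exprn_even_le_expR.
rewrite RintZ//; last by apply: bmeasM; [exact: bmeas_cst|apply: bmeasD; exact: be].
rewrite ler_wpM2l ?exprn_ge0 ?mulr_ge0//.
rewrite RintZ//; last by apply: bmeasD; exact: be.
rewrite ler_wpM2l// RintD; [|exact: kp1|exact: be|exact: be].
rewrite mulr_natl mulr2n lerD//.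
  rewrite (le_trans (iid_expR_le _ _))// ?ler_expR//.
  by rewrite gtr0_norm.
rewrite (le_trans (iid_expR_le _ _))// ?ler_expR//.
  by rewrite normrN gtr0_norm.
by rewrite mulNr sqrrN.
Qed.

(* e is the Gaussian characteristic function of one summand, delta the error made by it. *)
Let e s := expR (- (s ^+ 2 * (\int[k z]_x u x ^+ 2) / 2)).
Let delta s := 2 * (`|s| * B) ^+ 3 + (s * B) ^+ 4.

Let Vu0 : 0 <= \int[k z]_x u x ^+ 2.
Proof. by apply: Rint_ge0 => x; rewrite sqr_ge0. Qed.

Let VuB : \int[k z]_x u x ^+ 2 <= B ^+ 2.
Proof.
apply: Rint_le_cst => //; first exact: bmeasX.
by move=> x; rewrite -[leLHS]real_normK ?num_real// lerXn2r ?nnegrE.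
Qed.

Let one_step s a : `|\int[k z]_x cos (a + s * u x) - e s * cos a| <= delta s.
Proof.
have bsu : bmeas (fun x => s * u x) by apply: bmeasM => //; exact: bmeas_cst.
have bT : bmeas (fun x => cos a - s * u x * sin a - 2^-1 * (s * u x) ^+ 2 * cos a).
  apply: bmeasB.
    apply: bmeasB; first exact: bmeas_cst.
    by apply: bmeasM => //; exact: bmeas_cst.
  apply: bmeasM; last exact: bmeas_cst.
  by apply: bmeasM; [exact: bmeas_cst|exact: bmeasX].
have bc : bmeas (fun x => cos (a + s * u x)).
  by apply: bmeas_cos; apply: measurable_funD => //; exact: bsu.1.
have -> : \int[k z]_x cos (a + s * u x) - e s * cos a =
    (\int[k z]_x (cos (a + s * u x) -
       (cos a - s * u x * sin a - 2^-1 * (s * u x) ^+ 2 * cos a))) +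
    ((1 - s ^+ 2 * (\int[k z]_x u x ^+ 2) / 2) - e s) * cos a.
  rewrite RintB//.
  have -> : \int[k z]_x (cos a - s * u x * sin a - 2^-1 * (s * u x) ^+ 2 * cos a) =
      \int[k z]_x (cos a - (s * sin a) * u x - (2^-1 * s ^+ 2 * cos a) * u x ^+ 2).
    by apply: eq_Rintegral => x _; rewrite exprMn; ring.
  rewrite RintB//; last 2 first.
  - apply: bmeasB; first exact: bmeas_cst.
    by apply: bmeasM => //; exact: bmeas_cst.
  - by apply: bmeasM; [exact: bmeas_cst|exact: bmeasX].
  rewrite RintB//; last 2 first.
  - exact: bmeas_cst.
  - by apply: bmeasM => //; exact: bmeas_cst.
  by rewrite Rint_cst// RintZ// u0 RintZ; [field|exact: k1|exact: bmeasX].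
rewrite (le_trans (ler_normD _ _))// lerD//.
  apply: norm_Rint_le_cst => //; first exact: bmeasB.
  move=> x; rewrite (le_trans (cos_Taylor2 _ _))// ler_pM2l// lerXn2r ?nnegrE ?mulr_ge0//.
  by rewrite normrM ler_wpM2l.
rewrite normrM (@le_trans _ _ (`|(1 - s ^+ 2 * (\int[k z]_x u x ^+ 2) / 2) - e s| * 1))//.
  by rewrite ler_wpM2l// cos_max.
have x0 : 0 <= s ^+ 2 * (\int[k z]_x u x ^+ 2) / 2.
  by rewrite divr_ge0// mulr_ge0// sqr_ge0.
rewrite mulr1 distrC (le_trans (expRN_Taylor1 x0))//.
rewrite (_ : 4%N = (2 * 2)%N)// exprM lerXn2r ?nnegrE ?sqr_ge0//.
rewrite exprMn -mulrA ler_wpM2l ?sqr_ge0// (le_trans _ VuB)//.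
by rewrite ler_pdivrMr// ler_peMr//; lra.
Qed.

Let e01 s : 0 <= e s <= 1.
Proof.
rewrite expR_ge0/= -[leRHS]expR0 ler_expR oppr_le0.
by rewrite divr_ge0// mulr_ge0// sqr_ge0.
Qed.

(** Lindeberg's argument: replacing the summands one at a time by Gaussian factors
    costs [delta s] each. The phase a travels along so that the induction on the
    number of summands closes, using cosines only. *)
Lemma iid_cf s a n :
  `|\int[kpow k n z]_v cos (a + s * \sum_(i < n) u (tnth v i)) - e s ^+ n * cos a|
  <= n%:R * delta s.
Proof.
have bcs m (b : R) : bmeas (fun v : m.-tuple X => cos (b + s * \sum_(i < m) u (tnth v i))).
  apply: bmeas_cos; apply: measurable_funD => //; apply: measurable_funM => //.
  exact: (bsum m).1.
have bc b : bmeas (fun x => cos (b + s * u x)).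
  by apply: bmeas_cos; apply: measurable_funD => //; apply: measurable_funM => //; exact: bu.1.
elim: n a => [|n ih] a.
  rewrite Rint_kpow0//; by rewrite big_ord0 mulr0 addr0 expr0 mul1r subrr normr0 mul0r.
rewrite Rint_kpowS//.
have /andP[e0 e1] := e01 s.
have sumE x (v : n.-tuple X) : a + s * \sum_(i < n.+1) u (tnth [tuple of x :: v] i) =
    (a + s * u x) + s * \sum_(i < n) u (tnth v i).
  rewrite big_ord_recl tnth0 mulrDr addrA; congr (_ + s * _).
  by apply: eq_bigr => i _; rewrite tnthS.
have binner : bmeas (fun x => \int[kpow k n z]_v
    cos (a + s * u x + s * \sum_(i < n) u (tnth v i))).
  have bj : bmeas (fun w : X * n.-tuple X =>
      cos (a + s * u w.1 + s * \sum_(i < n) u (tnth w.2 i))).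
    apply: bmeas_cos; apply: measurable_funD.
      apply: measurable_funD => //; apply: measurable_funM => //.
      exact: measurableT_comp bu.1 measurable_fst.
    apply: measurable_funM => //.
    exact: measurableT_comp (bsum n).1 measurable_snd.
  exact: (bmeas_Rint2 (prob_kernel z) bj).
under eq_Rintegral do under eq_Rintegral do rewrite sumE.
have -> : \int[k z]_x \int[kpow k n z]_v cos (a + s * u x + s * \sum_(i < n) u (tnth v i))
     - e s ^+ n.+1 * cos a =
   \int[k z]_x (\int[kpow k n z]_v cos (a + s * u x + s * \sum_(i < n) u (tnth v i))
     - e s ^+ n * cos (a + s * u x)) +
   e s ^+ n * (\int[k z]_x cos (a + s * u x) - e s * cos a).
  rewrite RintB//; last by apply: bmeasM => //; exact: bmeas_cst.
  by rewrite RintZ// exprSr; ring.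
rewrite (le_trans (ler_normD _ _))// -natr1 mulrDl mul1r lerD//.
  apply: norm_Rint_le_cst => //.
  by apply: bmeasB => //; apply: bmeasM => //; exact: bmeas_cst.
rewrite normrM (ger0_norm (exprn_ge0 _ e0)) (le_trans _ (one_step s a))//.
by rewrite ler_piMl// exprn_ile1.
Qed.

End fixed_law.
End iid_fluctuations.

(** * Uniform bounds for empirical fluctuations *)

Section empirical_fluctuations.
Context {R : realType} d0 d (T0 : measurableType d0) (X : measurableType d).

Definition moment_bound (M : R) m : R :=
  (2 * (2 * M)) ^+ m.*2 * (m.*2`!%:R * (2 * expR 1)).

Definition cf_bound (M t : R) : R :=
  2 * (`|t| * (2 * M)) ^+ 3 + (t * (2 * M)) ^+ 4.

Lemma cf_bound_scale (x t B s : R) : 1 <= s ->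
  s ^+ 2 * (2 * (x / s * B) ^+ 3 + (t / s * B) ^+ 4) <=
  (2 * (x * B) ^+ 3 + (t * B) ^+ 4) / s.
Proof.
move=> s1; have s0 : 0 < s by exact: lt_le_trans s1.
have t4 : 0 <= (t * B) ^+ 4 by rewrite -[4%N]/(2 * 2)%N exprM sqr_ge0.
rewrite -subr_ge0.
have -> : (2 * (x * B) ^+ 3 + (t * B) ^+ 4) / s -
    s ^+ 2 * (2 * (x / s * B) ^+ 3 + (t / s * B) ^+ 4) =
    (t * B) ^+ 4 * (s - 1) / s ^+ 2 by field; rewrite gt_eqF.
by rewrite divr_ge0 ?sqr_ge0// mulr_ge0// subr_ge0.
Qed.

Variables (k : R.-pker T0 ~> X) (z : T0) (f : X -> R) (M : R).
Hypotheses (bf : bmeas f) (fM : forall x, `|f x| <= M) (M0 : 0 < M).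

Let k1 : k z setT = 1%E. Proof. exact: prob_kernel. Qed.

Let c := \int[k z]_x f x.

Let cM : `|c| <= M. Proof. exact: norm_Rint_le_cst. Qed.

Let bu : bmeas (fun x => f x - c).
Proof. by apply: bmeasB => //; exact: bmeas_cst. Qed.

Let uB x : `|f x - c| <= 2 * M.
Proof. by rewrite (le_trans (ler_normB _ _))// mulr_natl mulr2n lerD. Qed.

Let u0 : \int[k z]_x (f x - c) = 0.
Proof. by rewrite RintB ?Rint_cst ?subrr//; exact: bmeas_cst. Qed.

Lemma dev_moment N m :
  \int[kpow k N.+1 z]_v (dev c f v) ^+ m.*2 <= moment_bound M m.
Proof.
under eq_Rintegral do rewrite devE.
by apply: (@iid_moment R _ _ T0 X k z (fun x => f x - c) (2 * M)) => //; rewrite mulr_gt0.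
Qed.

(** A rate 1 / sqrt N, rather than a bare limit, is needed: the law [k z] will
    itself vary with N and with the sampled particles, and the bound depends on f
    only through M. *)
Lemma dev_cf N t a : `|\int[kpow k N.+1 z]_v cos (a + t * dev c f v) -
    expR (- (t ^+ 2 * (\int[k z]_x f x ^+ 2 - c ^+ 2) / 2)) * cos a|
  <= cf_bound M t / Num.sqrt N.+1%:R.
Proof.
have s0 := @sqrtn_gt0 R N; have sn := @sqrtn_sqr R N; have s1 := @sqrtn_ge1 R N.
have VE := Rint_var k1 bf.
have := @iid_cf R _ _ T0 X k z (fun x => f x - c) (2 * M) bu uB u0
  (t / Num.sqrt N.+1%:R) a N.+1.
have -> : \int[kpow k N.+1 z]_v cos (a + t / Num.sqrt N.+1%:R *
     \sum_(i < N.+1) (f (tnth v i) - c)) = \int[kpow k N.+1 z]_v cos (a + t * dev c f v).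
  by apply: eq_Rintegral => v _; rewrite devE mulrA.
rewrite -/c in VE; rewrite VE -expRM_natl.
set V := _ - c ^+ 2; move: V (Num.sqrt _) sn s0 s1 => V s sn s0 s1; rewrite -sn.
have -> : s ^+ 2 * - ((t / s) ^+ 2 * V / 2) = - (t ^+ 2 * V / 2).
  by field; rewrite gt_eqF.
move=> h; apply: (le_trans h).
by rewrite /cf_bound normrM normfV (gtr0_norm s0); exact: cf_bound_scale.
Qed.

End empirical_fluctuations.

Section real_inequalities.
Context {R : realType}.

Lemma cos_lip (x y : R) : `|cos x - cos y| <= `|x - y|.
Proof.
wlog xy : x y / y <= x.
  move=> H; have [/H//|/ltW/H] := leP y x.
  by rewrite distrC [leRHS]distrC.
have [|c _ ->] := @MVT_segment R cos (fun z => - sin z) y x xy.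
  exact: continuous_subspaceT (@continuous_cos R).
by rewrite normrM normrN ler_piMl// sin_max.
Qed.

Lemma expRN_lip (x y : R) : 0 <= x -> 0 <= y -> `|expR (- x) - expR (- y)| <= `|x - y|.
Proof.
wlog xy : x y / y <= x.
  move=> H x0 y0; have [/H|/ltW/H h] := leP y x; first exact.
  by rewrite distrC [leRHS]distrC; exact: h.
move=> x0 y0; rewrite ler0_norm ?subr_le0 ?ler_expR ?lerN2// ger0_norm ?subr_ge0//.
rewrite opprB (_ : - x = - y - (x - y)); last by ring.
rewrite expRD -[X in X - _]mulr1 -mulrBr.
have h := expR_ge1Dx (- (x - y)).
have e1 : expR (- y) <= 1 by rewrite -[leRHS]expR0 ler_expR oppr_le0.
have e0 := expR_gt0 (- y).
have : 1 - expR (- (x - y)) <= x - y by lra.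
have : 0 <= 1 - expR (- (x - y)).
  by rewrite subr_ge0 -[leRHS]expR0 ler_expR oppr_le0 subr_ge0.
move: (expR (- y)) (1 - _) e0 e1 => e w e0 e1 w0 wx.
by rewrite (le_trans _ wx)// ler_piMl.
Qed.

Lemma exprD_even_le (x y : R) m : (x + y) ^+ m.*2 <= 2 ^+ m.*2 * (x ^+ m.*2 + y ^+ m.*2).
Proof.
have H (a : R) : a ^+ m.*2 = `|a| ^+ m.*2.
  by rewrite -normrX ger0_norm// -mul2n exprM exprn_ge0// sqr_ge0.
rewrite (H (x + y)) (H x) (H y); apply: (@le_trans _ _ ((2 * Num.max `|x| `|y|) ^+ m.*2)).
  rewrite lerXn2r ?nnegrE ?mulr_ge0 ?le_max ?normr_ge0//.
  rewrite (le_trans (ler_normD _ _))// mulr_natl mulr2n.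
  by rewrite lerD// le_max lexx ?orbT.
rewrite exprMn ler_wpM2l ?exprn_ge0//.
by have [_|_] := leP `|x| `|y|; [rewrite lerDr|rewrite lerDl]; exact: exprn_ge0.
Qed.

(** A ratio with random denominator e close to gamma. If e >= gamma / 2 the ratio
    is at most 2 |D| / gamma; otherwise the fluctuation d of e is at least of the
    order of s, and the a priori bound K on D / (s e) takes over, however small e
    is. *)
Lemma ratio_fluctuation (s e gamma D d K : R) :
  0 < s -> 0 < e -> 0 < gamma -> d = s * (e - gamma) -> `|D / s / e| <= K ->
  `|D / e| <= 2 / gamma * `|D| \/ `|D / e| <= 2 / gamma * (K * `|d|).
Proof.
move=> s0 e0 g0 dE DK; have [eg|eg] := leP (gamma / 2) e; [left|right].
  rewrite normrM normfV (gtr0_norm e0) mulrC ler_wpM2r// invf_ple ?posrE//; last first.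
    by rewrite divr_gt0.
  by rewrite invf_div.
have K0 : 0 <= K by exact: le_trans DK.
have -> : D / e = (D / s / e) * s by field; rewrite !gt_eqF.
rewrite normrM (gtr0_norm s0).
have sd : s <= 2 / gamma * `|d|.
  rewrite dE normrM (gtr0_norm s0) ltr0_norm ?subr_lt0; last by lra.
  rewrite mulrCA ler_peMr ?(ltW s0)// mulrAC ler_pdivlMr//; lra.
rewrite mulrCA; apply: ler_pM => //; exact: ltW.
Qed.

End real_inequalities.

(** * One step of the particle filter *)

Section filter_step.
Context {R : realType} d0 d (T : measurableType d0) (X : measurableType d).

Definition bounded_moments (nu : forall N, {measure set (N.+1.-tuple X) -> \bar R})
    (phi : {measure set X -> \bar R}) :=
  forall f, bmeas f -> forall m, exists C, forall N,
    \int[nu N]_v (dev (\int[phi]_x f x) f v) ^+ m.*2 <= C.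

(** The phase a is needed because, one generation later, the fluctuation of the
    current generation enters as a shift inside the cosine. *)
Definition gaussian_cf (nu : forall N, {measure set (N.+1.-tuple X) -> \bar R})
    (phi : {measure set X -> \bar R}) (V : (X -> R) -> R) :=
  forall f, bmeas f -> forall t a, exists C, forall N,
    `|\int[nu N]_v cos (a + t * dev (\int[phi]_x f x) f v)
      - expR (- (t ^+ 2 * V f / 2)) * cos a| <= C / Num.sqrt N.+1%:R.

Variables nu nu' : forall N, {measure set (N.+1.-tuple X) -> \bar R}.
Hypothesis nu1 : forall N, nu N setT = 1%E.
Variables (sel : forall N, R.-pker (T * N.+1.-tuple X) ~> X) (t0 : T).
Hypothesis nu'E : forall N (F : N.+1.-tuple X -> R), bmeas F ->
  \int[nu' N]_v F v = \int[nu N]_x \int[kpow (sel N) N.+1 (t0, x)]_v F v.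
Variables phi phi' : {measure set X -> \bar R}.
Hypotheses (phi1 : phi setT = 1%E) (phi'1 : phi' setT = 1%E).
Variables (G : X -> R) (bG : bmeas G) (G0 : forall x, 0 < G x) (Q : R.-pker X ~> X).

Let GQ (f : X -> R) x := G x * \int[Q x]_z f z.

Hypothesis selE : forall N, {ae nu N, forall x, forall f, bmeas f ->
  \int[sel N (t0, x)]_z f z = emean (GQ f) x / emean G x}.
Hypothesis phi'E : forall f, bmeas f ->
  \int[phi']_x f x = (\int[phi]_x GQ f x) / \int[phi]_x G x.

Hypothesis nu_mom : bounded_moments nu phi.

Let gamma := \int[phi]_x G x.

Let gamma0 : 0 < gamma. Proof. exact: Rint_gt0. Qed.

(** For c the next predictor of f, this function is centred for the current
    predictor, and the empirical mean of the selection law deviates from c exactly by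
    the ratio of the empirical means of [step_fun f c] and of G. *)
Definition step_fun (f : X -> R) (c : R) x := G x * (\int[Q x]_z f z - c).

Let gbar f := step_fun f (\int[phi']_x f x).

Let bGQ f : bmeas f -> bmeas (GQ f).
Proof. by move=> bf; apply: bmeasM => //; exact: bmeas_kernel. Qed.

Lemma bmeas_step_fun f c : bmeas f -> bmeas (step_fun f c).
Proof.
move=> bf; apply: bmeasM => //; apply: bmeasB; first exact: bmeas_kernel.
exact: bmeas_cst.
Qed.

Let bgbar f : bmeas f -> bmeas (gbar f). Proof. exact: bmeas_step_fun. Qed.

Lemma Rint_step_fun f : bmeas f -> \int[phi]_x step_fun f (\int[phi']_x f x) x = 0.
Proof.
move=> bf; rewrite /step_fun; under eq_Rintegral do rewrite mulrBr.
rewrite RintB ?RintZr//; last 2 first.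
- exact: bGQ.
- by apply: bmeasM => //; exact: bmeas_cst.
by rewrite phi'E// mulrCA mulfV ?mulr1 ?subrr// gt_eqF.
Qed.

Let bdev N c f : bmeas f -> bmeas (@dev R _ X N c f).
Proof. exact: bmeas_dev. Qed.

Lemma emean_gt0 N v : 0 < @emean R _ X N G v.
Proof.
rewrite mulr_gt0 ?invr_gt0 ?ltr0n// big_ord_recl ltr_pwDl// sumr_ge0// => i _.
exact: ltW.
Qed.

(** The conditional mean of the next fluctuation given the current particles. *)
Let amp f N (x : N.+1.-tuple X) : R :=
  Num.sqrt N.+1%:R * (\int[sel N (t0, x)]_z f z - \int[phi']_x f x).

Let D f N (x : N.+1.-tuple X) : R := dev 0 (gbar f) x.
Let dG N (x : N.+1.-tuple X) : R := dev gamma G x.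

(** A bound for the powers of [amp] whose integral is bounded uniformly in N. *)
Let H M f m N (x : N.+1.-tuple X) : R :=
  (2 / gamma) ^+ m.*2 * (D f x ^+ m.*2 + (2 * M) ^+ m.*2 * dG x ^+ m.*2).

Let ev_ge0 (a : R) m : 0 <= a ^+ m.*2.
Proof. by rewrite -mul2n exprM exprn_ge0// sqr_ge0. Qed.

Let ev_norm (a : R) m : a ^+ m.*2 = `|a| ^+ m.*2.
Proof. by rewrite -normrX ger0_norm. Qed.

Let bH M f m N : bmeas f -> bmeas (@H M f m N).
Proof.
move=> bf; apply: bmeasM; first exact: bmeas_cst.
apply: bmeasD; first by apply: bmeasX; apply: bdev; exact: bgbar.
by apply: bmeasM; [exact: bmeas_cst|apply: bmeasX; exact: bdev].
Qed.

Let H_int f M : bmeas f -> forall m, exists2 C, 0 <= C & forall N,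
  \int[nu N]_x H M f m x <= C.
Proof.
move=> bf m; have [C1 hC1] := nu_mom (bgbar bf) m.
have [C2 hC2] := nu_mom bG m.
have C1_ge0 : 0 <= C1 by apply: le_trans (hC1 0%N); apply: Rint_ge0 => x; exact: ev_ge0.
have C2_ge0 : 0 <= C2 by apply: le_trans (hC2 0%N); apply: Rint_ge0 => x; exact: ev_ge0.
exists ((2 / gamma) ^+ m.*2 * (C1 + (2 * M) ^+ m.*2 * C2)).
  by rewrite mulr_ge0// addr_ge0// mulr_ge0.
move=> N; have n1 := nu1 N; have bD : bmeas (fun x : N.+1.-tuple X => D f x ^+ m.*2).
  by apply: bmeasX; apply: bdev; exact: bgbar.
have bd : bmeas (fun x : N.+1.-tuple X => dG x ^+ m.*2) by apply: bmeasX; exact: bdev.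
rewrite RintZ//; last first.
  by apply: bmeasD => //; apply: bmeasM => //; exact: bmeas_cst.
rewrite ler_wpM2l// RintD//; last by apply: bmeasM => //; exact: bmeas_cst.
rewrite RintZ// lerD//; last by rewrite ler_wpM2l.
by have := hC1 N; rewrite Rint_step_fun.
Qed.

Let amp_good f M N : bmeas f -> (forall x, `|f x| <= M) ->
  {ae nu N, forall x : N.+1.-tuple X,
    [/\ amp f x = D f x / emean G x,
        forall m, amp f x ^+ m.*2 <= H M f m x &
        `|amp f x - D f x / gamma| <=
           (H M f 1 x + dG x ^+ 2) / gamma / Num.sqrt N.+1%:R]}.
Proof.
move=> bf fM; apply: filterS (selE N) => x hx.
have s0 := @sqrtn_gt0 R N; have e0 := emean_gt0 x.
have key : emean (GQ f) x - (\int[phi']_x f x) * emean G x = emean (gbar f) x.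
  rewrite /emean mulrCA -mulrBr; congr (_ * _).
  rewrite mulr_sumr -sumrB; apply: eq_bigr => i _.
  by rewrite /GQ /gbar /step_fun; ring.
have ampE : amp f x = D f x / emean G x.
  rewrite /amp hx// /D /dev subr0 -key.
  move: (emean (GQ f) x) (emean G x) e0 (Num.sqrt _) (\int[phi']_x _) => a e e0 s c.
  by field; rewrite gt_eqF.
have Msel : `|D f x / Num.sqrt N.+1%:R / emean G x| <= 2 * M.
  have -> : D f x / Num.sqrt N.+1%:R / emean G x =
      \int[sel N (t0, x)]_z f z - \int[phi']_x f x.
    rewrite mulrAC -ampE /amp; field; rewrite gt_eqF//.
  rewrite (le_trans (ler_normB _ _))// mulr_natl mulr2n lerD//.
    exact: (norm_Rint_le_cst (prob_kernel (t0, x))).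
  exact: norm_Rint_le_cst.
have M0 : 0 <= M by have := le_trans (normr_ge0 _) Msel; lra.
have gV : 0 <= gamma^-1 by rewrite invr_ge0 ltW.
have H1 := ratio_fluctuation s0 e0 gamma0 (erefl (dG x)) Msel.
have ampH m : amp f x ^+ m.*2 <= H M f m x.
  rewrite /H mulrDr ev_norm; have g2 : 0 <= 2 / gamma by rewrite divr_ge0// ltW.
  case: H1; rewrite -ampE => h.
    apply: (@le_trans _ _ ((2 / gamma) ^+ m.*2 * D f x ^+ m.*2)).
      by rewrite (ev_norm (D f x)) -exprMn lerXn2r ?nnegrE// mulr_ge0.
    by rewrite lerDl !mulr_ge0.
  apply: (@le_trans _ _ ((2 / gamma) ^+ m.*2 * ((2 * M) ^+ m.*2 * dG x ^+ m.*2))).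
    rewrite (ev_norm (dG x)) -!exprMn lerXn2r ?nnegrE//.
    by rewrite !mulr_ge0.
  by rewrite lerDr mulr_ge0.
split => //.
have -> : amp f x - D f x / gamma = - (amp f x * dG x) / gamma / Num.sqrt N.+1%:R.
  rewrite ampE /dG /dev -/gamma; move: (Num.sqrt _) s0 => s s0; field.
  by rewrite !gt_eqF.
rewrite !normrM normrN !normfV (gtr0_norm gamma0) (gtr0_norm s0).
rewrite ler_pM2r ?invr_gt0// ler_pM2r ?invr_gt0// normrM.
rewrite (le_trans _ (lerD (ampH 1) (lexx _)))// -[1.*2]/2%N.
rewrite -[X in _ <= X + _]real_normK ?num_real// -[X in _ <= _ + X]real_normK ?num_real//.
have : 0 <= (`|amp f x| - `|dG x|) ^+ 2 by rewrite sqr_ge0.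
have : 0 <= `|amp f x| ^+ 2 + `|dG x| ^+ 2 by rewrite addr_ge0 ?sqr_ge0.
by rewrite !expr2; lra.
Qed.

Let inner_decomp f N (x v : N.+1.-tuple X) :
  dev (\int[phi']_x f x) f v = dev (\int[sel N (t0, x)]_z f z) f v + amp f x.
Proof. by rewrite /dev /amp; ring. Qed.

(** The next fluctuation is the sum of an independent-sample fluctuation, bounded by
    [dev_moment] whatever the particles, and of [amp], bounded by [H]. *)
Lemma step_bounded_moments : bounded_moments nu' phi'.
Proof.
move=> f bf m; have [M M0 fM] := bmeas_ge0_bound bf.
have [C C0 HC] := H_int M bf m.
exists (2 ^+ m.*2 * (moment_bound M m + C)) => N.
have bd c : bmeas (fun v : N.+1.-tuple X => dev c f v ^+ m.*2) by apply: bmeasX; exact: bdev.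
have n1 := nu1 N; rewrite nu'E//.
apply: (@le_trans _ _ (\int[nu N]_x (2 ^+ m.*2 * (moment_bound M m + H M f m x)))).
  apply: le_Rint_ae => //.
  - exact: (bmeas_kernel (kpre (kpow (sel N) N.+1) (pair1_measurable t0)) (bd _)).
  - apply: bmeasM; first exact: bmeas_cst.
    by apply: bmeasD; [exact: bmeas_cst|exact: bH].
  apply: filterS (amp_good N bf fM) => x [_ ampH _].
  have k1 : kpow (sel N) N.+1 (t0, x) setT = 1%E by exact: prob_kernel.
  apply: (@le_trans _ _ (\int[kpow (sel N) N.+1 (t0, x)]_v
      (2 ^+ m.*2 * (dev (\int[sel N (t0, x)]_z f z) f v ^+ m.*2 + amp f x ^+ m.*2)))).
    apply: le_Rint => //.
      apply: bmeasM; first exact: bmeas_cst.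
      by apply: bmeasD => //; exact: bmeas_cst.
    by move=> v; rewrite (inner_decomp f x v); exact: exprD_even_le.
  rewrite RintZ//; last by apply: bmeasD => //; exact: bmeas_cst.
  rewrite ler_wpM2l ?exprn_ge0// RintD//; last exact: bmeas_cst.
  by rewrite Rint_cst// lerD//; exact: dev_moment.
rewrite RintZ//; last by apply: bmeasD; [exact: bmeas_cst|exact: bH].
rewrite ler_wpM2l ?exprn_ge0// RintD//; last 2 first.
- exact: bmeas_cst.
- exact: bH.
by rewrite Rint_cst// lerD2l.
Qed.

Variable V : (X -> R) -> R.
Hypothesis nu_cf : gaussian_cf nu phi V.

(** Sampling noise of the new generation, plus the noise of the current one
    transported by the selection step. *)
Definition step_variance (f : X -> R) : R :=
  \int[phi']_x f x ^+ 2 - (\int[phi']_x f x) ^+ 2 +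
  V (step_fun f (\int[phi']_x f x)) / (\int[phi]_x G x) ^+ 2.

(** Given the current particles, the new ones are independent, so [dev_cf] gives a
    Gaussian factor with their conditional variance W and a phase t [amp]. Up to
    O(1 / sqrt N) in the mean, W may be replaced by its limit and [amp] by the current
    fluctuation of [gbar f] divided by gamma; the assumption on the current
    generation concludes. *)
Lemma step_gaussian_cf : gaussian_cf nu' phi' step_variance.
Proof.
move=> f bf t a; have [M M0 fM] := bmeas_ge0_bound bf.
have bf2 : bmeas (fun x => f x ^+ 2) by exact: bmeasX.
have f2M x : `|f x ^+ 2| <= M ^+ 2 by rewrite normrX lerXn2r// nnegrE ltW.
pose V0 := \int[phi']_x f x ^+ 2 - (\int[phi']_x f x) ^+ 2.
have V00 : 0 <= V0 by exact: Rint_var_ge0.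
have [Cc hCc] := nu_cf (bgbar bf) (t / gamma) a.
have [C1 C10 hC1] := H_int M bf 1.
have [C2 C20 hC2] := H_int (M ^+ 2) bf2 1.
have [C3 hC3] := nu_mom bG 1.
pose K N (x : N.+1.-tuple X) : R := cf_bound M t +
  t ^+ 2 / 2 * ((1 + H (M ^+ 2) (fun x => f x ^+ 2) 1 x) + 2 * M * (1 + H M f 1 x)) +
  `|t| * ((H M f 1 x + dG x ^+ 2) / gamma).
pose CK := cf_bound M t + t ^+ 2 / 2 * ((1 + C2) + 2 * M * (1 + C1)) +
  `|t| * ((C1 + C3) / gamma).
exists (CK + Cc) => N; have n1 := nu1 N.
have s0 := @sqrtn_gt0 R N.
have b1 := bH M 1 N bf; have b2 := bH (M ^+ 2) 1 N bf2.
have b3 : bmeas (fun x : N.+1.-tuple X => dG x ^+ 2) by apply: bmeasX; exact: bdev.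
have bb1 : bmeas (fun x : N.+1.-tuple X => 2 * M * (1 + H M f 1 x)).
  by apply: bmeasM; [exact: bmeas_cst|apply: bmeasD => //; exact: bmeas_cst].
have bb2 : bmeas (fun x : N.+1.-tuple X => 1 + H (M ^+ 2) (fun x => f x ^+ 2) 1 x).
  by apply: bmeasD => //; exact: bmeas_cst.
have bb3 : bmeas (fun x : N.+1.-tuple X => H M f 1 x + dG x ^+ 2) by exact: bmeasD.
have bb3' : bmeas (fun x : N.+1.-tuple X => (H M f 1 x + dG x ^+ 2) / gamma).
  by apply: bmeasM => //; exact: bmeas_cst.
have bb12 := bmeasD bb2 bb1.
have bb12' : bmeas (fun x : N.+1.-tuple X => t ^+ 2 / 2 *
    ((1 + H (M ^+ 2) (fun x => f x ^+ 2) 1 x) + 2 * M * (1 + H M f 1 x))).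
  by apply: bmeasM => //; exact: bmeas_cst.
have bb3'' : bmeas (fun x : N.+1.-tuple X => `|t| * ((H M f 1 x + dG x ^+ 2) / gamma)).
  by apply: bmeasM => //; exact: bmeas_cst.
have bK1 : bmeas (fun x : N.+1.-tuple X => cf_bound M t + t ^+ 2 / 2 *
    ((1 + H (M ^+ 2) (fun x => f x ^+ 2) 1 x) + 2 * M * (1 + H M f 1 x))).
  by apply: bmeasD => //; exact: bmeas_cst.
have bK : bmeas (@K N) by exact: bmeasD.
have Kint : \int[nu N]_x K N x <= CK.
  rewrite /K RintD// lerD//.
    rewrite RintD//; last exact: bmeas_cst.
    rewrite Rint_cst// lerD2l RintZ// ler_wpM2l ?divr_ge0 ?sqr_ge0//.
    rewrite RintD// lerD//.
      by rewrite RintD ?Rint_cst ?lerD2l//; exact: bmeas_cst.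
    rewrite RintZ; [|exact: n1|by apply: bmeasD => //; exact: bmeas_cst].
    rewrite ler_wpM2l ?mulr_ge0 ?(ltW M0)//.
    by rewrite RintD ?Rint_cst ?lerD2l//; exact: bmeas_cst.
  rewrite RintZ// ler_wpM2l// RintZr// ler_wpM2r ?invr_ge0 ?(ltW gamma0)//.
  by rewrite RintD// lerD//; exact: hC3.
pose F (v : N.+1.-tuple X) := cos (a + t * dev (\int[phi']_x f x) f v).
have bF : bmeas F.
  apply: bmeas_cos; apply: measurable_funD => //; apply: measurable_funM => //.
  exact: (bdev _ _ bf).1.
pose I x := \int[kpow (sel N) N.+1 (t0, x)]_v F v.
have bI : bmeas I.
  exact: (bmeas_kernel (kpre (kpow (sel N) N.+1) (pair1_measurable t0)) bF).
pose e0 := expR (- (t ^+ 2 * V0 / 2)).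
have e01 : 0 <= e0 <= 1.
  rewrite expR_ge0/= -[leRHS]expR0 ler_expR oppr_le0.
  by rewrite divr_ge0// mulr_ge0// sqr_ge0.
pose J (x : N.+1.-tuple X) := cos (a + t / gamma * dev (\int[phi]_x gbar f x) (gbar f) x).
have bJ : bmeas J.
  apply: bmeas_cos; apply: measurable_funD => //; apply: measurable_funM => //.
  exact: (bdev _ _ (bgbar bf)).1.
have beJ : bmeas (fun x => e0 * J x) by apply: bmeasM => //; exact: bmeas_cst.
have IJ : {ae nu N, forall x, `|I x - e0 * J x| <= K N x / Num.sqrt N.+1%:R}.
  apply: filterS2 (amp_good N bf fM) (amp_good N bf2 f2M) => x [_ ampf amp1] [_ ampf2 _].
  pose m1 := \int[sel N (t0, x)]_z f z.
  pose W := \int[sel N (t0, x)]_z f z ^+ 2 - m1 ^+ 2.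
  have W0 : 0 <= W by apply: Rint_var_ge0 => //; exact: prob_kernel.
  have h1 : `|I x - expR (- (t ^+ 2 * W / 2)) * cos (a + t * amp f x)| <=
      cf_bound M t / Num.sqrt N.+1%:R.
    have -> : I x = \int[kpow (sel N) N.+1 (t0, x)]_v
        cos (a + t * amp f x + t * dev m1 f v).
      by apply: eq_Rintegral => v _; rewrite /F (inner_decomp f x v); congr cos; ring.
    exact: (@dev_cf R _ _ _ X (sel N) (t0, x) f M bf fM N t (a + t * amp f x)).
  have h2 : `|expR (- (t ^+ 2 * W / 2)) - e0| <= t ^+ 2 / 2 *
      ((1 + H (M ^+ 2) (fun x => f x ^+ 2) 1 x) + 2 * M * (1 + H M f 1 x)) / Num.sqrt N.+1%:R.
    have q (r : R) : 0 <= r -> 0 <= t ^+ 2 * r / 2.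
      by move=> r0; rewrite divr_ge0// mulr_ge0// sqr_ge0.
    rewrite (le_trans (expRN_lip (q _ W0) (q _ V00)))//.
    have -> : t ^+ 2 * W / 2 - t ^+ 2 * V0 / 2 = t ^+ 2 / 2 * (W - V0) by ring.
    rewrite normrM ger0_norm ?divr_ge0 ?sqr_ge0// -mulrA ler_wpM2l ?divr_ge0 ?sqr_ge0//.
    have lin (r : R) : `|r| <= 1 + r ^+ 2.
      rewrite -[r ^+ 2]real_normK ?num_real//.
      by have := sqr_ge0 (`|r| - 1); rewrite !expr2; have : 0 <= `|r| by []; nra.
    have m1M : `|m1 + \int[phi']_x f x| <= 2 * M.
      rewrite (le_trans (ler_normD _ _))// mulr_natl mulr2n lerD//.
        exact: (norm_Rint_le_cst (prob_kernel (t0, x))).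
      exact: norm_Rint_le_cst.
    have -> : W - V0 = (amp (fun x => f x ^+ 2) x - (m1 + \int[phi']_x f x) * amp f x) /
        Num.sqrt N.+1%:R.
      rewrite /W /V0 /amp -/m1; move: (Num.sqrt _) s0 => s s0.
      by field; rewrite gt_eqF.
    rewrite normrM normfV (gtr0_norm s0) ler_wpM2r ?invr_ge0 ?(ltW s0)//.
    rewrite (le_trans (ler_normB _ _))// lerD//.
      by rewrite (le_trans (lin _))// lerD2l; exact: (ampf2 1).
    rewrite normrM ler_pM//.
    by rewrite (le_trans (lin _))// lerD2l; exact: (ampf 1).
  have h3 : `|cos (a + t * amp f x) - J x| <=
      `|t| * ((H M f 1 x + dG x ^+ 2) / gamma) / Num.sqrt N.+1%:R.
    rewrite (le_trans (cos_lip _ _))// /J Rint_step_fun//.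
    have -> : a + t * amp f x - (a + t / gamma * dev 0 (gbar f) x) =
      t * (amp f x - D f x / gamma) by rewrite /D; ring.
    by rewrite normrM -[leRHS]mulrA ler_wpM2l.
  have -> : I x - e0 * J x =
      (I x - expR (- (t ^+ 2 * W / 2)) * cos (a + t * amp f x)) +
      ((expR (- (t ^+ 2 * W / 2)) - e0) * cos (a + t * amp f x) +
       e0 * (cos (a + t * amp f x) - J x)) by ring.
  rewrite (le_trans (ler_normD _ _))// /K 2![(_ + _) / _]mulrDl -addrA lerD//.
  rewrite (le_trans (ler_normD _ _))// lerD//.
    by rewrite normrM (le_trans _ h2)// ler_piMr// cos_max.
  have /andP[e00 e0le1] := e01.
  by rewrite normrM (ger0_norm e00) (le_trans _ h3)// ler_piMl.
rewrite nu'E//.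
have -> : \int[nu N]_x \int[kpow (sel N) N.+1 (t0, x)]_v cos (a + t * dev (\int[phi']_x0 f x0) f v)
   - expR (- (t ^+ 2 * step_variance f / 2)) * cos a =
  \int[nu N]_x (I x - e0 * J x) + e0 * (\int[nu N]_x J x -
     expR (- ((t / gamma) ^+ 2 * V (gbar f) / 2)) * cos a).
  rewrite RintB// RintZ// mulrBr mulrA -expRD.
  have -> : - (t ^+ 2 * step_variance f / 2) =
      - (t ^+ 2 * V0 / 2) - (t / gamma) ^+ 2 * V (gbar f) / 2.
    rewrite /step_variance -/V0 -/(gbar f) -/gamma.
    by field; rewrite gt_eqF.
  by rewrite /I; ring.
rewrite (le_trans (ler_normD _ _))// [(CK + Cc) / _]mulrDl lerD//.
  rewrite (le_trans (le_norm_Rint n1 _))//; first exact: bmeasB.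
  apply: (@le_trans _ _ (\int[nu N]_x (K N x / Num.sqrt N.+1%:R))).
    apply: le_Rint_ae => //.
    - by apply: bmeas_norm; exact: bmeasB.
    - by apply: bmeasM => //; exact: bmeas_cst.
  by rewrite RintZr// ler_wpM2r ?invr_ge0 ?(ltW s0).
have /andP[e00 e0le1] := e01.
by rewrite normrM (ger0_norm e00) (le_trans _ (hCc N))// ler_piMl.
Qed.

End filter_step.

(** * Unnormalized predictors *)

Section unnormalized_predictor.
Local Open Scope ereal_scope.
Context dX dY (X : measurableType dX) (Y : measurableType dY) (R : realType).
Variables (Q : R.-pker X ~> X) (g : {mfun (X * Y)%type >-> R}).

Lemma measurable_integral_L (s : seq Y) (f : X -> \bar R) :
  (forall x, 0 <= f x) -> measurable_fun setT f ->
  measurable_fun setT (fun x => \int[L Q g s x]_z f z).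
Proof.
move=> f0 mf; apply: measurable_fun_integral_kernel => // U mU.
exact: measurable_kernel.
Qed.

Lemma integral_gQ y x (f : X -> \bar R) :
  (forall x, 0 <= f x) -> measurable_fun setT f ->
  \int[gQ Q g y x]_z f z = (`|g (x, y)|)%:E * \int[Q x]_z f z.
Proof. by move=> f0 mf; rewrite ge0_integral_mscale. Qed.

Lemma integral_L_cons y s x (f : X -> \bar R) :
  (forall x, 0 <= f x) -> measurable_fun setT f ->
  \int[L Q g (y :: s) x]_z f z =
  (`|g (x, y)|)%:E * \int[Q x]_z \int[L Q g s z]_u f u.
Proof.
move=> f0 mf; rewrite [LHS](integral_kcomp (gQ Q g y) (ksnd (L Q g s)))//.
rewrite -integral_gQ//; first by move=> z; exact: integral_ge0.
exact: measurable_integral_L.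
Qed.

Lemma integral_L_nil x (f : X -> \bar R) :
  measurable_fun setT f -> \int[L Q g [::] x]_z f z = f x.
Proof. by move=> mf; rewrite /= /kdirac integral_dirac// diracT mul1e. Qed.

Lemma integral_L_cat s1 s2 x (f : X -> \bar R) :
  (forall x, 0 <= f x) -> measurable_fun setT f ->
  \int[L Q g (s1 ++ s2) x]_z f z = \int[L Q g s1 x]_z \int[L Q g s2 z]_u f u.
Proof.
move=> f0 mf.
have h0 z : 0 <= \int[L Q g s2 z]_u f u by exact: integral_ge0.
have mh := measurable_integral_L s2 f0 mf.
elim: s1 x => [|y s1 ih] x; first by rewrite integral_L_nil.
rewrite cat_cons !integral_L_cons//; congr (_ * _).
by apply: eq_integral => z _.
Qed.

Variable chi : probability X R.

(** Its total mass is the likelihood of the observations, and [predictor] is its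
    normalization. *)
Definition upredictor (s : seq Y) : {measure set X -> \bar R} := mkmeasure chi (L Q g s).

Lemma integral_upredictor s (f : X -> \bar R) :
  (forall x, 0 <= f x) -> measurable_fun setT f ->
  \int[upredictor s]_z f z = \int[chi]_x \int[L Q g s x]_z f z.
Proof.
move=> f0 mf.
rewrite (@eq_measure_integral _ _ _ setT
  (mkcomp (kcst chi : R.-sfker unit ~> X) (ksnd (L Q g s)) tt))//.
by rewrite [LHS](integral_kcomp (kcst chi : R.-sfker unit ~> X) (ksnd (L Q g s))).
Qed.

Lemma integral_upredictor_cat s1 s2 (f : X -> \bar R) :
  (forall x, 0 <= f x) -> measurable_fun setT f ->
  \int[upredictor (s1 ++ s2)]_z f z =
  \int[upredictor s1]_x \int[L Q g s2 x]_z f z.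
Proof.
move=> f0 mf; rewrite !integral_upredictor//; last 2 first.
- by move=> x; exact: integral_ge0.
- exact: measurable_integral_L.
by apply: eq_integral => x _; rewrite integral_L_cat.
Qed.

Lemma integral_upredictor_rcons s y (f : X -> \bar R) :
  (forall x, 0 <= f x) -> measurable_fun setT f ->
  \int[upredictor (rcons s y)]_z f z =
  \int[upredictor s]_x ((`|g (x, y)|)%:E * \int[Q x]_z f z).
Proof.
move=> f0 mf; rewrite -cats1 integral_upredictor_cat//.
apply: eq_integral => x _; rewrite integral_L_cons//; congr (_ * _).
by apply: eq_integral => z _; rewrite integral_L_nil.
Qed.

Lemma upredictor_nil A : measurable A -> upredictor [::] A = chi A.
Proof.
move=> mA; rewrite /upredictor /= /mkmeasure /=.
by have := integral_indic chi measurableT mA; rewrite setIT => <-.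
Qed.

Lemma integral_predictor s (f : X -> \bar R) :
  0 < upredictor s setT -> upredictor s setT < +oo ->
  (forall x, 0 <= f x) -> measurable_fun setT f ->
  \int[upredictor s]_z f z =
  upredictor s setT * \int[predictor Q g chi s]_z f z.
Proof.
move=> m0 mfin f0 mf.
have k0 : (0 <= (fine (upredictor s setT))^-1)%R by rewrite invr_ge0 fine_ge0.
have fn : upredictor s setT \is a fin_num by rewrite ge0_fin_numE.
rewrite (@eq_measure_integral _ _ _ setT (mscale (NngNum k0) (upredictor s))
  (predictor Q g chi s)); last first.
  move=> A mA _; rewrite /predictor /= /mnormalize -/(upredictor s).
  by rewrite gt_eqF//= lt_eqF//= /mscale/= muleC.
rewrite ge0_integral_mscale// muleA.
have -> : upredictor s setT * ((NngNum k0)%:num)%:E = 1.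
  rewrite -{1}(fineK fn) -EFinM/= mulfV//.
  by rewrite gt_eqF// fine_gt0// m0 mfin.
by rewrite mul1e.
Qed.

End unnormalized_predictor.

(** * Recursions for the predictor and the asymptotic variance *)

(** Almost everywhere for the m-th unnormalized predictor, g(., y_m) is bounded by M,
    so that g may be truncated at M in all the integrals. Unlike a bound on the
    supremum, this is a measurable condition on the observations. *)
Section predictor_recursion.
Context dX dY (X : measurableType dX) (Y : measurableType dY) (R : realType).
Variables (Q : R.-pker X ~> X) (g : {mfun (X * Y)%type >-> R}).
Hypothesis g_gt0 : forall x y, 0 < g (x, y).
Variables (chi : probability X R) (ob : nat -> Y) (n : nat) (M : R).
Hypothesis M0 : 0 < M.

Definition obs m : seq Y := [seq ob k | k <- iota 0 m].

Lemma size_obs m : size (obs m) = m. Proof. by rewrite size_map size_iota. Qed.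

Lemma obsS m : obs m.+1 = rcons (obs m) (ob m).
Proof. by rewrite /obs -addn1 iotaD map_cat cats1 add0n. Qed.

Lemma take_obs k m : (k <= m)%N -> take k (obs m) = obs k.
Proof. by move=> km; rewrite /obs -map_take take_iota (minn_idPl km). Qed.

Definition trunc_g m (x : X) : R := Num.min (g (x, ob m)) M.

Lemma trunc_g_gt0 m x : 0 < trunc_g m x.
Proof. by rewrite /trunc_g lt_min g_gt0. Qed.

Lemma measurable_g m : measurable_fun setT (fun x => g (x, ob m)).
Proof. exact: (measurableT_comp (measurable_funPT g) (pair2_measurable (ob m))). Qed.

Lemma bmeas_trunc_g m : bmeas (trunc_g m).
Proof.
split; first by apply: measurable_minr => //; exact: measurable_g.
by exists M => x; rewrite gtr0_norm ?trunc_g_gt0// /trunc_g ge_min lexx orbT.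
Qed.

Local Notation Lam m := (upredictor Q g chi (obs m)).
Local Notation phi m := (predictor Q g chi (obs m)).

Hypothesis good : forall m, (m < n)%N -> Lam m [set x | M < g (x, ob m)] = 0%E.

Lemma measurable_exceed m : measurable [set x | M < g (x, ob m)].
Proof.
rewrite -[X in measurable X]setTI.
have := @measurable_g m measurableT _ (measurable_itv `]M, +oo[%R).
by rewrite (_ : _ @^-1` _ = [set x | M < g (x, ob m)])//;
  apply/seteqP; split=> x/=; rewrite in_itv/= andbT.
Qed.

Let trunc_gE m x : ~ M < g (x, ob m) -> trunc_g m x = g (x, ob m).
Proof. by move=> /negP; rewrite -leNgt /trunc_g => /min_idPl. Qed.

Lemma ae_trunc_g m : (m < n)%N -> {ae Lam m, forall x, g (x, ob m) = trunc_g m x}.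
Proof.
move=> mn; exists [set x | M < g (x, ob m)]; split; [exact: measurable_exceed|exact: good|].
by move=> x /=; apply: contra_notP => /trunc_gE.
Qed.

Lemma integral_Lam_S m (f : X -> \bar R) : (m < n)%N ->
  (forall x, (0 <= f x)%E) -> measurable_fun setT f ->
  (\int[Lam m.+1]_z f z = \int[Lam m]_x ((trunc_g m x)%:E * \int[Q x]_z f z))%E.
Proof.
move=> mn f0 mf; rewrite obsS integral_upredictor_rcons//.
have mQ : measurable_fun setT (fun x => \int[Q x]_z f z)%E.
  by apply: measurable_fun_integral_kernel => // U mU; exact: measurable_kernel.
apply: ae_eq_integral => //.
- apply: emeasurable_funM => //; apply/measurable_EFinP.
  by apply: measurableT_comp => //; exact: measurable_g.
- apply: emeasurable_funM => //; apply/measurable_EFinP.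
  exact: (bmeas_trunc_g m).1.
- apply: filterS (ae_trunc_g mn) => x gx _.
  by rewrite gx ger0_norm// ltW// trunc_g_gt0.
Qed.

Let trunc_mean_gt0 m : 0 < \int[phi m]_x trunc_g m x.
Proof.
by apply: Rint_gt0; [exact: probability_setT|exact: bmeas_trunc_g|exact: trunc_g_gt0].
Qed.

Let massS m : (m < n)%N -> (0 < Lam m setT < +oo)%E ->
  (Lam m.+1 setT = Lam m setT * (\int[phi m]_x trunc_g m x)%:E)%E.
Proof.
move=> mn /andP[m0 mfin].
rewrite -[LHS]mul1e -integral_cst// integral_Lam_S//.
rewrite -(bmeas_EFin (probability_setT _) (bmeas_trunc_g m)).
rewrite -integral_predictor//; last 2 first.
- by move=> x; rewrite lee_fin ltW// trunc_g_gt0.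
- by apply/measurable_EFinP; exact: (bmeas_trunc_g m).1.
apply: eq_integral => x _.
by rewrite integral_cst// prob_kernel mule1 mule1.
Qed.

Lemma upredictor_mass m : (m <= n)%N -> (0 < Lam m setT < +oo)%E.
Proof.
elim: m => [|m ih] mn.
  by rewrite [obs 0]/= upredictor_nil// probability_setT lte01 ltry.
have h := ih (ltnW mn); have := massS mn h; case/andP: h => m0 mfin ->.
have fn : Lam m setT \is a fin_num by rewrite ge0_fin_numE.
rewrite -(fineK fn) -EFinM lte_fin ltry andbT.
by rewrite mulr_gt0// fine_gt0// m0 mfin.
Qed.

Definition kappa m : R := fine (Lam m setT).

Lemma kappaE m : (m <= n)%N -> Lam m setT = (kappa m)%:E.
Proof.
move=> mn; have /andP[_ mfin] := upredictor_mass mn.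
by rewrite /kappa fineK// ge0_fin_numE.
Qed.

Lemma kappa_gt0 m : (m <= n)%N -> 0 < kappa m.
Proof. by move=> mn; rewrite /kappa fine_gt0// upredictor_mass. Qed.

Lemma kappaS m : (m < n)%N -> kappa m.+1 = kappa m * \int[phi m]_x trunc_g m x.
Proof.
move=> mn; have := massS mn (upredictor_mass (ltnW mn)).
by rewrite (kappaE mn) (kappaE (ltnW mn)) -EFinM => -[].
Qed.

Lemma integral_Lam_phi m (f : X -> \bar R) : (m <= n)%N ->
  (forall x, (0 <= f x)%E) -> measurable_fun setT f ->
  (\int[Lam m]_z f z = (kappa m)%:E * \int[phi m]_z f z)%E.
Proof.
move=> mn f0 mf; have /andP[? ?] := upredictor_mass mn.
by rewrite integral_predictor// kappaE.
Qed.

Lemma predictorS m (f : X -> R) : (m < n)%N -> bmeas f ->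
  \int[phi m.+1]_x f x =
  (\int[phi m]_x (trunc_g m x * \int[Q x]_z f z)) / \int[phi m]_x trunc_g m x.
Proof.
move=> mn bf; have p1 k : phi k setT = 1%E by exact: probability_setT.
have gn0 : \int[phi m]_x trunc_g m x != 0 by rewrite gt_eqF// trunc_mean_gt0.
have key (h : X -> R) : (forall x, 0 <= h x) -> bmeas h ->
  \int[phi m.+1]_x h x =
  (\int[phi m]_x (trunc_g m x * \int[Q x]_z h z)) / \int[phi m]_x trunc_g m x.
  move=> h0 bh.
  have h0E x : (0 <= (h x)%:E)%E by rewrite lee_fin.
  have mhE : measurable_fun setT (EFin \o h) by apply/measurable_EFinP; exact: bh.1.
  have bGh : bmeas (fun x => trunc_g m x * \int[Q x]_z h z).
    by apply: bmeasM; [exact: bmeas_trunc_g|exact: bmeas_kernel].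
  have := integral_Lam_S mn h0E mhE.
  rewrite integral_Lam_phi// (bmeas_EFin (p1 _) bh).
  rewrite integral_Lam_phi 1?ltnW//; last 2 first.
  - move=> x; apply: mule_ge0; last exact: integral_ge0.
    by rewrite lee_fin ltW// trunc_g_gt0.
  - apply: emeasurable_funM; first by apply/measurable_EFinP; exact: (bmeas_trunc_g m).1.
    by apply: measurable_fun_integral_kernel => // U mU; exact: measurable_kernel.
  under eq_integral do rewrite (bmeas_EFin (prob_kernel _) bh) -EFinM.
  rewrite (bmeas_EFin (p1 _) bGh) -!EFinM => -[].
  rewrite kappaS// -mulrA => /(mulfI (lt0r_neq0 (kappa_gt0 (ltnW mn)))) <-.
  by rewrite mulrC mulKf.
have [B B0 fB] := bmeas_ge0_bound bf.
have bfB : bmeas (fun x => f x + B) by apply: bmeasD => //; exact: bmeas_cst.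
have fB0 x : 0 <= f x + B by have := fB x; rewrite ler_norml; lra.
rewrite (Rint_shift B (p1 _) bf) key//.
have bQf : bmeas (fun x => trunc_g m x * \int[Q x]_z f z).
  by apply: bmeasM; [exact: bmeas_trunc_g|exact: bmeas_kernel].
have bGB : bmeas (fun x => trunc_g m x * B).
  by apply: bmeasM; [exact: bmeas_trunc_g|exact: bmeas_cst].
have -> : \int[phi m]_x (trunc_g m x * \int[Q x]_z (f z + B)) =
    \int[phi m]_x (trunc_g m x * \int[Q x]_z f z + trunc_g m x * B).
  apply: eq_Rintegral => x _; rewrite (RintD (prob_kernel x))//; last exact: bmeas_cst.
  by rewrite (Rint_cst (prob_kernel x)) mulrDr.
rewrite (RintD (p1 _))// (RintZr (p1 _))//; last exact: bmeas_trunc_g.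
by field.
Qed.

Lemma measurable_Lint (s : seq Y) (f : X -> R) :
  measurable_fun setT f -> measurable_fun setT (Lint Q g s f).
Proof.
move=> mf; apply: measurableT_comp => //; under eq_fun do rewrite integralE.
have mE : measurable_fun setT (EFin \o f) by exact/measurable_EFinP.
apply: emeasurable_funB; apply: measurable_integral_L => //.
- exact: measurable_funepos.
- exact: measurable_funeneg.
Qed.

Lemma ae_phi m (P : X -> Prop) : (m <= n)%N ->
  {ae Lam m, forall x, P x} -> {ae phi m, forall x, P x}.
Proof.
move=> mn [A [mA A0 PA]]; exists A; split => //.
have h1 x : (0 <= (\1_A x : R)%:E)%E by rewrite lee_fin.
have mI : measurable_fun setT (fun x => (\1_A x : R)%:E).
  by apply/measurable_EFinP; exact: measurable_indic.
have := integral_Lam_phi mn h1 mI.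
rewrite !integral_indic// !setIT => /eqP.
rewrite [X in X == _](_ : _ = 0%E)// eq_sym mule_eq0 => /orP[|/eqP//].
by rewrite eqe gt_eqF// kappa_gt0.
Qed.

Let dropE k m : (k <= m)%N -> obs m = obs k ++ drop k (obs m).
Proof. by move=> km; rewrite -{1}(cat_take_drop k (obs m)) take_obs. Qed.

Lemma integral_Lam_drop k m (f : X -> \bar R) : (k <= m)%N ->
  (forall x, (0 <= f x)%E) -> measurable_fun setT f ->
  (\int[Lam m]_z f z = \int[Lam k]_x \int[L Q g (drop k (obs m)) x]_z f z)%E.
Proof. by move=> km f0 mf; rewrite {1}(dropE km) integral_upredictor_cat. Qed.

Lemma ae_L_fin k m : (k <= m)%N -> (m <= n)%N ->
  {ae phi k, forall x, (L Q g (drop k (obs m)) x setT < +oo)%E}.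
Proof.
move=> km mn; apply: ae_phi; first exact: leq_trans mn.
have h : (Lam k).-integrable setT (fun x => L Q g (drop k (obs m)) x setT).
  apply/integrableP; split; first exact: measurable_kernel.
  under eq_integral do rewrite gee0_abs//.
  have := integral_Lam_drop km (fun=> lee01 : (0 <= (1 : \bar R))%E) (measurable_cst _).
  rewrite integral_cst// mul1e => h; have /andP[_] := upredictor_mass mn.
  by rewrite h; under eq_integral do rewrite integral_cst// mul1e.
apply: filterS (integrable_ae measurableT h) => x /(_ Logic.I).
by rewrite ge0_fin_numE.
Qed.

Lemma ae_L_trunc k m : (k <= m)%N -> (m < n)%N ->
  {ae phi k, forall x, {ae L Q g (drop k (obs m)) x, forall z, g (z, ob m) = trunc_g m z}}.
Proof.
move=> km mn; apply: ae_phi; first by rewrite (leq_trans km)// ltnW.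
pose B := [set x | M < g (x, ob m)]; have mB : measurable B := measurable_exceed m.
have h1 x : (0 <= (\1_B x : R)%:E)%E by rewrite lee_fin.
have mI : measurable_fun setT (fun x => (\1_B x : R)%:E).
  by apply/measurable_EFinP; exact: measurable_indic.
have := integral_Lam_drop km h1 mI; rewrite integral_indic// setIT good//.
under eq_integral do rewrite integral_indic// setIT.
move=> /esym h.
have mL : measurable_fun setT (fun x => L Q g (drop k (obs m)) x B).
  exact: measurable_kernel.
have [h2 _] := ae_eq_integral_abs (Lam k) measurableT mL.
have {}h : (\int[Lam k]_x `|L Q g (drop k (obs m)) x B| = 0)%E.
  by rewrite -h; apply: eq_integral => x _; rewrite gee0_abs.
apply: filterS (h2 h) => x /(_ Logic.I) LB0.
exists B; split => // z /=.
by apply: contra_notP => /trunc_gE.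
Qed.

Lemma Lint_rcons k m (f : X -> R) : (k <= m)%N -> (m < n)%N -> bmeas f ->
  {ae phi k, forall x, Lint Q g (rcons (drop k (obs m)) (ob m)) f x =
    Lint Q g (drop k (obs m)) (fun z => trunc_g m z * \int[Q z]_u f u) x}.
Proof.
move=> km mn bf; apply: filterS2 (ae_L_fin km (ltnW mn)) (ae_L_trunc km mn) => x.
set s := drop k (obs m) => Lfin gE; rewrite /Lint.
have bG := bmeas_trunc_g m.
have fin_int := @bmeas_fin_integrable _ X R.
have bGQ h : bmeas h -> bmeas (fun z => trunc_g m z * \int[Q z]_u h u).
  by move=> bh; apply: bmeasM => //; exact: bmeas_kernel.
have keyE (h : X -> R) : (forall z, 0 <= h z) -> bmeas h ->
    (\int[L Q g (rcons s (ob m)) x]_z (h z)%:E =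
     \int[L Q g s x]_z (trunc_g m z * \int[Q z]_u h u)%:E)%E.
  move=> h0 bh.
  have h0E z : (0 <= (h z)%:E)%E by rewrite lee_fin.
  have mhE : measurable_fun setT (EFin \o h) by apply/measurable_EFinP; exact: bh.1.
  have mQ : measurable_fun setT (fun z => \int[Q z]_u (h u)%:E)%E.
    by apply: measurable_fun_integral_kernel => // U mU; exact: measurable_kernel.
  rewrite -cats1 integral_L_cat//; apply: ae_eq_integral => //.
  - by apply: measurable_integral_L.
  - by apply/measurable_EFinP; exact: (bGQ _ bh).1.
  - apply: filterS gE => z gz _; rewrite integral_L_cons// gz.
    rewrite ger0_norm ?ltW ?trunc_g_gt0// EFinM; congr (_ * _)%E.
    rewrite -(bmeas_EFin (prob_kernel z) bh).
    by apply: eq_integral => u _; rewrite integral_L_nil.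
have b1 : bmeas (cst 1 : X -> R) by exact: bmeas_cst.
have Lfin' : (L Q g (rcons s (ob m)) x setT < +oo)%E.
  have -> : L Q g (rcons s (ob m)) x setT =
      (\int[L Q g (rcons s (ob m)) x]_z (cst (1 : R) z)%:E)%E.
    by rewrite -[LHS]mul1e -integral_cst.
  rewrite keyE//.
  have /integrableP[_] := fin_int _ _ Lfin (bGQ _ b1).
  apply: le_lt_trans; apply: ge0_le_integral => //.
  - move=> z _; rewrite lee_fin mulr_ge0 ?ltW ?trunc_g_gt0//.
    by rewrite (Rint_cst (prob_kernel z)).
  - by apply/measurable_EFinP; exact: (bGQ _ b1).1.
  - by apply: measurableT_comp => //; apply/measurable_EFinP; exact: (bGQ _ b1).1.
  - by move=> z _; rewrite lee_fin ler_norm.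
have [B B0 fB] := bmeas_ge0_bound bf.
have bB : bmeas (cst B : X -> R) by exact: bmeas_cst.
have bfB : bmeas (fun z => f z + B) by exact: bmeasD.
have fB0 z : 0 <= f z + B by have := fB z; rewrite ler_norml; lra.
have -> : \int[L Q g (rcons s (ob m)) x]_z f z =
    \int[L Q g (rcons s (ob m)) x]_z (f z + B) - \int[L Q g (rcons s (ob m)) x]_z B.
  rewrite -RintegralB//; [|exact: fin_int|exact: fin_int].
  by apply: eq_Rintegral => z _; rewrite addrK.
rewrite /Rintegral keyE// (keyE (cst B) (fun=> ltW B0) bB).
rewrite -!/(Rintegral _ _ _) -RintegralB//; last 2 first.
- by apply: fin_int => //; exact: bGQ.
- by apply: fin_int => //; exact: bGQ.
apply: eq_Rintegral => z _.
rewrite -mulrBr (RintD (prob_kernel z))//.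
by rewrite addrK.
Qed.

(** The denominators in the definition of the asymptotic variance are ratios of
    likelihoods, hence telescope from one time to the next. *)
Lemma mean_Lint_one k m : (k <= m)%N -> (m <= n)%N ->
  \int[phi k]_x Lint Q g (drop k (obs m)) (cst 1) x = kappa m / kappa k.
Proof.
move=> km mn; have kn := leq_trans km mn.
have k0 := kappa_gt0 kn.
have mL : measurable_fun setT (fun x => L Q g (drop k (obs m)) x setT).
  exact: measurable_kernel.
have LE x : (\int[L Q g (drop k (obs m)) x]_z (cst (1 : R) z)%:E)%E =
    L Q g (drop k (obs m)) x setT.
  by rewrite -[RHS]mul1e -integral_cst.
have -> : \int[phi k]_x Lint Q g (drop k (obs m)) (cst 1) x =
    fine (\int[phi k]_x L Q g (drop k (obs m)) x setT)%E.
  rewrite /Rintegral; congr fine; apply: ae_eq_integral => //.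
  - by apply/measurable_EFinP; apply: measurable_Lint; exact: measurable_cst.
  - apply: filterS (ae_L_fin km mn) => x Lfin _.
    by rewrite /Lint /Rintegral LE fineK// ge0_fin_numE.
have h := integral_Lam_phi kn (fun x => measure_ge0 _ setT) mL.
have : (\int[Lam k]_x L Q g (drop k (obs m)) x setT = (kappa m)%:E)%E.
  rewrite -kappaE//; transitivity (\int[Lam m]_x (cst (1 : R) x)%:E)%E.
    rewrite (integral_Lam_drop km)//.
    - by apply: eq_integral => x _; rewrite LE.
    - by apply/measurable_EFinP.
  by rewrite -[RHS]mul1e -integral_cst.
rewrite h; case: (integral _ _ _) => [r| |] //.
- by rewrite -EFinM => -[<-]; rewrite mulrC mulKf// gt_eqF.
- by rewrite gt0_muley ?lte_fin.
- by rewrite gt0_muleNy ?lte_fin.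
Qed.

Lemma Lint_nil (f : X -> R) x : measurable_fun setT f -> Lint Q g [::] f x = f x.
Proof.
by move=> mf; rewrite /Lint /Rintegral integral_L_nil//; exact/measurable_EFinP.
Qed.

Lemma Rint_predictor_nil (f : X -> R) :
  \int[predictor Q g chi [::]]_x f x = \int[chi]_x f x.
Proof.
rewrite /Rintegral (eq_measure_integral chi)// => A mA _.
rewrite /predictor /= /mnormalize -/(upredictor Q g chi [::]).
have -> : upredictor Q g chi [::] setT = 1%E.
  by rewrite upredictor_nil// probability_setT.
by rewrite onee_eq0/= invr1 mule1 (upredictor_nil Q g chi mA).
Qed.

Lemma asymptotic_variance_nil (f : X -> R) : bmeas f ->
  asymptotic_variance Q g chi [::] f =
  \int[chi]_x f x ^+ 2 - (\int[chi]_x f x) ^+ 2.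
Proof.
move=> bf; rewrite /asymptotic_variance /= big_nat1/= !Rint_predictor_nil.
rewrite -(Rint_var (probability_setT chi) bf).
apply: eq_Rintegral => x _; rewrite !Lint_nil//; last exact: bf.1.
have -> : \int[chi]_z Lint Q g [::] (cst 1) z = 1.
  by under eq_Rintegral do rewrite Lint_nil//; rewrite (Rint_cst (probability_setT chi)).
by rewrite divr1 mulr1.
Qed.

(** Appending an observation applies the last kernel to f and to the constants, so
    that each term of the sum for f becomes the term for [step_fun], divided by the
    square of the increment of the likelihood; the new last term is the variance of f
    under the new predictor. *)
Lemma asymptotic_varianceS m (f : X -> R) : (m < n)%N -> bmeas f ->
  asymptotic_variance Q g chi (obs m.+1) f =
  step_variance (phi m) (phi m.+1) (trunc_g m) Q
    (asymptotic_variance Q g chi (obs m)) f.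
Proof.
move=> mn bf; set c := \int[phi m.+1]_z f z.
set gamma := \int[phi m]_x trunc_g m x.
have gamma0 : 0 < gamma by exact: trunc_mean_gt0.
pose gbar := step_fun (trunc_g m) Q f c.
have bgbar : bmeas gbar by apply: bmeas_step_fun => //; exact: bmeas_trunc_g.
have gbar0 : \int[phi m]_z gbar z = 0.
  apply: (Rint_step_fun (probability_setT _) (bmeas_trunc_g m)) => //.
    exact: trunc_g_gt0.
  by move=> h bh; exact: predictorS.
have b1 : bmeas (cst 1 : X -> R) by exact: bmeas_cst.
rewrite /step_variance -/gamma -/c -/gbar addrC.
rewrite /asymptotic_variance !size_obs big_nat_recr// take_oversize ?size_obs//.
rewrite drop_oversize ?size_obs//; congr (_ + _); last first.
  rewrite -/c -(Rint_var (probability_setT (phi m.+1)) bf).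
  apply: eq_Rintegral => x _; rewrite !Lint_nil//; last exact: bf.1.
  have -> : \int[phi m.+1]_z Lint Q g [::] (cst 1) z = 1.
    under eq_Rintegral do rewrite Lint_nil//.
    by rewrite (Rint_cst (probability_setT (phi m.+1))).
  by rewrite divr1 mulr1.
rewrite mulr_suml !big_mkord; apply: eq_bigr => k _.
have km : (k <= m)%N by rewrite -ltnS.
rewrite gbar0 -/c !take_obs//; last by rewrite leqW.
have dropS : drop k (obs m.+1) = rcons (drop k (obs m)) (ob m).
  by rewrite obsS drop_rcons// size_obs.
rewrite dropS mean_Lint_one//; last exact: ltnW.
have -> : \int[phi k]_z Lint Q g (rcons (drop k (obs m)) (ob m)) (cst 1) z =
    gamma * (kappa m / kappa k).
  by rewrite -dropS mean_Lint_one ?leqW// kappaS// -/gamma; ring.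
set dk := kappa m / kappa k.
have dk0 : dk != 0.
  have mn' := ltnW mn; have kn' := leq_trans km mn'.
  by rewrite gt_eqF// divr_gt0// kappa_gt0.
rewrite [RHS]mulrC -[RHS]ge0_RintZ; last 3 first.
- by rewrite invr_gt0 exprn_gt0.
- apply: measurable_funX; apply: measurable_funM => //.
  apply: measurable_funB; first by apply: measurable_Lint; exact: bgbar.1.
  by apply: measurable_funM => //; exact: measurable_Lint.
- by move=> x; rewrite sqr_ge0.
have mG (h : X -> R) : bmeas h -> bmeas (fun z => trunc_g m z * \int[Q z]_u h u).
  by move=> bh; apply: bmeasM; [exact: bmeas_trunc_g|exact: bmeas_kernel].
rewrite /Rintegral; congr fine; apply: ae_eq_integral => //.
- apply/measurable_EFinP; apply: measurable_funX; apply: measurable_funM => //.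
  apply: measurable_funB; first by apply: measurable_Lint; exact: bf.1.
  by apply: measurable_funM => //; exact: measurable_Lint.
- apply/measurable_EFinP; apply: measurable_funM => //.
  apply: measurable_funX; apply: measurable_funM => //.
  apply: measurable_funB; first by apply: measurable_Lint; exact: bgbar.1.
  by apply: measurable_funM => //; exact: measurable_Lint.
have h1 := Lint_rcons km mn bf; have h2 := Lint_rcons km mn b1.
have h3 := ae_L_fin km (ltnW mn).
apply: filterS3 h1 h2 h3 => x e1 e2 Lfin _.
rewrite e1 e2; congr EFin.
have -> : Lint Q g (drop k (obs m)) (fun z => trunc_g m z * \int[Q z]_u f u) x -
    c * Lint Q g (drop k (obs m)) (fun z => trunc_g m z * \int[Q z]_u cst 1 u) x =
    Lint Q g (drop k (obs m)) gbar x.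
  rewrite /Lint -RintegralZl//; last by apply: bmeas_fin_integrable => //; exact: mG.
  rewrite -RintegralB//; last 2 first.
  - by apply: bmeas_fin_integrable => //; exact: mG.
  - apply: (bmeas_fin_integrable Lfin).
    by apply: bmeasM; [exact: bmeas_cst|exact: mG].
  apply: eq_Rintegral => z _; rewrite /gbar /step_fun (Rint_cst (prob_kernel z)); ring.
by rewrite mul0r subr0 invfM mulrCA exprMn exprVn.
Qed.

End predictor_recursion.

(** * The particle law for fixed observations *)

Section particle_law.
Context dX dY dT (X : measurableType dX) (Y : measurableType dY)
  (T : measurableType dT) (R : realType).
Variables (Q : R.-pker X ~> X) (g : {mfun (X * Y)%type >-> R}).
Hypothesis g_gt0 : forall x y, 0 < g (x, y).
Variables (chi : probability X R) (ob : nat -> T -> Y).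
Hypothesis mob : forall m, measurable_fun setT (ob m).

Definition potential m (z : T * X) : R := g (z.2, ob m z.1).

Lemma measurable_potential m : measurable_fun setT (potential m).
Proof.
apply: (measurableT_comp (measurable_funPT g)); apply: measurable_fun_pair => //.
exact: measurableT_comp (mob m) measurable_fst.
Qed.

Lemma potential_gt0 m z : 0 < potential m z. Proof. exact: g_gt0. Qed.

Section particle_number.
Variable N : nat.

Definition select m : R.-pker (T * N.+1.-tuple X) ~> X :=
  selection (potential_gt0 m) Q (measurable_potential m).

(** The observations are a parameter of the kernel: they may be frozen, or be
    integrated later. *)
Fixpoint law m : R.-pker T ~> N.+1.-tuple X :=
  if m is m'.+1 then pkcomp (law m') (kpow (select m') N.+1)
  else kpow (kcst chi) N.+1.

End particle_number.

Lemma Rint_kpow_tnth d0 d (T0 : measurableType d0) (X0 : measurableType d)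
    (k : R.-pker T0 ~> X0) z n (i : 'I_n) (f : X0 -> R) : bmeas f ->
  \int[kpow k n z]_v f (tnth v i) = \int[k z]_x f x.
Proof.
move=> bf; pose u (j : 'I_n) : X0 -> R := if j == i then f else cst 1.
have bu j : bmeas (u j) by rewrite /u; case: ifP => _ //; exact: bmeas_cst.
have := Rint_kpow_prod k z bu; rewrite (bigD1 i)//= /u eqxx big1 ?mulr1; last first.
  by move=> j /negbTE ->; rewrite (Rint_cst (prob_kernel z)).
move=> <-; apply: eq_Rintegral => v _; rewrite (bigD1 i)//= eqxx big1 ?mulr1//.
by move=> j /negbTE ->.
Qed.

Lemma Rint_kpow_sum d0 d (T0 : measurableType d0) (X0 : measurableType d)
    (k : R.-pker T0 ~> X0) z n (f : X0 -> R) : bmeas f ->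
  \int[kpow k n z]_v (\sum_(i < n) f (tnth v i)) = n%:R * \int[k z]_x f x.
Proof.
move=> bf; rewrite (Rint_sum (prob_kernel z)); last by move=> i; exact: bmeas_tnth.
under eq_bigr do rewrite Rint_kpow_tnth//.
by rewrite sumr_const card_ord mulr_natl.
Qed.

Lemma gaussian_cf_ext (nu : forall N, {measure set (N.+1.-tuple X) -> \bar R})
    (phi : {measure set X -> \bar R}) (V V' : (X -> R) -> R) :
  (forall f, bmeas f -> V f = V' f) -> gaussian_cf nu phi V -> gaussian_cf nu phi V'.
Proof. by move=> VV' h f bf t a; rewrite -VV'//; exact: h. Qed.

Section fixed_observations.
Variables (t : T) (n : nat) (M : R).
Hypothesis M0 : 0 < M.

Let obt k := ob k t.
Local Notation obst m := (obs obt m).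
Local Notation phi m := (predictor Q g chi (obst m)).
Local Notation G m := (trunc_g g obt M m).

Hypothesis good : forall m, (m < n)%N ->
  upredictor Q g chi (obst m) [set x | M < g (x, obt m)] = 0%E.

Let bG m : bmeas (G m). Proof. exact: bmeas_trunc_g. Qed.
Let G0 m x : 0 < G m x. Proof. exact: trunc_g_gt0. Qed.

(** Functions vanishing almost everywhere for the predictor vanish at all the
    particles: this carries essential bounds over to the particles. *)
Let null_law m := forall f, bmeas f -> (forall x, 0 <= f x) ->
  \int[phi m]_x f x = 0 ->
  forall N, \int[law N m t]_x (\sum_(i < N.+1) f (tnth x i)) = 0.

Let select_ae m : (m < n)%N -> null_law m -> forall N,
  {ae law N m t, forall x, forall f, bmeas f ->
    \int[select N m (t, x)]_z f z =
    emean (fun x => G m x * \int[Q x]_z f z) x / emean (G m) x}.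
Proof.
move=> mn null N; pose B := [set x | g (x, obt m) != G m x].
have mB : measurable B.
  have -> : B = [set x | M < g (x, obt m)].
    apply/seteqP; split => x; rewrite /B/= /trunc_g.
      by apply: contraNT; rewrite -leNgt => /min_idPl ->.
    by move=> gM; rewrite (min_idPr (ltW gM)) gt_eqF.
  exact: measurable_exceed.
have bB := bmeas_indic R mB.
have B0 : \int[phi m]_x \1_B x = 0.
  rewrite (ae_eq_Rint bB (bmeas_cst _ 0)).
    by rewrite (Rint_cst (probability_setT (phi m))).
  apply: (ae_phi g_gt0 M0 good (ltnW mn)).
  apply: filterS (ae_trunc_g good mn) => x gx.
  by rewrite indicE memNset// /B/=; apply/negP; rewrite negbK; apply/eqP.
have bsum : bmeas (fun x : N.+1.-tuple X => \sum_(i < N.+1) (\1_B (tnth x i) : R)).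
  by apply: bmeas_sum => i; exact: (bmeas_tnth i bB).
have sum0 (x : N.+1.-tuple X) : 0 <= \sum_(i < N.+1) (\1_B (tnth x i) : R).
  by apply: sumr_ge0.
have := null _ bB (fun x => ltac:(by [])) B0 N.
move=> /(Rint_eq0_ae (prob_kernel t) bsum sum0).
apply: filterS => x /eqP; rewrite psumr_eq0// => /allP x0 f bf.
have gE i : g (tnth x i, obt m) = G m (tnth x i).
  have := x0 i (mem_index_enum i); rewrite /= indicE.
  have [|] := boolP (tnth x i \in B); first by rewrite oner_eq0.
  by rewrite notin_setE /B/= => /negP; rewrite negbK => /eqP.
rewrite Rint_selection// /weight /=.
have den : \sum_(j < N.+1) potential m (t, tnth x j) = \sum_(j < N.+1) G m (tnth x j).
  by apply: eq_bigr => j _; exact: gE.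
rewrite den /emean invfM invrK mulrACA mulVf ?mul1r//.
rewrite mulr_suml; apply: eq_bigr => l _.
by rewrite -gE /potential/= mulrAC.
Qed.

(** The three properties propagate together: [null_law] lets g be replaced by its
    truncation in the selection step, where the bounded-moment and Gaussian
    estimates of the previous section apply. *)
Lemma law_limit m : (m <= n)%N ->
  [/\ null_law m,
      bounded_moments (fun N => law N m t) (phi m) &
      gaussian_cf (fun N => law N m t) (phi m) (asymptotic_variance Q g chi (obst m))].
Proof.
elim: m => [|m ih] mn.
  split.
  - move=> f bf f0; rewrite Rint_predictor_nil => chif0 N.
    by rewrite Rint_kpow_sum// chif0 mulr0.
  - move=> f bf m; have [B B0 fB] := bmeas_ge0_bound bf.
    exists (moment_bound B m) => N; rewrite Rint_predictor_nil.
    exact: (dev_moment (kcst chi) t bf fB B0).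
  - move=> f bf s a; have [B B0 fB] := bmeas_ge0_bound bf.
    exists (cf_bound B s) => N.
    rewrite (asymptotic_variance_nil _ _ _ bf) Rint_predictor_nil.
    exact: (dev_cf (kcst chi) t bf fB).
have [null mom cf] := ih (ltnW mn).
have p1 k : phi k setT = 1%E by exact: probability_setT.
have nu1 N : law N m t setT = 1%E by exact: prob_kernel.
have nu'E N (F : N.+1.-tuple X -> R) : bmeas F ->
    \int[law N m.+1 t]_v F v = \int[law N m t]_x \int[kpow (select N m) N.+1 (t, x)]_v F v.
  by move=> bF; rewrite /= Rint_pkcomp.
have selE := select_ae mn null.
have phiS f (bf : bmeas f) := predictorS g_gt0 M0 good mn bf.
split.
- move=> f bf f0 pf0 N; rewrite nu'E; last by apply: bmeas_sum => i; exact: bmeas_tnth.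
  have bh : bmeas (fun x => G m x * \int[Q x]_z f z).
    by apply: bmeasM => //; exact: bmeas_kernel.
  have h0 x : 0 <= G m x * \int[Q x]_z f z.
    by apply: mulr_ge0; [exact: ltW (G0 _ _)|exact: Rint_ge0].
  have Gm0 : 0 < \int[phi m]_x G m x by exact: (Rint_gt0 (p1 m) (bG m) (G0 m)).
  have ph0 : \int[phi m]_x (G m x * \int[Q x]_z f z) = 0.
    have := phiS f bf; rewrite pf0 => /esym/eqP.
    by rewrite mulf_eq0 invr_eq0 (gt_eqF Gm0) orbF => /eqP.
  have bs : bmeas (fun x : N.+1.-tuple X =>
      \sum_(i < N.+1) (G m (tnth x i) * \int[Q (tnth x i)]_z f z)).
    by apply: bmeas_sum => i; exact: (bmeas_tnth i bh).
  have s0 (x : N.+1.-tuple X) :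
      0 <= \sum_(i < N.+1) (G m (tnth x i) * \int[Q (tnth x i)]_z f z).
    by apply: sumr_ge0 => i _; exact: h0.
  have h := Rint_eq0_ae (nu1 N) bs s0 (null _ bh h0 ph0 N).
  rewrite (@ae_eq_Rint _ _ _ _ _ (cst 0)); first by rewrite (Rint_cst (nu1 N)).
  + have bF : bmeas (fun v : N.+1.-tuple X => \sum_(i < N.+1) f (tnth v i)).
      by apply: bmeas_sum => i; exact: bmeas_tnth.
    exact: (bmeas_kernel (kpre (kpow (select N m) N.+1) (pair1_measurable t)) bF).
  + exact: bmeas_cst.
  apply: filterS2 h (selE N) => x hx sx.
  by rewrite Rint_kpow_sum// sx// /emean hx mulr0 mul0r mulr0.
- exact: (step_bounded_moments nu1 nu'E (p1 m) (p1 m.+1) (bG m) (G0 m) selE phiS mom).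
- have := step_gaussian_cf nu1 nu'E (p1 m) (p1 m.+1) (bG m) (G0 m) selE phiS mom cf.
  apply: gaussian_cf_ext => f bf.
  by rewrite (asymptotic_varianceS g_gt0 M0 good).
Qed.

End fixed_observations.
End particle_law.

(** * Limits of moments for fixed observations *)

Section moment_limit.
Context dX dY dT (X : measurableType dX) (Y : measurableType dY)
  (T : measurableType dT) (R : realType).
Variables (Q : R.-pker X ~> X) (g : {mfun (X * Y)%type >-> R}).
Hypothesis g_gt0 : forall x y, 0 < g (x, y).
Variables (chi : probability X R) (ob : nat -> T -> Y).
Hypothesis mob : forall m, measurable_fun setT (ob m).

Lemma asymptotic_variance_ge0 (s : seq Y) (f : X -> R) :
  0 <= asymptotic_variance Q g chi s f.
Proof.
by apply: sumr_ge0 => k _; apply: Rint_ge0 => x; exact: sqr_ge0.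
Qed.

Lemma law_moment_limit (t : T) (n : nat) (M : R) (f : X -> R) (p : R) :
  0 < M ->
  (forall m, (m < n)%N ->
    upredictor Q g chi (obs (ob^~ t) m) [set x | M < g (x, ob m t)] = 0%E) ->
  bmeas f -> 0 < p ->
  (fun N => \int[law Q g_gt0 chi mob N n t]_v
     `|dev (\int[predictor Q g chi (obs (ob^~ t) n)]_x f x) f v| `^ p) @ \oo -->
  (2 * asymptotic_variance Q g chi (obs (ob^~ t) n) f) `^ (p / 2) *
    (Gamma ((p + 1) / 2) / Num.sqrt pi).
Proof.
move=> M0 good bf p0.
have [_ mom cf] := law_limit g_gt0 mob M0 good (leqnn n).
apply: cvg_moment => //.
- by rewrite mulr_ge0// asymptotic_variance_ge0.
- by move=> N; exact: prob_kernel.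
- by move=> N; exact: bmeas_dev.
- move=> s; have [C hC] := cf _ bf s 0.
  rewrite (_ : s ^+ 2 * _ / 4 =
    s ^+ 2 * asymptotic_variance Q g chi (obs (ob^~ t) n) f / 2); last by field.
  set l := expR _; apply/cvgrPdist_le => e e0.
  have C1 : 0 < `|C| + 1 by rewrite ltr_wpDl.
  near=> N; rewrite distrC.
  have := hC N; rewrite cos0 mulr1.
  under eq_Rintegral do rewrite add0r.
  move=> /le_trans; apply.
  rewrite ler_pdivrMr ?sqrtn_gt0// (le_trans (ler_norm C))//.
  have h : (`|C| / e) ^+ 2 <= N.+1%:R.
    rewrite (@le_trans _ _ N%:R) ?ler_nat//.
    by near: N; exact: nbhs_infty_ger.
  have : Num.sqrt ((`|C| / e) ^+ 2) <= Num.sqrt N.+1%:R by rewrite ler_sqrt.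
  rewrite sqrtr_sqr ger0_norm; last by rewrite divr_ge0// ltW.
  by rewrite ler_pdivrMr// mulrC.
- by move=> k; have [C hC] := mom _ bf k; exists C.
Unshelve. all: by end_near. Qed.

End moment_limit.

(** * Measurable dependence on the observations *)

Section measurable_dependence.
Local Open Scope ereal_scope.
Context dX dY dT (X : measurableType dX) (Y : measurableType dY)
  (T : measurableType dT) (R : realType).
Variables (Q : R.-pker X ~> X) (g : {mfun (X * Y)%type >-> R}).
Variables (chi : probability X R) (ob : nat -> T -> Y).
Hypothesis mob : forall m, measurable_fun setT (ob m).

Lemma measurable_integral_pker d0 d1 (T0 : measurableType d0) (T1 : measurableType d1)
    (k : R.-pker T0 ~> T1) (f : T0 * T1 -> \bar R) :
  (forall z, 0 <= f z) -> measurable_fun setT f ->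
  measurable_fun setT (fun x => \int[k x]_y f (x, y)).
Proof. by move=> f0 mf; exact: measurable_fun_integral_sfinite_kernel. Qed.

(** The recursion on the sequence of observations runs backwards, so that only the
    probability kernel Q is ever integrated: joint measurability could fail for
    integrals against kernels that are not s-finite. *)
Lemma measurable_L_joint (s : seq nat) (f : T * X -> \bar R) :
  (forall z, 0 <= f z) -> measurable_fun setT f ->
  measurable_fun setT (fun z : T * X =>
    \int[L Q g [seq ob k z.1 | k <- s] z.2]_u f (z.1, u)).
Proof.
move=> f0 mf.
have mf1 t : measurable_fun setT (fun u => f (t, u)).
  exact: (measurableT_comp mf (pair1_measurable t)).
elim: s => [|k s ih].
  by under eq_fun do (rewrite integral_L_nil//=); rewrite (_ : (fun z => _) = f)//;
    apply/funext => -[].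
under eq_fun do rewrite integral_L_cons//.
apply: emeasurable_funM.
  apply/measurable_EFinP; apply: measurableT_comp => //.
  apply: (measurableT_comp (measurable_funPT g)); apply: measurable_fun_pair => //.
  exact: measurableT_comp (mob k) measurable_fst.
pose F (z : T * X) := \int[L Q g [seq ob k z.1 | k <- s] z.2]_u f (z.1, u).
have mswap : measurable_fun setT (fun w : (T * X) * X => (w.1.1, w.2)).
  by apply: measurable_fun_pair => //; exact: measurableT_comp measurable_fst measurable_fst.
apply: (@measurable_integral_pker _ _ _ _ (kpre Q (@measurable_snd _ _ T X))
  (fun w => F (w.1.1, w.2))); first by move=> w; exact: integral_ge0.
exact: (measurableT_comp ih mswap).
Qed.

Lemma measurable_upredictor_joint m (f : T * X -> \bar R) :
  (forall z, 0 <= f z) -> measurable_fun setT f ->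
  measurable_fun setT (fun t => \int[upredictor Q g chi (obs (ob^~ t) m)]_x f (t, x)).
Proof.
move=> f0 mf.
have mf1 t : measurable_fun setT (fun u => f (t, u)).
  exact: (measurableT_comp mf (pair1_measurable t)).
under eq_fun do rewrite integral_upredictor//.
apply: (@measurable_integral_pker _ _ _ _ (kcst chi)
  (fun z => \int[L Q g (obs (ob^~ z.1) m) z.2]_u f (z.1, u))) => //.
  by move=> z; exact: integral_ge0.
exact: measurable_L_joint.
Qed.

Lemma measurable_upredictor_set m (D : set (T * X)) : measurable D ->
  measurable_fun setT
    (fun t => upredictor Q g chi (obs (ob^~ t) m) [set x | D (t, x)]).
Proof.
move=> mD; have mI : measurable_fun setT (fun z => (\1_D z : R)%:E).
  by apply/measurable_EFinP; exact: measurable_indic.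
have I0 z : 0 <= (\1_D z : R)%:E by rewrite lee_fin.
have := measurable_upredictor_joint m I0 mI.
apply: eq_measurable_fun => t _.
have mDt : measurable [set x | D (t, x)].
  by have := measurable_xsection t mD; rewrite xsectionE.
by rewrite -[in RHS](setIT [set x | D (t, x)]) -integral_indic//.
Qed.

Section predictor_kernel.
Variable m : nat.

Definition kupredictor (t : T) : {measure set X -> \bar R} :=
  upredictor Q g chi (obs (ob^~ t) m).

Let measurable_kupredictor U : measurable U -> measurable_fun setT (kupredictor ^~ U).
Proof.
move=> mU; apply: (measurable_upredictor_set m (D := snd @^-1` U)).
by rewrite -[X in measurable X]setTI; exact: measurable_snd.
Qed.

HB.instance Definition _ := isKernel.Build _ _ _ _ _ kupredictor measurable_kupredictor.

Lemma bmeas_predictor (f : X -> R) : bmeas f ->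
  bmeas (fun t => \int[predictor Q g chi (obs (ob^~ t) m)]_x f x)%R.
Proof. exact: (bmeas_kernel (knormalize kupredictor chi)). Qed.

End predictor_kernel.

(** This replaces the finiteness of the supremum of g(., y), which need not be a
    measurable condition on y. *)
Lemma measurable_essentially_bounded m : measurable [set t | exists M : nat,
  upredictor Q g chi (obs (ob^~ t) m) [set x | (M%:R < g (x, ob m t))%R] = 0].
Proof.
rewrite (_ : [set t | _] = \bigcup_(M : nat) [set t |
    upredictor Q g chi (obs (ob^~ t) m) [set x | (M%:R < g (x, ob m t))%R] = 0]); last first.
  by apply/seteqP; split => [t [M tM]|t [M _ tM]]; exists M.
apply: bigcup_measurable => M _.
pose D := [set z : T * X | (M%:R < g (z.2, ob m z.1))%R].
have mD : measurable D.
  have mg : measurable_fun setT (fun z : T * X => g (z.2, ob m z.1)).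
    apply: (measurableT_comp (measurable_funPT g)); apply: measurable_fun_pair => //.
    exact: measurableT_comp (mob m) measurable_fst.
  have := mg measurableT _ (measurable_itv `]M%:R, +oo[%R).
  rewrite setTI (_ : _ @^-1` _ = D)//.
  by apply/seteqP; split=> z/=; rewrite in_itv/= andbT.
have := measurable_upredictor_set m mD measurableT (emeasurable_set1 0).
by rewrite setTI.
Qed.

End measurable_dependence.

(** * Disintegration of a joint law *)

Section rectangles.
Context d0 d (T : measurableType d0) (X : measurableType d) (n : nat).

Definition rectangle (A : set T) (B : 'I_n -> set X) : set (T * n.-tuple X) :=
  [set z | A z.1 /\ forall i, B i (tnth z.2 i)].

Definition rectangles : set (set (T * n.-tuple X)) :=
  [set D | exists A B, [/\ measurable A, forall i, measurable (B i) & D = rectangle A B]].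

Lemma measurable_rectangle A B : measurable A -> (forall i, measurable (B i)) ->
  measurable (rectangle A B).
Proof.
move=> mA mB; rewrite (_ : rectangle A B =
    (fst @^-1` A) `&` \big[setI/setT]_(i < n) ((fun z => tnth z.2 i) @^-1` B i)).
  apply: measurableI; first by rewrite -[X in measurable X]setTI; exact: measurable_fst.
  apply: bigsetI_measurable => i _; rewrite -[X in measurable X]setTI.
  by apply: (measurableT_comp (measurable_tnth i) measurable_snd).
rewrite -bigcap_seq; apply/seteqP; split => z [Az Bz]; split => //.
- by move=> i _; exact: Bz.
- by move=> i; apply: Bz; rewrite /= mem_index_enum.
Qed.

Lemma rectangles_generate : measurable = <<s rectangles >>.
Proof.
apply/seteqP; split; last first.
  apply: smallest_sub; first exact: sigma_algebra_measurable.
  by move=> D [A [B [mA mB ->]]]; exact: measurable_rectangle.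
pose S := g_sigma_algebraType rectangles.
have mid : measurable_fun [set: S] (id : S -> (T * n.-tuple X)%type).
  have sub D : rectangles D -> @measurable _ S D by exact: sub_sigma_algebra.
  rewrite (_ : id = (fun z : S => (z.1, z.2))); last by apply/funext => -[].
  apply: measurable_fun_pair.
    move=> _ A mA; rewrite setTI; apply: sub; exists A, (fun=> setT); split => //.
    by apply/seteqP; split => z // -[].
  apply/measurable_fun_tnthP => i _ A mA; rewrite setTI; apply: sub.
  exists setT, (fun j => if j == i then A else setT); split => //.
    by move=> j; case: ifP.
  apply/seteqP; split => [z Az|z [_ /(_ i)]]; last by rewrite eqxx.
  by split => // j; case: ifPn => // /eqP ->.
by move=> D mD; have := mid measurableT D mD; rewrite setTI.
Qed.

Lemma rectangle_measure_unique (R : realType) (m1 m2 : {measure set (T * n.-tuple X) -> \bar R}) :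
  (m1 setT < +oo)%E ->
  (forall A B, measurable A -> (forall i, measurable (B i)) ->
    m1 (rectangle A B) = m2 (rectangle A B)) ->
  forall D, measurable D -> m1 D = m2 D.
Proof.
move=> m1oo m12; apply: (measure_unique rectangles (fun=> setT)) => //.
- exact: rectangles_generate.
- move=> _ _ [A [B [mA mB ->]]] [A' [B' [mA' mB' ->]]].
  exists (A `&` A'), (fun i => B i `&` B' i); split.
  + exact: measurableI.
  + by move=> i; exact: measurableI.
  + apply/seteqP; split => z.
      by move=> [[Az Bz] [A'z B'z]]; split => // i; split.
    by move=> [[Az A'z] BB]; split; split => // i; have [] := BB i.
- move=> _; exists setT, (fun=> setT); split => //.
  by apply/seteqP; split => z //.
- by apply/seteqP; split => z // _; exists 0.
- by move=> _ [A [B [mA mB ->]]]; exact: m12.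
Qed.

End rectangles.

Section disintegration.
Context {R : realType} d d0 d1 (W : measurableType d) (T : measurableType d0)
  (X : measurableType d1) (P : probability W R).

Lemma bmeas_comp d2 d3 (T2 : measurableType d2) (T3 : measurableType d3)
    (a : T2 -> T3) (f : T3 -> R) :
  measurable_fun setT a -> bmeas f -> bmeas (f \o a).
Proof. by move=> ma [mf [M fM]]; split; [exact: measurableT_comp|exists M => x; exact: fM]. Qed.

Lemma Rint_indic d2 (T2 : measurableType d2) (m : {measure set T2 -> \bar R}) A :
  measurable A -> \int[m]_x \1_A x = fine (m A).
Proof. by move=> mA; rewrite /Rintegral integral_indic// setIT. Qed.

Lemma prod_indic n (B : 'I_n -> set X) (v : n.-tuple X) :
  \prod_(i < n) (\1_(B i) (tnth v i) : R) = \1_[set v : n.-tuple X | forall i, B i (tnth v i)] v.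
Proof.
rewrite [RHS]indicE; have [/set_mem Bv|/negP vB] := boolP (v \in _).
  by apply: big1 => i _; rewrite indicE mem_set//; exact: Bv.
have [i Bi] : exists i, ~ B i (tnth v i).
  by apply/existsNP => Bv; apply: vB; rewrite inE.
by rewrite (bigD1 i)//= indicE memNset// mul0r.
Qed.

Variables (n : nat) (a : W -> T) (x : W -> n.-tuple X) (k : R.-pker T ~> n.-tuple X).
Hypotheses (ma : measurable_fun setT a) (mx : measurable_fun setT x).

(** Both sides integrate u against a probability on T * X^n; the two probabilities
    agree on rectangles, which generate the product sigma-algebra and are stable under
    intersection. *)
Lemma disintegration :
  (forall A (B : 'I_n -> set X), measurable A -> (forall i, measurable (B i)) ->
    \int[P]_w (\1_A (a w) * \prod_(i < n) \1_(B i) (tnth (x w) i)) =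
    \int[P]_w (\1_A (a w) * \int[k (a w)]_v \prod_(i < n) \1_(B i) (tnth v i))) ->
  forall u : T * n.-tuple X -> R, bmeas u ->
  \int[P]_w u (a w, x w) = \int[P]_w \int[k (a w)]_v u (a w, v).
Proof.
move=> rect.
have ax : measurable_fun setT (fun w => (a w, x w)) by exact: measurable_fun_pair.
have av : measurable_fun setT (fun z : W * n.-tuple X => (a z.1, z.2)).
  by apply: measurable_fun_pair => //; exact: measurableT_comp.
pose k1 : R.-pker unit ~> (T * n.-tuple X)%type :=
  pkcomp (kcst P) (kpre (kdirac ax) measurable_snd).
pose k2 : R.-pker unit ~> (T * n.-tuple X)%type := pkcomp (kcst P)
  (kpre (pkcomp (kpre k ma) (kdirac av)) measurable_snd).
have k1E u : bmeas u -> \int[k1 tt]_z u z = \int[P]_w u (a w, x w).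
  move=> bu; rewrite Rint_pkcomp//; apply: eq_Rintegral => w _.
  by rewrite Rint_kdirac//; exact: bu.1.
have k2E u : bmeas u -> \int[k2 tt]_z u z = \int[P]_w \int[k (a w)]_v u (a w, v).
  move=> bu; rewrite Rint_pkcomp//; apply: eq_Rintegral => w _.
  rewrite Rint_pkcomp//; apply: eq_Rintegral => v _.
  by rewrite Rint_kdirac//; exact: bu.1.
have kk D : measurable D -> k1 tt D = k2 tt D.
  apply: rectangle_measure_unique; first by rewrite prob_kernel ltry.
  move=> A B mA mB; have mD := measurable_rectangle mA mB.
  have bD := bmeas_indic R mD.
  have fin (kk : R.-pker unit ~> (T * n.-tuple X)%type) :
      kk tt (rectangle A B) = (\int[kk tt]_z \1_(rectangle A B) z)%:E.
    rewrite Rint_indic// fineK// ge0_fin_numE//.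
    rewrite (@le_lt_trans _ _ (kk tt setT))// ?le_measure ?inE//.
    by rewrite prob_kernel ltry.
  have rE z : \1_(rectangle A B) z = \1_A z.1 * \prod_(i < n) \1_(B i) (tnth z.2 i) :> R.
    rewrite prod_indic !indicE -natrM mulnb; congr (_ %:R); congr nat_of_bool.
    by apply/idP/andP; rewrite !inE.
  rewrite !fin k1E// k2E//; congr EFin.
  under eq_Rintegral do rewrite rE; rewrite rect//.
  apply: eq_Rintegral => w _; rewrite -(RintZ (prob_kernel _)).
    by apply: eq_Rintegral => v _; rewrite rE.
  by apply: bmeas_prod => i; apply: bmeas_tnth; exact: bmeas_indic.
move=> u bu; rewrite -k1E// -k2E// /Rintegral.
by congr fine; apply: eq_measure_integral => D mD _; exact: kk.
Qed.

End disintegration.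

(** * Uniqueness of conditional expectations *)

Section conditional_expectation.
Context d (W : measurableType d) (R : realType) (P : probability W R).

Lemma sub_generators (G H : set (set W)) A : G `<=` H -> <<s G >> A -> <<s H >> A.
Proof. by move=> GH; exact: sub_sigma_algebra2. Qed.

Lemma measurable_generators dT (T : measurableType dT) I (K : set I)
    (Z : I -> {RV P >-> T}) : <<s generators K Z >> `<=` measurable.
Proof.
apply: smallest_sub; first exact: sigma_algebra_measurable.
by move=> _ [i _ [B mB <-]]; apply: measurable_funPT.
Qed.

Lemma integral_indicM (u : W -> R) A :
  (\int[P]_(w in A) (u w)%:E = \int[P]_w (\1_A w * u w)%:E)%E.
Proof.
rewrite [LHS]integral_mkcond; apply: eq_integral => w _; rewrite patchE indicE.
by case: ifPn => _; rewrite ?mul1r ?mul0r.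
Qed.

Lemma Rint_cond_expectation G (f Z : W -> R) A :
  is_cond_expectation P G f Z -> <<s G >> A ->
  \int[P]_w (\1_A w * Z w) = \int[P]_w (\1_A w * f w).
Proof.
by move=> [_ _ /(_ A)] /[apply]; rewrite [LHS]integral_indicM [RHS]integral_indicM /Rintegral => ->.
Qed.

Lemma cond_expectation_unique G (f Z F : W -> R) :
  <<s G >> `<=` measurable ->
  is_cond_expectation P G f Z -> P.-integrable setT (EFin \o F) ->
  measurable_fun [set: g_sigma_algebraType G] (F : g_sigma_algebraType G -> R) ->
  (forall A, <<s G >> A ->
    (\int[P]_(w in A) (F w)%:E = \int[P]_(w in A) (f w)%:E)%E) ->
  {ae P, forall w, Z w = F w}.
Proof.
move=> Gm [mZ iZ fZ] iF mF fF.
have mZ' : measurable_fun [set: g_sigma_algebraType G] (Z : g_sigma_algebraType G -> R).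
  by move=> _ B mB; rewrite setTI; exact: mZ.
have key (u v : W -> R) :
    measurable_fun [set: g_sigma_algebraType G] (u : g_sigma_algebraType G -> R) ->
    measurable_fun [set: g_sigma_algebraType G] (v : g_sigma_algebraType G -> R) ->
    P.-integrable setT (EFin \o u) -> P.-integrable setT (EFin \o v) ->
    (forall A, <<s G >> A ->
      (\int[P]_(w in A) (u w)%:E = \int[P]_(w in A) (v w)%:E)%E) ->
    {ae P, forall w, u w <= v w}.
  move=> mu mv iu iv uv; pose A := [set w | v w < u w].
  have GA : <<s G >> A.
    have := measurable_funB mu mv measurableT (measurable_itv `]0, +oo[%R).
    rewrite setTI (_ : _ @^-1` _ = A)//.
    by apply/seteqP; split=> w/=; rewrite in_itv/= andbT subr_gt0.
  have mA : measurable A by exact: Gm.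
  have iuA : P.-integrable A (EFin \o u) by exact: integrableS iu.
  have ivA : P.-integrable A (EFin \o v) by exact: integrableS iv.
  have AE : (\int[P]_(w in A) `|((u w)%:E - (v w)%:E)| = 0)%E.
    transitivity (\int[P]_(w in A) ((u w)%:E - (v w)%:E))%E.
      apply: eq_integral => w; rewrite inE => Aw.
      by rewrite gee0_abs// sube_ge0// lee_fin ltW.
    rewrite integralB_EFin// uv// subee//.
    exact: integrable_fin_num ivA.
  have mD : measurable_fun A (fun w => (u w)%:E - (v w)%:E)%E.
    by have /integrableP[] := integrableB mA iuA ivA.
  have [h _] := ae_eq_integral_abs P mA mD.
  apply: filterS (h AE) => w /(_ _)/= hw; rewrite leNgt; apply/negP => vu.
  by have [/eqP] := hw vu; rewrite subr_eq0 gt_eqF.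
have h1 := key Z F mZ' mF iZ iF (fun A GA => etrans (fZ A GA) (esym (fF A GA))).
have h2 := key F Z mF mZ' iF iZ (fun A GA => etrans (fF A GA) (esym (fZ A GA))).
by apply: filterS2 h1 h2 => w ? ?; apply/eqP; rewrite eq_le; apply/andP.
Qed.

End conditional_expectation.

(** * The conditional law of the particles *)

Section filter_law.
Context d (W : measurableType d) (R : realType) (P : probability W R)
  dX dY (X : measurableType dX) (Y : measurableType dY).
Variables (Q : R.-pker X ~> X) (g : {mfun (X * Y)%type >-> R}).
Hypothesis g_gt0 : forall x y, 0 < g (x, y).
Variables (chi : probability X R) (Yobs : int -> {RV P >-> Y}) (n : nat).
Hypothesis n_gt0 : (0 < n)%N.
Variables (N : nat) (xi : nat -> 'I_N.+1 -> {RV P >-> X})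
  (anc : nat -> 'I_N.+1 -> W -> 'I_N.+1).
Hypothesis BF : bootstrap_filter Yobs Q g chi xi anc.

Local Notation G0 := (generators [set k : int | 0 <= k < n%:Z] Yobs).
Local Notation T0 := (g_sigma_algebraType G0).

(** The observations seen as functions on the same set with the smaller
    sigma-algebra generated by the window; outside the window the value at time 0 is a
    harmless default that keeps them measurable. *)
Definition window_obs (k : nat) : T0 -> Y := Yobs (if (k < n)%N then k%:Z else 0).

Lemma measurable_window_obs k : measurable_fun setT (window_obs k).
Proof.
move=> _ B mB; rewrite setTI; apply: sub_sigma_algebra.
exists (if (k < n)%N then k%:Z else 0); last by exists B => //; rewrite setTI.
by rewrite /=; case: ifP => kn; rewrite ?lexx ?ltz_nat ?n_gt0.
Qed.

Lemma obs_blockE w m : (m <= n)%N -> obs_block Yobs m w = obs (window_obs^~ w) m.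
Proof.
move=> mn; apply/eq_in_map => k; rewrite mem_iota add0n => /andP[_ km].
by rewrite /window_obs (leq_trans km mn).
Qed.

Definition particles (m : nat) (w : W) : N.+1.-tuple X := [tuple xi m i w | i < N.+1].

Lemma measurable_particles m : measurable_fun setT (particles m).
Proof.
apply/measurable_fun_tnthP => i.
rewrite (_ : _ \o _ = xi m i); first exact: measurable_funPT.
by apply/funext => w /=; rewrite tnth_mktuple.
Qed.

Lemma particle_predictorE m (h : X -> R) w :
  particle_predictor xi m h w = emean h (particles m w).
Proof.
by rewrite /particle_predictor /emean; congr (_ * _); apply: eq_bigr => i _; rewrite tnth_mktuple.
Qed.

Let window_past A : <<s G0 >> A -> <<s generators setT Yobs >> A.
Proof.
move=> GA; have GH : G0 `<=` generators setT Yobs by move=> B [k _ kB]; exists k.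
exact: (sub_generators GH GA).
Qed.

Let window_measurable A : <<s G0 >> A -> measurable A.
Proof. by move=> /window_past; exact: measurable_generators. Qed.

Lemma measurable_window : measurable_fun setT (id : W -> T0).
Proof. by move=> _ A mA; rewrite setTI; exact: window_measurable. Qed.

Local Notation law := (law Q g_gt0 chi measurable_window_obs N).
Local Notation select := (select Q g_gt0 measurable_window_obs N).

Let bprodB (B : 'I_N.+1 -> set X) : (forall i, measurable (B i)) ->
  bmeas (fun v : N.+1.-tuple X => \prod_(i < N.+1) (\1_(B i) (tnth v i) : R)).
Proof. by move=> mB; apply: bmeas_prod => i; apply: bmeas_tnth; exact: bmeas_indic. Qed.

Lemma initial_rectangle (A : set W) (B : 'I_N.+1 -> set X) :
  <<s G0 >> A -> (forall i, measurable (B i)) ->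
  \int[P]_w (\1_A w * \prod_(i < N.+1) \1_(B i) (tnth (particles 0 w) i)) =
  \int[P]_w (\1_A w * \prod_(i < N.+1) fine (chi (B i))).
Proof.
move=> GA mB; have [_ /(_ B mB) c0 _] := BF.
rewrite (Rint_cond_expectation c0 (window_past GA)).
apply: eq_Rintegral => w _; congr (_ * _); rewrite prod_indic !indicE; congr (_%:R).
congr nat_of_bool; apply/idP/idP; rewrite !inE /= => h i; have := h i;
  by rewrite tnth_mktuple.
Qed.

(** Summing the given conditional probabilities over all the ancestor vectors and
    exchanging sum and product turns them into a product of selection
    probabilities. *)
Lemma transition_rectangle m (A : set W) (B : 'I_N.+1 -> set X) : (m < n)%N ->
  <<s G0 >> A -> (forall i, measurable (B i)) ->
  \int[P]_w (\1_A w * \prod_(i < N.+1) \1_(B i) (tnth (particles m.+1 w) i)) =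
  \int[P]_w (\1_A w * \prod_(i < N.+1) \int[select m (w, particles m w)]_x \1_(B i) x).
Proof.
move=> mn GA mB; have [manc _ /(_ m) cS] := BF.
have bA : bmeas (\1_A : W -> R) by apply: bmeas_indic; exact: window_measurable.
have past : <<s filter_past Yobs xi anc m >> A.
  have GH : generators setT Yobs `<=` filter_past Yobs xi anc m by move=> D GD; left; left.
  exact: (sub_generators GH (window_past GA)).
have bB i : bmeas (\1_(B i) : X -> R) by exact: bmeas_indic.
pose I (a : {ffun 'I_N.+1 -> 'I_N.+1}) : W -> R :=
  \1_[set w | forall i, anc m i w = a i /\ B i (xi m.+1 i w)].
pose K (a : {ffun 'I_N.+1 -> 'I_N.+1}) (w : W) : R := \prod_(i < N.+1)
  (weight (potential g window_obs m) (w : T0, particles m w) (a i) *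
   \int[Q (tnth (particles m w) (a i))]_x \1_(B i) x).
have cK a : \int[P]_w (\1_A w * I a w) = \int[P]_w (\1_A w * K a w).
  rewrite -(Rint_cond_expectation (cS a B mB) past).
  apply: eq_Rintegral => w _; congr (_ * _); apply: eq_bigr => i _.
  rewrite Rint_indic// tnth_mktuple; congr (_ * _).
  rewrite /weight /potential /= /window_obs mn tnth_mktuple; congr (_ / _).
  by apply: eq_bigr => l _; rewrite tnth_mktuple.
have IE w : \sum_a I a w = \prod_(i < N.+1) \1_(B i) (tnth (particles m.+1 w) i).
  transitivity (\prod_(i < N.+1) \sum_(j < N.+1)
      ((anc m i w == j)%:R * \1_(B i) (xi m.+1 i w)) : R).
    rewrite bigA_distr_bigA; apply: eq_bigr => a _.
    rewrite /I indicE; have [/set_mem h|/negP h] := boolP (w \in _).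
      apply/esym/big1 => i _; have [-> Bi] := h i.
      by rewrite eqxx mul1r indicE mem_set.
    have [i hi] : exists i, ~ (anc m i w = a i /\ B i (xi m.+1 i w)).
      by apply/existsNP => h'; apply: h; rewrite inE.
    rewrite (bigD1 i)//= indicE; have [e|] := eqVneq; last by rewrite mul0r mul0r.
    by rewrite memNset ?mulr0 ?mul0r// => Bi; exact: hi.
  apply: eq_bigr => i _; rewrite -mulr_suml (bigD1 (anc m i w))//= eqxx big1 ?addr0 ?mul1r.
    by rewrite tnth_mktuple.
  by move=> j /negbTE; rewrite eq_sym => ->.
have KE w : \sum_a K a w = \prod_(i < N.+1) \int[select m (w, particles m w)]_x \1_(B i) x.
  rewrite /K -(bigA_distr_bigA (fun i l =>
    weight (potential g window_obs m) (w : T0, particles m w) l *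
    \int[Q (tnth (particles m w) l)]_x \1_(B i) x)).
  by apply: eq_bigr => i _; rewrite Rint_selection.
have mJ : measurable_fun setT (fun w : W => (w : T0, particles m w)).
  by apply: measurable_fun_pair; [exact: measurable_window|exact: measurable_particles].
have bI a : bmeas (I a).
  apply: bmeas_indic; rewrite (_ : [set w | _] = \big[setI/setT]_(i < N.+1)
      ((anc m i @^-1` [set a i]) `&` (xi m.+1 i @^-1` B i))).
    apply: bigsetI_measurable => i _; apply: measurableI; first exact: manc.
    by rewrite -[X in measurable X]setTI; exact: measurable_funPT.
  rewrite -bigcap_seq; apply/seteqP; split => w h i.
    by move=> _; exact: h.
  by apply: h; rewrite /= mem_index_enum.
have bK a : bmeas (K a).
  apply: bmeas_prod => i; apply: bmeasM.
    have bw : bmeas (fun z : T0 * N.+1.-tuple X =>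
        weight (potential g window_obs m) z (a i)).
      have pot0 := potential_gt0 g_gt0 window_obs m.
      split; first exact: (measurable_weight (measurable_potential g measurable_window_obs m)).
      exists 1 => z; rewrite ger0_norm ?weight_ge0// -(sum_weight pot0 z) (bigD1 (a i))//=.
      by rewrite lerDl sumr_ge0// => l _; exact: weight_ge0.
    exact: (bmeas_comp mJ bw).
  have bQ : bmeas (fun v : N.+1.-tuple X => \int[Q (tnth v (a i))]_x (\1_(B i) x : R)).
    by apply: (bmeas_tnth (u := fun x => \int[Q x]_z \1_(B i) z)); exact: bmeas_kernel.
  exact: (bmeas_comp (measurable_particles m) bQ).
have P1 := probability_setT P.
under eq_Rintegral do rewrite -IE mulr_sumr.
rewrite (Rint_sum P1); last by move=> a; exact: bmeasM.
under eq_bigr do rewrite cK.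
rewrite -(Rint_sum P1); last by move=> a; exact: bmeasM.
by apply: eq_Rintegral => w _; rewrite -KE mulr_sumr.
Qed.

(** Although the transitions of the filter are conditional on the whole sequence of
    observations, they depend on the window only; the induction hypothesis is used with
    the transition probability of a rectangle as test function. *)
Lemma filter_law m : (m <= n)%N -> forall u : T0 * N.+1.-tuple X -> R, bmeas u ->
  \int[P]_w u (w : T0, particles m w) = \int[P]_w \int[law m w]_v u (w : T0, v).
Proof.
elim: m => [_|m ih mn].
  apply: (disintegration measurable_window (measurable_particles 0)) => A B mA mB.
  rewrite initial_rectangle//; apply: eq_Rintegral => w _; congr (_ * _).
  have bB i : bmeas (\1_(B i) : X -> R) by exact: bmeas_indic.
  rewrite (Rint_kpow_prod (kcst chi) (w : T0) bB).
  by apply: eq_bigr => i _; rewrite Rint_indic.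
apply: (disintegration measurable_window (measurable_particles m.+1)) => A B mA mB.
have bA : bmeas (\1_A : T0 -> R) by exact: bmeas_indic.
rewrite transition_rectangle//.
pose u (z : T0 * N.+1.-tuple X) : R := \1_A z.1 *
  \int[kpow (select m) N.+1 z]_v \prod_(i < N.+1) \1_(B i) (tnth v i).
have bkp := bmeas_kernel (kpow (select m) N.+1) (bprodB mB).
have bu : bmeas u by apply: bmeasM => //; exact: (bmeas_comp measurable_fst bA).
transitivity (\int[P]_w u (w : T0, particles m w)).
  have bB i : bmeas (\1_(B i) : X -> R) by exact: bmeas_indic.
  by apply: eq_Rintegral => w _; rewrite /u (Rint_kpow_prod (select m) _ bB).
rewrite (ih (ltnW mn) u bu); apply: eq_Rintegral => w _.
have bkw := bmeas_comp (pair1_measurable (w : T0)) bkp.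
have -> : \int[law m w]_v u (w : T0, v) = \1_A w * \int[law m w]_v
    \int[kpow (select m) N.+1 (w : T0, v)]_v' \prod_(i < N.+1) \1_(B i) (tnth v' i).
  exact: (RintZ (prob_kernel (w : T0)) (\1_A w) bkw).
by rewrite -Rint_pkcomp//; exact: bprodB.
Qed.

Lemma cond_moment (f : X -> R) (p : R) (Z : W -> R) : bmeas f -> 0 < p ->
  is_cond_expectation P G0 (fun w => `|particle_predictor xi n f w
    - \int[predictor Q g chi (obs_block Yobs n w)]_x f x| `^ p) Z ->
  {ae P, forall w, Z w = \int[law n w]_v
    `|emean f v - \int[predictor Q g chi (obs (window_obs^~ w) n)]_x f x| `^ p}.
Proof.
move=> bf p0 cZ.
pose u (z : T0 * N.+1.-tuple X) := `|emean f z.2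
  - \int[predictor Q g chi (obs (window_obs^~ z.1) n)]_x f x| `^ p.
have bu : bmeas u.
  apply: bmeas_powR; first exact: ltW.
  apply: bmeasB; first exact: (bmeas_comp measurable_snd (bmeas_emean N bf)).
  exact: (bmeas_comp measurable_fst
    (bmeas_predictor Q g chi measurable_window_obs n bf)).
have bF : bmeas (fun w : T0 => \int[law n w]_v u (w, v)) by exact: bmeas_kernel2.
have bFW := bmeas_comp measurable_window bF.
have bup : bmeas (fun w : W => u (w : T0, particles n w)).
  apply: (bmeas_comp (f := u) (a := fun w : W => (w : T0, particles n w))) => //.
  by apply: measurable_fun_pair; [exact: measurable_window|exact: measurable_particles].
have P1 := probability_setT P.
apply: (cond_expectation_unique _ cZ).
- exact: window_measurable.
- exact: (bmeas_integrable P1 bFW).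
- exact: bF.1.
move=> A GA.
have bA : bmeas (\1_A : T0 -> R) by exact: bmeas_indic.
have bAW : bmeas (\1_A : W -> R) by apply: bmeas_indic; exact: window_measurable.
have E (v : W -> R) : bmeas v ->
    (\int[P]_(w in A) (v w)%:E = (\int[P]_w (\1_A w * v w))%:E)%E.
  by move=> bv; rewrite -(bmeas_EFin P1 (bmeasM bAW bv)) integral_indicM.
rewrite E//.
transitivity ((\int[P]_w (\1_A w * u (w : T0, particles n w)))%:E); last first.
  rewrite -(E _ bup); apply: eq_integral => w _.
  by rewrite /u /= -particle_predictorE obs_blockE.
have bAu : bmeas (fun z : T0 * N.+1.-tuple X => \1_A z.1 * u z).
  by apply: bmeasM => //; exact: (bmeas_comp measurable_fst bA).
rewrite (filter_law (leqnn n) bAu); congr EFin.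
apply: eq_Rintegral => w _; apply/esym.
exact: (RintZ (prob_kernel (w : T0)) (\1_A w) (bmeas_comp (pair1_measurable (w : T0)) bu)).
Qed.

End filter_law.

(** * Essential boundedness of the density along the observations *)

Section essentially_bounded_density.
Context d (W : measurableType d) (R : realType) (P : probability W R)
  dX dY (X : measurableType dX) (Y : measurableType dY).
Variables (Q : R.-pker X ~> X) (g : {mfun (X * Y)%type >-> R}).
Hypothesis g_gt0 : forall x y, 0 < g (x, y).
Variables (chi : probability X R) (Yobs : int -> {RV P >-> Y}).

Lemma ae_bounded_density :
  P.-integrable setT (fun w => lneplus (supnorm_at g (Yobs 0 w))) ->
  {ae P, forall w, exists M : nat, forall x, g (x, Yobs 0 w) <= M%:R}.
Proof.
move=> /(integrable_ae measurableT); apply: filterS => w /(_ Logic.I).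
set S := supnorm_at g (Yobs 0 w) => fin.
have gS x : ((g (x, Yobs 0 w))%:E <= S)%E.
  apply: ereal_sup_ubound; exists x => //; congr EFin.
  by rewrite ger0_norm// ltW.
case: S fin gS => [s _ gs|fin _|_ gs].
- exists (Num.bound `|s|) => x.
  have := gs x; rewrite lee_fin => /le_trans; apply.
  by rewrite (le_trans (ler_norm s))// ltW// archi_boundP.
- by move: fin; rewrite /lneplus /= maxye.
- by have := gs point; rewrite leeNy_eq.
Qed.

Hypothesis stat : strictly_stationary Yobs.
Hypothesis mom : P.-integrable setT (fun w => lneplus (supnorm_at g (Yobs 0 w))).

(** Stationarity only applies to measurable events, whereas the event that the
    supremum of g(., Y_m) is finite may not be measurable. Essential boundedness given
    the m previous observations is; for (Y_{-m}, ..., Y_0) it follows from the bound at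
    time 0, and stationarity moves it to (Y_0, ..., Y_m). *)
Lemma ae_essentially_bounded m : {ae P, forall w, exists M : nat,
  upredictor Q g chi (obs_block Yobs m w) [set x | M%:R < g (x, Yobs m%:Z w)] = 0%E}.
Proof.
pose ob (k : nat) (t : m.+1.-tuple Y) := tnth t (inord k).
have mob k : measurable_fun setT (ob k) by exact: measurable_tnth.
pose B := [set t | exists M : nat,
  upredictor Q g chi (obs (ob^~ t) m) [set x | M%:R < g (x, ob m t)] = 0%E].
have mB : measurable B := measurable_essentially_bounded Q g chi mob m.
pose tY (t : 'I_m.+1 -> int) w := [tuple Yobs (t i) w | i < m.+1].
have mtY t : measurable [set w | (~` B) (tY t w)].
  have mt : measurable_fun setT (tY t).
    apply/measurable_fun_tnthP => i.
    rewrite (_ : _ \o _ = Yobs (t i)); first exact: measurable_funPT.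
    by apply/funext => w /=; rewrite tnth_mktuple.
  by have := mt measurableT _ (measurableC mB); rewrite setTI.
pose now (i : 'I_m.+1) : int := i%:Z.
pose past (i : 'I_m.+1) : int := i%:Z - m%:Z.
have past0 : P [set w | (~` B) (tY past w)] = 0%E.
  apply/(measure_negligible (mtY past)).
  apply: negligibleS (ae_bounded_density mom) => w /= nB.
  apply: contra_not nB => -[M gM]; exists M.
  rewrite (_ : [set x | _] = set0) ?measure0//.
  apply/seteqP; split => x //=; rewrite /ob tnth_mktuple /past inordK// subrr.
  by rewrite ltNge gM.
have := stat past m%:Z (measurableC mB).
rewrite [RHS]past0 => now0.
have nowE w : [tuple Yobs (past i + m%:Z) w | i < m.+1] = tY now w.
  by apply: eq_from_tnth => i; rewrite !tnth_mktuple subrK.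
have : P.-negligible [set w | (~` B) (tY now w)].
  exists [set w | (~` B) (tY now w)]; split => //; rewrite -[RHS]now0; congr (P _).
  by apply/funext => w /=; rewrite nowE.
apply: negligibleS => w /= nB BY; apply: nB; case: BY => M.
rewrite /ob tnth_mktuple /now inordK// => h; exists M; rewrite -[RHS]h.
congr (upredictor Q g chi _ _); apply/eq_in_map => k.
rewrite mem_iota add0n => /andP[_ km].
by rewrite tnth_mktuple inordK// ltnS ltnW.
Qed.

Lemma ae_common_bound n : {ae P, forall w, exists2 M : R, 0 < M &
  forall m, (m < n)%N ->
  upredictor Q g chi (obs_block Yobs m w) [set x | M < g (x, Yobs m%:Z w)] = 0%E}.
Proof.
have h := ae_foralln ae_essentially_bounded.
apply: filterS h => w; elim: n => [|n ih] hw; first by exists 1.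
have [M M0 hM] := ih hw; have [M' hM'] := hw n.
have mexceed (K : R) m : measurable [set x | K < g (x, Yobs m%:Z w)].
  exact: (measurable_exceed g (fun k : nat => Yobs k%:Z w) K m).
exists (Num.max M M'%:R); first by rewrite lt_max M0.
move=> m; rewrite ltnS leq_eqVlt => /orP[/eqP ->|mn].
  apply: (subset_measure0 (mexceed _ _) (mexceed _ _) _ hM') => x /=.
  by rewrite gt_max => /andP[].
apply: (subset_measure0 (mexceed _ _) (mexceed _ _) _ (hM _ mn)) => x /=.
by rewrite gt_max => /andP[].
Qed.

End essentially_bounded_density.

(** * The limit theorem *)

Lemma root_gauss_limit (R : realType) (V gam p : R) : 0 <= V -> 0 <= gam -> 0 < p ->
  ((2 * V) `^ (p / 2) * gam) `^ p^-1 = Num.sqrt 2 * Num.sqrt V * gam `^ p^-1.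
Proof.
move=> V0 gam0 p0; rewrite powRM ?powR_ge0// -powRrM.
have -> : p / 2 * p^-1 = 2^-1 by field; rewrite gt_eqF.
by rewrite powR12_sqrt ?mulr_ge0// sqrtrM.
Qed.

Theorem theorem12 (R : realType)
    (dX dY d : measure_display)
    (X : measurableType dX) (Y : measurableType dY) (W : measurableType d)
    (P : probability W R)
    (X_cg : countably_generated X)
    (Q : R.-pker X ~> X)
    (nu : {sigma_finite_measure set Y -> \bar R})
    (g : {mfun (X * Y)%type >-> R})
    (g_gt0 : forall x y, 0 < g (x, y))
    (g_density : forall x, (\int[nu]_y (g (x, y))%:E = 1)%E)
    (Yobs : int -> {RV P >-> Y})
    (Yobs_stationary : strictly_stationary Yobs)
    (g_log_moment : P.-integrable setT
       (fun w => lneplus (supnorm_at g (Yobs 0 w))))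
    (h : X -> R) (h_measurable : measurable_fun setT h)
    (h_bounded : exists M : R, forall x, `|h x| <= M)
    (p : R) (p_gt0 : 0 < p)
    (chi : probability X R)
    (n : nat) (n_gt0 : (0 < n)%N)
    (xi : forall N : nat, nat -> 'I_N -> {RV P >-> X})
    (anc : forall N : nat, nat -> 'I_N -> W -> 'I_N)
    (particles : forall N : nat, (0 < N)%N ->
       bootstrap_filter Yobs Q g chi (xi N) (anc N))
    (E : nat -> W -> R)
    (E_cond : forall N : nat, (0 < N)%N ->
       is_cond_expectation P
         (generators [set k : int | 0 <= k < n%:Z] Yobs)
         (fun w => `|particle_predictor (xi N) n h w
                     - \int[predictor Q g chi (obs_block Yobs n w)]_x h x| `^ p)
         (E N)) :
  {ae P, forall w,
    (fun N : nat => Num.sqrt N%:R * E N w `^ p^-1) @ \oo -->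
      Num.sqrt 2 * asymptotic_std Q g chi (obs_block Yobs n w) h
      * (Gamma ((p + 1) / 2) / Num.sqrt pi) `^ p^-1}.
Proof.
have bh : bmeas h by [].
have p_inv : 0 < p^-1 by rewrite invr_gt0.
have E_law N := cond_moment g_gt0 n_gt0 (particles N.+1 isT) bh p_gt0 (E_cond N.+1 isT).
have bound := ae_common_bound Q g_gt0 chi Yobs_stationary g_log_moment n.
apply: filterS2 (ae_foralln E_law) bound => w Ew [M M0 gM].
pose ob := @window_obs _ _ _ _ _ _ Yobs n.
pose mob := measurable_window_obs (Yobs := Yobs) n_gt0.
have obsE m : (m <= n)%N -> obs_block Yobs m w = obs (ob^~ w) m by exact: obs_blockE.
have good m : (m < n)%N ->
    upredictor Q g chi (obs (ob^~ w) m) [set x | M < g (x, ob m w)] = 0%E.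
  move=> mn; have obm : ob m w = Yobs m%:Z w by rewrite /ob /window_obs mn.
  have := gM m mn; rewrite (obsE m (ltnW mn)) -obm; exact.
have := law_moment_limit g_gt0 mob M0 good bh p_gt0.
rewrite obsE// /asymptotic_std.
set c := \int[_]_x h x; set V := asymptotic_variance _ _ _ _ _.
set gam := Gamma _ / _; set u := (fun N => _) => lim.
have V0 : 0 <= V by exact: asymptotic_variance_ge0.
have gam0 : 0 <= gam.
  rewrite divr_ge0 ?sqrtr_ge0// Rintegral_ge0// => t _.
  by rewrite mulr_ge0 ?powR_ge0 ?expR_ge0.
have uE N : Num.sqrt N.+1%:R * E N.+1 w `^ p^-1 = `|u N| `^ p^-1.
  have p1 : law Q g_gt0 chi mob N n w setT = 1%E by exact: prob_kernel.
  have bc : bmeas (fun v : N.+1.-tuple X => `|emean h v - c| `^ p).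
    apply: bmeas_powR; first exact: ltW.
    by apply: bmeasB; [exact: bmeas_emean|exact: bmeas_cst].
  have -> : u N = Num.sqrt N.+1%:R `^ p * E N.+1 w.
    rewrite Ew -(RintZ p1 _ bc); apply: eq_Rintegral => v _.
    by rewrite /dev normrM powRM// (ger0_norm (sqrtr_ge0 _)).
  have E0 : 0 <= E N.+1 w by rewrite Ew; apply: Rint_ge0 => v; exact: powR_ge0.
  rewrite ger0_norm ?mulr_ge0 ?powR_ge0// powRM ?powR_ge0// -powRrM mulfV ?gt_eqF//.
  by rewrite powRr1 ?sqrtr_ge0.
(* The particle numbers are at least 1 in the lemmas, where N stands for N + 1. *)
rewrite -(cvg_shiftS _) /=; under eq_fun do rewrite uE.
rewrite -root_gauss_limit// -[X in X `^ p^-1]ger0_norm; last first.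
  by rewrite mulr_ge0 ?powR_ge0.
set l := _ * gam in lim *.
have pow_cont : {for l, continuous (fun x : R => `|x| `^ p^-1)}.
  exact: continuous_norm_powR.
have := continuous_cvg _ pow_cont lim; exact.
Qed.
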